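(* Let $G$ be a series parallel digraph on $n$ vertices. There is an algorithm that computes in time $\mathcal{O}(n^2)$ the modified cutwidth of $G$, and outputs a topological ordering of $G$ that achieves it.
   Context: Digraphs may have parallel arcs. A topological order of a directed acyclic graph $G$ on $n$ vertices is a bijection $\sigma: V(G)\to[n]$ with $\sigma(u)<\sigma(v)$ for every arc $uv$. The modified cutwidth of $\sigma$ is $\max_{i\in[n]} |\{uv\in A(G): \sigma(u)< i,\ \sigma(v)>i\}|$, and the modified cutwidth of $G$ is the minimum modified cutwidth over all topological orders of $G$. A series parallel digraph (SPD) is a (multi)digraph $G$ with an ordered pair of terminals $(s,t)$ defined recursively: a single arc from $s$ to $t$ is an SPD; if $(G_1,(s_1,t_1))$ and $(G_2,(s_2,t_2))$ are SPDs, then so is their series composition (disjoint union with $t_1$ and $s_2$ identified, terminals $(s_1,t_2)$) and their parallel composition (disjoint union with $s_1,s_2$ identified and $t_1,t_2$ identified, terminals $(s_1,t_1)$). *)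

(* Defs.v *)
From mathcomp Require Import all_boot.

Set Implicit Arguments.
Unset Strict Implicit.
Unset Printing Implicit Defensive.

Record digraph := Digraph {
  vertex : finType;
  arc : finType;
  tail : arc -> vertex;
  head : arc -> vertex
}.

Arguments tail {d} a.
Arguments head {d} a.

(* Positions are numbered from 0: ['I_n] stands for {1, ..., n}. *)

Definition topological (G : digraph)
    (sigma : {ffun vertex G -> 'I_#|vertex G|}) : bool :=
  [&& injectiveb sigma, [forall i, i \in codom sigma]
    & [forall a : arc G, sigma (tail a) < sigma (head a)]].

Definition order_mcw (G : digraph)
    (sigma : {ffun vertex G -> 'I_#|vertex G|}) : nat :=
  \max_(i < #|vertex G|)
    #|[set a : arc G | (sigma (tail a) < i) && (i < sigma (head a))]|.

(* [#|arc G|] bounds every [order_mcw sigma], so as the default value of the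
   big operator it does not affect a minimum over a nonempty set of orders. *)
Definition mcw (G : digraph) : nat :=
  \big[minn/#|arc G|]_(sigma | topological sigma) @order_mcw G sigma.

Lemma mcw_le (G : digraph) (sigma : {ffun vertex G -> 'I_#|vertex G|}) :
  topological sigma -> mcw G <= order_mcw sigma.
Proof.
move=> sP; rewrite /mcw unlock /=.
elim: (index_enum _) (mem_index_enum sigma) => //= s r IHr.
rewrite inE => /predU1P[<-|/IHr le_r]; first by rewrite sP geq_minl.
by case: ifP => // _; apply: leq_trans le_r; exact: geq_minr.
Qed.

Lemma mcw_attained (G : digraph) (tau : {ffun vertex G -> 'I_#|vertex G|}) :
  topological tau ->
  exists2 sigma : {ffun vertex G -> 'I_#|vertex G|},
    topological sigma & order_mcw sigma = mcw G.
Proof.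
move=> tauP.
have ub (s : {ffun vertex G -> 'I_#|vertex G|}) : order_mcw s <= #|arc G|.
  by apply/bigmax_leqP => i _; exact: max_card.
have [] : mcw G = #|arc G| \/ exists2 sigma : {ffun vertex G -> 'I_#|vertex G|},
    topological sigma & order_mcw sigma = mcw G.
- rewrite /mcw; elim/big_ind: _ => [|x y Hx Hy|s sP]; first by left.
  + by rewrite /minn; case: ifP.
  + by right; exists s.
- move=> E; exists tau => //; apply/eqP; rewrite eqn_leq mcw_le // andbT.
  by rewrite E.
- by [].
Qed.

Record tdigraph := TDigraph {
  graph :> digraph;
  source : vertex graph;
  sink : vertex graph
}.

Arguments source : clear implicits.
Arguments sink : clear implicits.

Definition isomorphic (G H : tdigraph) : Prop :=
  exists (f : vertex G -> vertex H) (g : arc G -> arc H),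
    [/\ bijective f, bijective g,
        forall a, tail (g a) = f (tail a),
        forall a, head (g a) = f (head a)
      & f (source G) = source H /\ f (sink G) = sink H].

Definition single_arc : tdigraph :=
  @TDigraph (@Digraph bool unit (fun=> false) (fun=> true)) false true.

(* In both compositions the vertices are those of [G1] together with those
   vertices of [G2] that are not identified with a terminal of [G1];
   [series_in2] and [parallel_in2] map each vertex of [G2] to its image. *)

Section Composition.
Variables G1 G2 : tdigraph.

Definition series_vertex : finType :=
  (vertex G1 + {v : vertex G2 | v != source G2})%type.

Definition series_in2 (v : vertex G2) : series_vertex :=
  if insub v is Some u then inr u else inl (sink G1).

Definition series : tdigraph :=
  @TDigraph
    (@Digraph series_vertex (arc G1 + arc G2)%type
      (fun a => match a with
                | inl a1 => inl (tail a1)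
                | inr a2 => series_in2 (tail a2)
                end)
      (fun a => match a with
                | inl a1 => inl (head a1)
                | inr a2 => series_in2 (head a2)
                end))
    (inl (source G1)) (series_in2 (sink G2)).

Definition parallel_vertex : finType :=
  (vertex G1 + {v : vertex G2 | (v != source G2) && (v != sink G2)})%type.

Definition parallel_in2 (v : vertex G2) : parallel_vertex :=
  if insub v is Some u then inr u
  else inl (if v == source G2 then source G1 else sink G1).

Definition parallel : tdigraph :=
  @TDigraph
    (@Digraph parallel_vertex (arc G1 + arc G2)%type
      (fun a => match a with
                | inl a1 => inl (tail a1)
                | inr a2 => parallel_in2 (tail a2)
                end)
      (fun a => match a with
                | inl a1 => inl (head a1)
                | inr a2 => parallel_in2 (head a2)
                end))
    (inl (source G1)) (inl (sink G1)).

End Composition.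

Inductive SPD : tdigraph -> Prop :=
| SPD_arc : SPD single_arc
| SPD_series G1 G2 : SPD G1 -> SPD G2 -> SPD (series G1 G2)
| SPD_parallel G1 G2 : SPD G1 -> SPD G2 -> SPD (parallel G1 G2)
| SPD_iso G H : isomorphic G H -> SPD G -> SPD H.

(** A uniform-cost RAM with structured control flow.  A program uses finitely
    many registers and finitely many unbounded arrays, each named by a constant
    of the program, all holding natural numbers; array cells are addressed by
    computed values.  Every arithmetic operation, memory access, test and
    assignment costs one unit.  Multiplication is deliberately not an
    instruction: with addition and (truncated) subtraction only, the values
    grow by at most a constant number of bits per step, so that unit cost does
    not hide exponentially large numbers. *)

Inductive expr :=
| Const of nat
| Reg of nat
| Read of nat & expr            (* array name, index *)
| Add of expr & expr
| Sub of expr & expr.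

Inductive prog :=
| Skip
| Assign of nat & expr          (* register, value *)
| Write of nat & expr & expr    (* array name, index, value *)
| Seq of prog & prog
| If of expr & prog & prog      (* first branch if the value is nonzero *)
| While of expr & prog.         (* iterate while the value is nonzero *)

Record state := State {
  reg : nat -> nat;
  arr : nat -> nat -> nat
}.

Definition set_reg (s : state) (x v : nat) : state :=
  State (fun y => if y == x then v else reg s y) (arr s).

Definition set_arr (s : state) (a i v : nat) : state :=
  State (reg s)
    (fun b j => if (b == a) && (j == i) then v else arr s b j).

Fixpoint eval (s : state) (e : expr) : nat :=
  match e with
  | Const k => k
  | Reg x => reg s x
  | Read a e1 => arr s a (eval s e1)
  | Add e1 e2 => eval s e1 + eval s e2
  | Sub e1 e2 => eval s e1 - eval s e2
  end.

Fixpoint expr_cost (e : expr) : nat :=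
  match e with
  | Const _ | Reg _ => 1
  | Read _ e1 => (expr_cost e1).+1
  | Add e1 e2 | Sub e1 e2 => (expr_cost e1 + expr_cost e2).+1
  end.

(* [exec p s s' t]: started in [s], the program [p] halts in [s'] after
   exactly [t] units of time. *)
Inductive exec : prog -> state -> state -> nat -> Prop :=
| exec_Skip s : exec Skip s s 1
| exec_Assign x e s :
    exec (Assign x e) s (set_reg s x (eval s e)) (expr_cost e).+1
| exec_Write a e1 e2 s :
    exec (Write a e1 e2) s (set_arr s a (eval s e1) (eval s e2))
      (expr_cost e1 + expr_cost e2).+1
| exec_Seq p1 p2 s1 s2 s3 t1 t2 :
    exec p1 s1 s2 t1 -> exec p2 s2 s3 t2 ->
    exec (Seq p1 p2) s1 s3 (t1 + t2).+1
| exec_IfT e p1 p2 s s' t :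
    eval s e != 0 -> exec p1 s s' t ->
    exec (If e p1 p2) s s' (expr_cost e + t).+1
| exec_IfF e p1 p2 s s' t :
    eval s e = 0 -> exec p2 s s' t ->
    exec (If e p1 p2) s s' (expr_cost e + t).+1
| exec_WhileT e p s1 s2 s3 t1 t2 :
    eval s1 e != 0 -> exec p s1 s2 t1 -> exec (While e p) s2 s3 t2 ->
    exec (While e p) s1 s3 (expr_cost e + t1 + t2).+1
| exec_WhileF e p s :
    eval s e = 0 -> exec (While e p) s s (expr_cost e).+1.

(** A digraph on [n] vertices, numbered [0, ..., n - 1] as in [enum], is given
    by [n] and its matrix of arc multiplicities.  The number of arcs is not
    bounded in terms of [n], so a time bound in [n] alone presupposes an
    encoding in which parallel arcs are not listed one by one. *)

Definition multiplicity (G : digraph) (u v : vertex G) : nat :=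
  #|[set a : arc G | (tail a == u) && (head a == v)]|.

(* Register 0 holds [n], array 0 the matrix in row-major order; all other
   registers and cells are 0. *)
Definition input (G : digraph) : state :=
  State
    (fun x => if x == 0 then #|vertex G| else 0)
    (fun a k =>
       if a == 0 then
         nth 0 [seq multiplicity u v | u <- enum (vertex G),
                                       v <- enum (vertex G)] k
       else 0).

(* Register 0 holds the number [w], array 1 the table of [sigma]. *)
Definition output (G : digraph) (s : state) (w : nat)
    (sigma : {ffun vertex G -> 'I_#|vertex G|}) : Prop :=
  reg s 0 = w /\ forall u : vertex G, arr s 1 (enum_rank u) = sigma u.

(* Main.v *)
(** In a topological order, the number of arcs passing over a vertex [x] is the
    number of arcs leaving the vertices before [x], minus the number of arcs
    entering [x] or a vertex before [x].  So the modified cutwidth is the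
    minimum, over all orders, of a maximum cumulative cost, and exchange
    arguments for sequencing problems apply (Abdel-Wahab and Kameda, Monma and
    Sidney): there is a total preorder on strings of vertices such that swapping
    two neighbouring strings that are in the wrong order never hurts.

    The program reduces the digraph by eliminating vertices with one
    in-neighbour and one out-neighbour.  In a series parallel digraph this ends
    with a single arc, whatever eliminable vertex is chosen, because
    eliminations commute.  Each arc [uw] of the reduced digraph carries a chain,
    an order of the eliminated vertices between [u] and [w] that some optimal
    order respects.  Eliminating [v] concatenates the chain of [uv], [v] and the
    chain of [vw]; this chain is cut into tight strings with nondecreasing
    keys, and then merged by key with the chain that [uw] had before.  Every
    elimination takes linear time. *)

Require Import Defs.
From mathcomp Require Import all_boot.
From mathcomp Require Import zify.
Import Defs.

Set Implicit Arguments.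
Unset Strict Implicit.
Unset Printing Implicit Defensive.

(** * Running programs *)

(** The chain of an arc is fixed long before the vertices that will be interleaved with it are
    known. Hence every exchange is proved for strings in an arbitrary surrounding ([better],
    [dominates]), whose strings keep their relative order.

    Optimality needs no lower bound argument. Each reduction keeps two transfer properties: an order
    that respects the chains is topological, and every topological order can be replaced by one that
    respects the chains and costs no more. When a single arc is left, only one order respects its
    chain, so that order is optimal.

    Costs of whole orders are compared through the bounds [K] that they respect. The number of arcs,
    unbounded in [n], enters only through weighted degrees of the vertices, which elimination does
    not change; a reduced digraph is therefore a mere relation. An elimination takes linear time
    because a chain is a subsequence of a topological order and so has at most [n] vertices. *)

Definition runs p s T (Q : state -> Prop) :=
  exists s' t, [/\ exec p s s' t, t <= T & Q s'].

Lemma runs_weaken p s T T' (Q Q' : state -> Prop) :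
  runs p s T Q -> T <= T' -> (forall s', Q s' -> Q' s') -> runs p s T' Q'.
Proof.
by move=> [s' [t [e le q]]] le' qq; exists s', t; split; [|lia|apply: qq].
Qed.

Lemma runs_le p s T T' Q : T <= T' -> runs p s T Q -> runs p s T' Q.
Proof. by move=> le r; apply: (runs_weaken r le). Qed.

(** The postcondition of [p1] is itself a claim about [p2], so a program is verified front to back
    and its time budget nests like its commands. *)
Lemma runs_seq p1 p2 s T1 T2 Q :
  runs p1 s T1 (fun s' => runs p2 s' T2 Q) -> runs (Seq p1 p2) s (T1 + T2).+1 Q.
Proof.
move=> [s1 [t1 [e1 le1 [s2 [t2 [e2 le2 q]]]]]].
by exists s2, (t1 + t2).+1; split=> //; [apply: exec_Seq e1 e2|lia].
Qed.

Fixpoint loop_free p :=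
  match p with
  | Skip | Assign _ _ | Write _ _ _ => true
  | Seq p1 p2 | If _ p1 p2 => loop_free p1 && loop_free p2
  | While _ _ => false
  end.

(** Final state of loop-free code by computation: such code is verified by simplification instead of
    inversions of [exec]. *)
Fixpoint denote p s :=
  match p with
  | Skip | While _ _ => s
  | Assign x e => set_reg s x (eval s e)
  | Write a e1 e2 => set_arr s a (eval s e1) (eval s e2)
  | Seq p1 p2 => denote p2 (denote p1 s)
  | If e p1 p2 => if eval s e != 0 then denote p1 s else denote p2 s
  end.

Lemma denote_If e p1 p2 s :
  denote (If e p1 p2) s = if eval s e != 0 then denote p1 s else denote p2 s.
Proof. by []. Qed.

Fixpoint cost p :=
  match p with
  | Skip => 1
  | Assign _ e => (expr_cost e).+1
  | Write _ e1 e2 => (expr_cost e1 + expr_cost e2).+1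
  | Seq p1 p2 => (cost p1 + cost p2).+1
  | If e p1 p2 => (expr_cost e + maxn (cost p1) (cost p2)).+1
  | While _ _ => 0
  end.

Lemma runs_denote p s (Q : state -> Prop) :
  loop_free p -> Q (denote p s) -> runs p s (cost p) Q.
Proof.
move=> lf q; suff [t e le] : exists2 t, exec p s (denote p s) t & t <= cost p.
  by exists (denote p s), t.
elim: p s lf {q} => //= [|x e|a e1 e2|p1 IH1 p2 IH2|e p1 IH1 p2 IH2] s.
- by exists 1 => //; constructor.
- by eexists; first exact: exec_Assign.
- by eexists; first exact: exec_Write.
- move=> /andP[/(IH1 s)[t1 e1 le1] /(IH2 (denote p1 s))[t2 e2 le2]].
  by exists (t1 + t2).+1; [apply: exec_Seq e1 e2|lia].
- move=> /andP[/(IH1 s)[t1 e1 le1] /(IH2 s)[t2 e2 le2]].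
  case: eqP => /= [z|/eqP nz].
    by eexists; [apply: exec_IfF z e2|lia].
  by eexists; [apply: exec_IfT nz e1|lia].
Qed.

Fixpoint assigned p : seq nat :=
  match p with
  | Skip | Write _ _ _ => [::]
  | Assign x _ => [:: x]
  | Seq p1 p2 | If _ p1 p2 => assigned p1 ++ assigned p2
  | While _ p1 => assigned p1
  end.

Fixpoint written p : seq nat :=
  match p with
  | Skip | Assign _ _ => [::]
  | Write a _ _ => [:: a]
  | Seq p1 p2 | If _ p1 p2 => written p1 ++ written p2
  | While _ p1 => written p1
  end.

(** What a program cannot change is read off its text, so that loop invariants mention only what
    does change. *)
Definition frame p s s' :=
  (forall x, x \notin assigned p -> reg s' x = reg s x) /\
  (forall a, a \notin written p -> forall i, arr s' a i = arr s a i).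

Lemma frame_trans p s1 s2 s3 : frame p s1 s2 -> frame p s2 s3 -> frame p s1 s3.
Proof.
move=> [r1 a1] [r2 a2]; split=> [x xp|a ap i]; first by rewrite r2 ?r1.
by rewrite a2 ?a1.
Qed.

Lemma exec_frame p s s' t : exec p s s' t -> frame p s s'.
Proof.
elim=> {p s s' t} //=.
- by move=> x e s; split=> //= y; rewrite inE => /negbTE->.
- by move=> a e1 e2 s; split=> //= b; rewrite inE => /negbTE->.
- move=> p1 p2 s1 s2 s3 t1 t2 _ [r1 a1] _ [r2 a2]; split=> [x|a];
    rewrite /= mem_cat negb_or => /andP[h1 h2]; first by rewrite r2 ?r1.
  by move=> i; rewrite a2 ?a1.
- move=> e p1 p2 s s' t _ _ [r a]; split=> [x|b];
    by rewrite /= mem_cat negb_or => /andP[h1 h2]; auto.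
- move=> e p1 p2 s s' t _ _ [r a]; split=> [x|b];
    by rewrite /= mem_cat negb_or => /andP[h1 h2]; auto.
- move=> e p s1 s2 s3 t1 t2 _ _ f1 _ f2; exact: (@frame_trans p) f1 f2.
Qed.

Lemma denote_frame p s : loop_free p -> frame p s (denote p s).
Proof.
move=> lf.
have [s' [t [e _ <-]]] := runs_denote (Q := fun s' => s' = denote p s) lf erefl.
exact: exec_frame e.
Qed.

Lemma runs_frame p s T Q : runs p s T Q ->
  runs p s T (fun s' => frame p s s' /\ Q s').
Proof.
by move=> [s' [t [e le q]]]; exists s', t; split=> //; split=> //; apply: exec_frame e.
Qed.

(** The index of the invariant is a strictly decreasing measure that starts at [k]; the test is thus
    evaluated at most [k.+1] times, the last time with value 0. *)
Lemma runs_while e p T k s0 (I : nat -> state -> Prop) (Q : state -> Prop) :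
  I k s0 ->
  (forall k s, frame p s0 s -> I k s -> eval s e != 0 ->
    exists2 k', k' < k & runs p s T (I k')) ->
  (forall k s, frame p s0 s -> I k s -> eval s e = 0 -> Q s) ->
  runs (While e p) s0 (k.+1 * (expr_cost e + T).+1) Q.
Proof.
move=> I0 step stop.
suff H s : frame p s0 s -> I k s ->
    runs (While e p) s (k.+1 * (expr_cost e + T).+1) Q by apply: H.
elim/ltn_ind: k s {I0} => k IH s fr Ik; case: (eqVneq (eval s e) 0) => [z|nz].
  exists s, (expr_cost e).+1; split; [exact: exec_WhileF|lia|exact: stop Ik z].
have [k' lt r] := step k s fr Ik nz.
have [s1 [t1 [e1 le1 [fr1 I1]]]] := runs_frame r.
have [s2 [t2 [e2 le2 q2]]] := IH k' lt s1 (frame_trans fr fr1) I1.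
exists s2, (expr_cost e + t1 + t2).+1; split=> //; first exact: exec_WhileT e2.
apply: (@leq_trans ((expr_cost e + T).+1 + k'.+1 * (expr_cost e + T).+1)).
  lia.
by rewrite -mulSn leq_mul2r; lia.
Qed.

Lemma runs_for e p k s0 (I : nat -> state -> Prop) (Q : state -> Prop) :
  loop_free p -> I k s0 ->
  (forall k s, frame p s0 s -> I k s -> eval s e != 0 ->
    exists2 k', k' < k & I k' (denote p s)) ->
  (forall k s, frame p s0 s -> I k s -> eval s e = 0 -> Q s) ->
  runs (While e p) s0 (k.+1 * (expr_cost e + cost p).+1) Q.
Proof.
move=> lf I0 step; apply: runs_while I0 _ => k1 s1 fr I1 nz.
by have [k' lt I'] := step k1 s1 fr I1 nz; exists k'; last exact: runs_denote.
Qed.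

(* Boolean expressions evaluate to 0 or 1. *)
Definition Not e := Sub (Const 1) e.
Definition Le e1 e2 := Not (Sub e1 e2).
Definition And e1 e2 := Sub (Add e1 e2) (Const 1).
Definition Or e1 e2 := Not (And (Not e1) (Not e2)).

Lemma eval_Not s e (b : bool) : eval s e = b -> eval s (Not e) = ~~ b.
Proof. by move=> /= ->; case: b. Qed.

Lemma eval_Le s e1 e2 : eval s (Le e1 e2) = (eval s e1 <= eval s e2).
Proof. by rewrite /= /leq; case: (eval s e1 - eval s e2). Qed.

Lemma eval_And s e1 e2 (b1 b2 : bool) : eval s e1 = b1 -> eval s e2 = b2 ->
  eval s (And e1 e2) = b1 && b2.
Proof. by move=> /= -> ->; case: b1; case: b2. Qed.

Lemma eval_Or s e1 e2 (b1 b2 : bool) : eval s e1 = b1 -> eval s e2 = b2 ->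
  eval s (Or e1 e2) = b1 || b2.
Proof. by move=> /= -> ->; case: b1; case: b2. Qed.

(** * Eliminating vertices *)

Section Elimination.
Variable T : eqType.
Implicit Types (E : rel T) (l : seq T).

Definition legal E v u w := (forall x, E x v = (x == u)) /\ (forall y, E v y = (y == w)).

(** The disjunction merges a new arc with an arc that is already there. No multiplicity has to be
    recorded, since costs are computed from the weights of the input digraph. *)
Definition elim E v : rel T :=
  fun x y => [&& x != v, y != v & E x y || (E x v && E v y)].

Fixpoint elimable E s t l : Prop :=
  if l is v :: l' then
    [/\ v != s, v != t, exists u w, legal E v u w & elimable (elim E v) s t l']
  else forall x y, E x y = (x == s) && (y == t).

Lemma legal_ext E1 E2 v u w : E1 =2 E2 -> legal E1 v u w -> legal E2 v u w.
Proof. by move=> e [H1 H2]; split=> x; rewrite -e. Qed.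

Lemma elim_ext E1 E2 v : E1 =2 E2 -> elim E1 v =2 elim E2 v.
Proof. by move=> e x y; rewrite /elim !e. Qed.

Lemma elimable_ext E1 E2 s t l :
  E1 =2 E2 -> elimable E1 s t l -> elimable E2 s t l.
Proof.
elim: l E1 E2 => [|v l IH] E1 E2 e /=; first by move=> H x y; rewrite -e.
move=> [vs vt [u [w lg]] el]; split=> //; first by exists u, w; apply: legal_ext lg.
by apply: IH el; apply: elim_ext.
Qed.

(** Both sides relate vertices [x] and [y] other than [v] and [w] exactly when some path from [x] to
    [y] has all its inner vertices among [v] and [w]. *)
Lemma elimC E v w : elim (elim E v) w =2 elim (elim E w) v.
Proof.
case: (eqVneq v w) => [->//|vw] x y; rewrite /elim vw (eq_sym w v) vw.
case: (x == v); case: (x == w); case: (y == v); case: (y == w);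
  rewrite ?andbF //=.
by case: (E x y); case: (E x v); case: (E v y); case: (E x w);
   case: (E w y); case: (E w v); case: (E v w).
Qed.

Variable f : T -> nat.
(** Acyclicity, witnessed by a potential. *)
Definition increasing E := forall x y, E x y -> f x < f y.

Lemma increasing_elim E v : increasing E -> increasing (elim E v).
Proof.
move=> inc x y /and3P[_ _ /orP[/inc//|/andP[/inc h1 /inc h2]]].
exact: ltn_trans h1 h2.
Qed.

(** If the eliminated [v1] was a neighbour of [v], its own neighbour on the far side takes its
    place. The potential guarantees that this replacement is not [v1] itself. *)
Lemma legal_elim E v u w v1 u1 w1 : increasing E -> v != v1 ->
  legal E v u w -> legal E v1 u1 w1 -> exists u' w', legal (elim E v1) v u' w'.
Proof.
move=> inc vv1 [Hu Hw] [Hu1 Hw1].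
have lt1 : f u1 < f v1 by apply: inc; rewrite Hu1.
have lt2 : f v1 < f w1 by apply: inc; rewrite Hw1.
exists (if u == v1 then u1 else u), (if w == v1 then w1 else w).
rewrite /elim; split=> x; rewrite vv1 /=.
- rewrite (Hu x) (Hu1 x) (Hu v1) (eq_sym v1); case: (eqVneq u v1) => [->|uv1].
    rewrite andbT; case: (eqVneq x v1) => //= ->.
    by apply/esym/eqP => e; rewrite e ltnn in lt1.
  by rewrite andbF orbF; case: (eqVneq x u) => [->|]; rewrite ?uv1 ?andbF.
- rewrite (Hw x) (Hw1 x) (Hw v1) (eq_sym v1); case: (eqVneq w v1) => [->|wv1].
    case: (eqVneq x v1) => //= ->.
    by apply/esym/eqP => e; rewrite -e ltnn in lt2.
  by rewrite orbF; case: (eqVneq x w) => [->|]; rewrite ?wv1 ?andbF.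
Qed.

(* Eliminations commute, so no choice of a legal vertex is a wrong one. *)
Lemma elimable_any E s t l v u w : increasing E ->
  elimable E s t l -> legal E v u w ->
  [/\ v != s, v != t & exists l',
    size l = (size l').+1 /\ elimable (elim E v) s t l'].
Proof.
elim: l E v u w => [|v1 l IH] E v u w inc /=.
  move=> H [Hu Hw]; exfalso.
  have h1 : E u v by rewrite Hu.
  have h2 : E v w by rewrite Hw.
  move: (inc _ _ h1); rewrite H in h1; rewrite H in h2.
  by case/andP: h1 => /eqP-> _; case/andP: h2 => /eqP-> _; rewrite ltnn.
move=> [v1s v1t [u1 [w1 lg1]] el] lg.
case: (eqVneq v v1) => [->|vv1]; first by split=> //; exists l.
have [u' [w' lg']] := legal_elim inc vv1 lg lg1.
have [vs vt [l' [sz el']]] := IH _ _ _ _ (increasing_elim (v := v1) inc) el lg'.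
split=> //; exists (v1 :: l'); rewrite /= sz; split=> //; split=> //.
  by apply: legal_elim lg1 lg => //; rewrite eq_sym.
by apply: elimable_ext el'; apply: elimC.
Qed.

End Elimination.

(** * Series parallel digraphs are eliminable *)

Section Gluing.
Variables (T1 T : eqType) (g : T1 -> T).
Hypothesis g_inj : injective g.

Definition glued (E : rel T) (E1 : rel T1) (R : T -> T -> Prop) :=
  forall x y, E x y <->
    (exists x1 y1, [/\ x = g x1, y = g y1 & E1 x1 y1]) \/ R x y.

Definition avoids (R : T -> T -> Prop) v := forall x, ~ R x v /\ ~ R v x.

Lemma glued_at E E1 R v : glued E E1 R -> avoids R (g v) ->
  (forall x, E x (g v) <-> exists2 x1, x = g x1 & E1 x1 v) /\
  (forall y, E (g v) y <-> exists2 y1, y = g y1 & E1 v y1).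
Proof.
move=> gl av; split=> x; rewrite gl; split.
- by case=> [[x1 [y1 [-> /g_inj -> ?]]]|/(proj1 (av x))//]; exists x1.
- by case=> x1 -> ?; left; exists x1, v.
- by case=> [[x1 [y1 [/g_inj -> -> ?]]]|/(proj2 (av x))//]; exists y1.
- by case=> x1 -> ?; left; exists v, x1.
Qed.

Lemma legal_glued E E1 R v u w : glued E E1 R -> avoids R (g v) ->
  legal E1 v u w -> legal E (g v) (g u) (g w).
Proof.
move=> gl av [Hu Hw]; have [glv gvl] := glued_at gl av.
split=> x; apply/idP/eqP.
- by move/glv => [x1 ->]; rewrite Hu => /eqP->.
- by move=> ->; apply/glv; exists u; rewrite // Hu.
- by move/gvl => [x1 ->]; rewrite Hw => /eqP->.
- by move=> ->; apply/gvl; exists w; rewrite // Hw.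
Qed.

Lemma elim_glued E E1 R v : glued E E1 R -> avoids R (g v) ->
  glued (elim E (g v)) (elim E1 v) R.
Proof.
move=> gl av x y; have [glv gvl] := glued_at gl av; split.
- case/and3P=> xv yv /orP[/gl[[x1 [y1 [ex ey Exy]]]|Rxy]|/andP[/glv + /gvl]].
  + left; exists x1, y1; split=> //; subst x y.
    by rewrite /elim -(inj_eq g_inj) xv -(inj_eq g_inj) yv Exy.
  + by right.
  + move=> [x1 ex Ex] [y1 ey Ey]; left; exists x1, y1; split=> //; subst x y.
    by rewrite /elim -(inj_eq g_inj) xv -(inj_eq g_inj) yv Ex Ey orbT.
- case=> [[x1 [y1 [-> -> /and3P[xv yv Exy]]]]|Rxy].
    rewrite /elim !(inj_eq g_inj) xv yv /=; case/orP: Exy => [Exy|/andP[Ex Ey]].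
      by apply/orP; left; apply/gl; left; exists x1, y1.
    by apply/orP; right; apply/andP; split; [apply/glv; exists x1|apply/gvl; exists y1].
  rewrite /elim; apply/and3P; split.
  + by apply/eqP => e; subst x; apply: (proj2 (av y)).
  + by apply/eqP => e; subst y; apply: (proj1 (av x)).
  + by apply/orP; left; apply/gl; right.
Qed.

(** Running the elimination of [E1] inside [E] shrinks the copy of [E1] to one arc and leaves [R]
    alone, because no arc of [R] touches an eliminated vertex; [l] then has to finish from there.
    Isomorphisms, both compositions and the numbering of the vertices are instances. *)
Lemma elimable_glued E E1 R s1 t1 l1 s t l : glued E E1 R ->
  elimable E1 s1 t1 l1 -> (forall v, v \in l1 -> avoids R (g v)) ->
  s \notin map g l1 -> t \notin map g l1 ->
  (forall E' : rel T, (forall x y, E' x y <-> (x = g s1 /\ y = g t1) \/ R x y) ->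
    elimable E' s t l) ->
  elimable E s t (map g l1 ++ l).
Proof.
elim: l1 E E1 => [|v l1 IH] E E1 gl /=.
  move=> EE _ _ _; apply=> x y; rewrite gl; split=> -[|]; try by right.
    by case=> x1 [y1 [-> ->]]; rewrite EE => /andP[/eqP-> /eqP->]; left.
  by case=> -> ->; left; exists s1, t1; rewrite EE !eqxx.
move=> [_ _ [u [w lg]] el] av; rewrite !inE !negb_or.
move=> /andP[sv sl] /andP[tv tl] H; rewrite [g v == s]eq_sym [g v == t]eq_sym.
have avv : avoids R (g v) by apply: av; rewrite inE eqxx.
split=> //; first by exists (g u), (g w); apply: legal_glued lg.
apply: IH el _ sl tl H; first exact: elim_glued.
by move=> x xl; apply: av; rewrite inE xl orbT.
Qed.

End Gluing.

Lemma elimable_internal (T : eqType) (E : rel T) s t l : elimable E s t l ->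
  s \notin l /\ t \notin l.
Proof.
elim: l E => // v l IH E /= [vs vt _ /IH[sl tl]].
by rewrite !inE !negb_or (eq_sym s) (eq_sym t) vs vt sl tl.
Qed.

Section Series_Parallel.

Definition edge (G : digraph) : rel (vertex G) := fun x y => 0 < multiplicity x y.
Arguments edge {G} x y.

Lemma edgeP (G : digraph) (x y : vertex G) :
  reflect (exists a : arc G, tail a = x /\ head a = y) (edge x y).
Proof.
apply: (iffP card_gt0P) => -[a]; first by rewrite inE => /andP[/eqP ? /eqP ?]; exists a.
by move=> [<- <-]; exists a; rewrite inE !eqxx.
Qed.

(** The induction hypothesis over series parallel digraphs. Potential 0 at the source and the strict
    maximum at the sink let the potentials of two parts be combined; the length of [l] fixes the
    number of eliminations; the last clause excludes isolated vertices, which no chain could ever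
    contain. *)
Definition eliminable (G : tdigraph) := exists l (f : vertex G -> nat),
  [/\ (size l).+2 = #|vertex G|, elimable (@edge G) (source G) (sink G) l,
     increasing f (@edge G),
     (f (source G) = 0 /\ forall x, x != source G -> f x > 0)
   & (forall x, x != sink G -> f x < f (sink G)) /\
     forall x : vertex G, exists y, edge x y || edge y x].

Lemma eliminable_arc : eliminable single_arc.
Proof.
have E x y : @edge single_arc x y = (x == false) && (y == true).
  apply/edgeP/andP => [[a [<- <-]]//|[/eqP-> /eqP->]]; by exists tt.
exists [::], nat_of_bool; split; rewrite ?card_bool //=.
- by move=> x y; rewrite E => /andP[/eqP-> /eqP->].
- by split=> //; case.
- by split=> [[]|[]] //; [exists false|exists true]; rewrite !E.
Qed.

Lemma eliminable_iso G H : isomorphic G H -> eliminable G -> eliminable H.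
Proof.
move=> [g [h [bg bh tg hg [gs gt]]]] [l [f [sz el inc [fs fs'] [ft cov]]]].
have [g' gK g'K] := bg; have [h' hK h'K] := bh.
have gi := bij_inj bg.
have E (x y : vertex G) : edge (g x) (g y) = edge x y.
  apply/edgeP/edgeP => -[a [ex ey]].
    by exists (h' a); split; apply: gi; rewrite -?tg -?hg h'K.
  by exists (h a); rewrite tg hg ex ey.
have E' (x y : vertex H) : edge x y = edge (g' x) (g' y) by rewrite -E !g'K.
have g'gi := can_inj g'K.
have g's : g' (source H) = source G by rewrite -gs gK.
have g't : g' (sink H) = sink G by rewrite -gt gK.
exists (map g l ++ [::]), (f \o g'); split.
- by rewrite cats0 size_map sz (bij_eq_card bg).
- have [sl tl] := elimable_internal el.
  apply: (elimable_glued gi (R := fun _ _ => False) _ el) => //.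
  + move=> x y; rewrite E'; split=> [e|[[x1 [y1 [-> ->]]]|//]]; last by rewrite !gK.
    by left; exists (g' x), (g' y); rewrite !g'K.
  + by move=> v _ x; split.
  + by rewrite -gs mem_map.
  + by rewrite -gt mem_map.
  + move=> F FE x y; apply/idP/andP => [/FE[[-> ->]|//]|[/eqP-> /eqP->]].
      by rewrite gs gt.
    by apply/FE; left; rewrite gs gt.
- by move=> x y; rewrite E' => /inc.
- rewrite /= g's; split=> // x; rewrite -(inj_eq g'gi) g's; exact: fs'.
- rewrite /= g't; split=> x; first by rewrite -(inj_eq g'gi) g't; exact: ft.
  have [y] := cov (g' x); exists (g y); by rewrite !E' gK.
Qed.

Variables G1 G2 : tdigraph.
Hypotheses (el1 : eliminable G1) (el2 : eliminable G2).

(** If the terminals coincided, the potential of any other vertex would be below the value 0 at the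
    sink, so there would be only one vertex. *)
Lemma eliminable_neq (G : tdigraph) : eliminable G -> source G != sink G.
Proof.
case=> l [f [sz _ _ [f0 fs] [ft cov]]].
have : 1 < #|vertex G| by rewrite -sz.
apply: contraTneq => st; rewrite -leqNgt; apply/card_le1_eqP => x y _ _.
suff H z : z = source G by rewrite (H x) (H y).
by apply/eqP/negPn/negP => zs; have := ft z; rewrite -st zs f0 => /(_ isT).
Qed.

Lemma series_in2_inj : injective (@series_in2 G1 G2).
Proof.
move=> x y; rewrite /series_in2.
case: insubP => [a _ ea|/negPn/eqP ea]; case: insubP => [b _ eb|/negPn/eqP eb] //.
  by move=> [e]; rewrite -ea -eb e.
by rewrite ea eb.
Qed.

Lemma series_in2_source : @series_in2 G1 G2 (source G2) = inl (sink G1).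
Proof. by rewrite /series_in2 insubF // eqxx. Qed.

Lemma series_in2_inr v : (exists u, @series_in2 G1 G2 v = inr u) \/ v = source G2.
Proof.
rewrite /series_in2; case: insubP => [u _ _|/negPn/eqP ->]; last by right.
by left; exists u.
Qed.

Definition relation_image (T1 T : Type) (g : T1 -> T) (E : rel T1) x y :=
  exists x1 y1, [/\ x = g x1, y = g y1 & E x1 y1].

Lemma edge_series x y : @edge (series G1 G2) x y <->
  relation_image inl (@edge G1) x y \/ relation_image (@series_in2 G1 G2) (@edge G2) x y.
Proof.
split=> [/edgeP[[a|a] [<- <-]]|[] [x1 [y1 [-> -> /edgeP[a [<- <-]]]]]].
- by left; exists (tail a), (head a); split=> //; apply/edgeP; exists a.
- by right; exists (tail a), (head a); split=> //; apply/edgeP; exists a.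
- by apply/edgeP; exists (inl a).
- by apply/edgeP; exists (inr a).
Qed.

Lemma eliminable_series : eliminable (series G1 G2).
Proof.
have st1 := eliminable_neq el1; have st2 := eliminable_neq el2.
have [l1 [f1 [sz1 e1 inc1 [fs1 fs1'] [ft1 cov1]]]] := el1.
have [l2 [f2 [sz2 e2 inc2 [fs2 fs2'] [ft2 cov2]]]] := el2.
have [sl1 tl1] := elimable_internal e1; have [sl2 tl2] := elimable_internal e2.
have inl_inj : injective (@inl (vertex G1) {v : vertex G2 | v != source G2}).
  by move=> ? ? [].
pose i2 := @series_in2 G1 G2.
have i2_inl v x : i2 v = inl x -> v = source G2 /\ x = sink G1.
  have [[u eu]|->] := series_in2_inr v; first by rewrite /i2 eu.
  by rewrite /i2 series_in2_source => -[].
(* Once both parts have shrunk to an arc, the identified vertex is the middle of a path with two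
   arcs, and it goes last. *)
exists (map inl l1 ++ (map i2 l2 ++ [:: inl (sink G1)])).
(* The second potential is shifted; both agree at the identified vertex because the source of [G2]
   has potential 0. *)
exists (fun x => match x with inl v => f1 v | inr u => f1 (sink G1) + f2 (val u) end).
have fi2 v : match i2 v with inl v => f1 v | inr u => f1 (sink G1) + f2 (val u) end =
    f1 (sink G1) + f2 v.
  rewrite /i2 /series_in2; case: insubP => [u _ <-//|/negPn/eqP->].
  by rewrite fs2 addn0.
have f1t : 0 < f1 (sink G1) by apply: fs1'; rewrite eq_sym.
split.
- rewrite !size_cat !size_map /= card_sum card_sig -sz1.
  have -> : #|[pred v | v != source G2]| = #|vertex G2|.-1 by rewrite cardC1.
  by rewrite -sz2 /=; lia.
- apply: (elimable_glued inl_inj edge_series e1).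
  + move=> v vl x; split=> -[x1 [y1 [ex ey _]]].
      by have [_ e] := i2_inl _ _ (esym ey); rewrite e (negbTE tl1) in vl.
    by have [_ e] := i2_inl _ _ (esym ex); rewrite e (negbTE tl1) in vl.
  + by rewrite /= mem_map.
  + apply/mapP => -[x xl /= e]; have [e' _] := i2_inl _ _ e.
    by rewrite e' eqxx in st2.
  move=> E' EE'.
  apply: (elimable_glued series_in2_inj (E1 := @edge G2)
    (R := fun x y => x = inl (source G1) /\ y = inl (sink G1)) _ e2).
  + by move=> x y; rewrite EE'; split=> -[]; by [left|right].
  + move=> v vl x; split=> -[ex ey].
      by have [e _] := i2_inl _ _ ey; rewrite e (negbTE sl2) in vl.
    by have [e _] := i2_inl _ _ ex; rewrite e (negbTE sl2) in vl.
  + apply/mapP => -[x xl /= e]; have [_ e'] := i2_inl _ _ (esym e).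
    by rewrite e' eqxx in st1.
  + by rewrite /= mem_map //; apply: series_in2_inj.
  move=> E'' EE''; rewrite series_in2_source -/i2 in EE''.
  have it2 : i2 (sink G2) != inl (sink G1).
    by apply/eqP => /i2_inl[e]; rewrite e eqxx in st2.
  have E2 x y : E'' x y = (x == inl (sink G1)) && (y == i2 (sink G2)) || 
      (x == inl (source G1)) && (y == inl (sink G1)).
    apply/idP/orP => [/EE''[[-> ->]|[-> ->]]|[]/andP[/eqP-> /eqP->]].
    - by left; rewrite !eqxx.
    - by right; rewrite !eqxx.
    - by apply/EE''; left.
    - by apply/EE''; right.
  have it1 : (inl (source G1) : series_vertex G1 G2) != inl (sink G1).
    by apply/eqP => -[e]; rewrite e eqxx in st1.
  have it1' := it1; have it2' := it2; rewrite eq_sym in it1'; rewrite eq_sym in it2'.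
  split=> //=.
  + exists (inl (source G1)), (i2 (sink G2)); split=> x; rewrite E2 eqxx.
      by rewrite (negbTE it2') andbF andbT.
    by rewrite (negbTE it1') orbF.
  + move=> x y; rewrite /elim !E2 !eqxx (negbTE it1') (negbTE it2') andbF /= andbT orbF.
    case: (eqVneq x (inl (sink G1))) => [->|_]; first by rewrite (negbTE it1').
    case: (eqVneq y (inl (sink G1))) => [->|_] //=; last by rewrite andbF.
    by rewrite (negbTE it2') andbF.
- move=> x y /edge_series[] [x1 [y1 [-> -> /[dup] exy]]]; first exact: inc1.
  by rewrite !fi2 ltn_add2l; apply: inc2.
- split=> //= -[x|u] xs; first exact: fs1'.
  by rewrite addn_gt0 f1t.
- have f2t : 0 < f2 (sink G2) by apply: fs2'; rewrite eq_sym.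
  split=> /=.
    move=> x xt; rewrite fi2; case: x xt => [x|u] xt.
      case: (eqVneq x (sink G1)) => [->|/ft1]; first lia.
      lia.
    rewrite ltn_add2l; apply: ft2; apply: contraNneq xt => ut.
    rewrite -/i2 -ut /i2 /series_in2 insubT; first exact: (valP u).
    by move=> h; apply/eqP; congr inr; apply: val_inj.
  case=> [x|u].
    have [y exy] := cov1 x; exists (inl y).
    apply/orP; case/orP: exy => e; [left|right]; apply/edge_series; left.
      by exists x, y.
    by exists y, x.
  have [y exy] := cov2 (val u); exists (i2 y).
  have -> : inr u = i2 (val u).
    rewrite /i2 /series_in2 insubT; first exact: (valP u).
    by move=> h; congr inr; apply: val_inj.
  apply/orP; case/orP: exy => e; [left|right]; apply/edge_series; right.
    by exists (val u), y.
  by exists y, (val u).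
Qed.

Lemma parallel_in2_source : @parallel_in2 G1 G2 (source G2) = inl (source G1).
Proof. by rewrite /parallel_in2 insubF eqxx. Qed.

Lemma parallel_in2_sink : @parallel_in2 G1 G2 (sink G2) = inl (sink G1).
Proof.
rewrite /parallel_in2 insubF ?eqxx ?andbF // eq_sym.
by rewrite (negbTE (eliminable_neq el2)).
Qed.

Lemma parallel_in2_inl v x : @parallel_in2 G1 G2 v = inl x ->
  (v = source G2 /\ x = source G1) \/ (v = sink G2 /\ x = sink G1).
Proof.
rewrite /parallel_in2; case: insubP => // + [<-]; rewrite negb_and !negbK.
case/orP=> /eqP->; first by rewrite eqxx; left.
by right; rewrite eq_sym (negbTE (eliminable_neq el2)).
Qed.

Lemma parallel_in2_inr v u : @parallel_in2 G1 G2 v = inr u -> val u = v.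
Proof. by rewrite /parallel_in2; case: insubP => // a _ <- [->]. Qed.

Lemma parallel_in2_inj : injective (@parallel_in2 G1 G2).
Proof.
move=> x y e; case ex: (parallel_in2 G1 x) => [a|a]; last first.
  by rewrite -(parallel_in2_inr ex); apply: parallel_in2_inr; rewrite -e.
have st1 := eliminable_neq el1.
have := parallel_in2_inl ex; rewrite e in ex; have := parallel_in2_inl ex.
case=> [[-> ->]|[-> ->]] [[-> //]|[-> //]]; move/eqP; first by rewrite (negbTE st1).
by rewrite eq_sym (negbTE st1).
Qed.

Lemma edge_parallel x y : @edge (parallel G1 G2) x y <->
  relation_image inl (@edge G1) x y \/ relation_image (@parallel_in2 G1 G2) (@edge G2) x y.
Proof.
split=> [/edgeP[[a|a] [<- <-]]|[] [x1 [y1 [-> -> /edgeP[a [<- <-]]]]]].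
- by left; exists (tail a), (head a); split=> //; apply/edgeP; exists a.
- by right; exists (tail a), (head a); split=> //; apply/edgeP; exists a.
- by apply/edgeP; exists (inl a).
- by apply/edgeP; exists (inr a).
Qed.

Lemma eliminable_parallel : eliminable (parallel G1 G2).
Proof.
have st1 := eliminable_neq el1; have st2 := eliminable_neq el2.
have [l1 [f1 [sz1 e1 inc1 [fs1 fs1'] [ft1 cov1]]]] := el1.
have [l2 [f2 [sz2 e2 inc2 [fs2 fs2'] [ft2 cov2]]]] := el2.
have [sl1 tl1] := elimable_internal e1; have [sl2 tl2] := elimable_internal e2.
have inl_inj : injective
    (@inl (vertex G1) {v : vertex G2 | (v != source G2) && (v != sink G2)}).
  by move=> ? ? [].
pose i2 := @parallel_in2 G1 G2.
(* Only the common sink needs a new value: the sum of both maxima exceeds every value in either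
   part. *)
pose f (x : parallel_vertex G1 G2) := match x with
  | inl v => if v == sink G1 then f1 (sink G1) + f2 (sink G2) else f1 v
  | inr u => f2 (val u) end.
have fi2 v : f (i2 v) = if v == sink G2 then f1 (sink G1) + f2 (sink G2) else f2 v.
  case ei: (i2 v) => [a|a] /=.
    case: (parallel_in2_inl ei) => -[-> ->]; last by rewrite !eqxx.
    by rewrite (negbTE st1) (negbTE st2) fs1 fs2.
  rewrite -(parallel_in2_inr ei) ifN //; by case/andP: (valP a).
have f1t : 0 < f1 (sink G1) by apply: fs1'; rewrite eq_sym.
have f2t : 0 < f2 (sink G2) by apply: fs2'; rewrite eq_sym.
have inr_i2 u : inr u = i2 (val u).
  rewrite /i2 /parallel_in2 insubT; first exact: (valP u).
  by move=> h; congr inr; apply: val_inj.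
(* No further vertex is needed: the two remaining arcs have the same ends and are one pair of the
   relation. *)
exists (map inl l1 ++ (map i2 l2 ++ [::])), f; split.
- rewrite !size_cat !size_map /= card_sum card_sig -sz1.
  have -> : #|[pred v | (v != source G2) && (v != sink G2)]| = #|vertex G2|.-2.
    have c2 : #|[:: source G2; sink G2]| = 2.
      by apply/card_uniqP; rewrite /= inE st2.
    rewrite -(cardC (mem [:: source G2; sink G2])) c2.
    by apply: eq_card => v; rewrite !inE /= ?inE negb_or.
  by rewrite -sz2 /=; lia.
- apply: (elimable_glued inl_inj edge_parallel e1).
  + move=> v vl x; split=> -[x1 [y1 [ex ey _]]].
      by case: (parallel_in2_inl (esym ey)) => -[_ e]; move: vl;
        rewrite e ?(negbTE sl1) ?(negbTE tl1).
    by case: (parallel_in2_inl (esym ex)) => -[_ e]; move: vl;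
      rewrite e ?(negbTE sl1) ?(negbTE tl1).
  + by rewrite /= mem_map.
  + by rewrite /= mem_map.
  move=> E' EE'.
  apply: (elimable_glued parallel_in2_inj (E1 := @edge G2)
    (R := fun x y => x = inl (source G1) /\ y = inl (sink G1)) _ e2).
  + by move=> x y; rewrite EE'; split=> -[]; by [left|right].
  + move=> v vl x; split=> -[ex ey].
      by case: (parallel_in2_inl ey) => -[e _]; move: vl;
        rewrite e ?(negbTE sl2) ?(negbTE tl2).
    by case: (parallel_in2_inl ex) => -[e _]; move: vl;
      rewrite e ?(negbTE sl2) ?(negbTE tl2).
  + by rewrite /= -parallel_in2_source mem_map //; apply: parallel_in2_inj.
  + by rewrite /= -parallel_in2_sink mem_map //; apply: parallel_in2_inj.
  move=> E'' EE''; rewrite parallel_in2_source parallel_in2_sink in EE''.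
  move=> x y; apply/idP/andP => [/EE''[] [-> ->]|[/eqP-> /eqP->]].
  + by rewrite !eqxx.
  + by rewrite !eqxx.
  + by apply/EE''; left.
- move=> x y /edge_parallel[] [x1 [y1 [-> -> exy]]].
    have lt := inc1 _ _ exy.
    rewrite /f; case: (eqVneq x1 (sink G1)) lt => [->|xt] lt.
      by case: (eqVneq y1 (sink G1)) lt => [->|/ft1 h]; lia.
    case: (eqVneq y1 (sink G1)) lt => [->|]; lia.
  have lt := inc2 _ _ exy.
  rewrite -!/(i2 _) !fi2; case: (eqVneq x1 (sink G2)) lt => [->|xt] lt.
    by case: (eqVneq y1 (sink G2)) lt => [->|/ft2 h]; lia.
  case: (eqVneq y1 (sink G2)) lt => [->|]; lia.
- split; rewrite /f /=; first by rewrite (negbTE st1).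
  move=> [x|u] xs; last by apply: fs2'; case/andP: (valP u).
  by case: (eqVneq x (sink G1)) => [_|_]; [lia|apply: fs1'].
- split; rewrite /f /= ?eqxx.
    move=> [x|u] xt.
      case: (eqVneq x (sink G1)) xt => [->|/ft1]; first by rewrite eqxx.
      lia.
    have [_ ut] := andP (valP u).
    exact: leq_trans (ft2 _ ut) (leq_addl _ _).
  case=> [x|u].
    have [y exy] := cov1 x; exists (inl y).
    apply/orP; case/orP: exy => e; [left|right]; apply/edge_parallel; left.
      by exists x, y.
    by exists y, x.
  have [y exy] := cov2 (val u); exists (i2 y).
  rewrite inr_i2; apply/orP; case/orP: exy => e; [left|right];
    apply/edge_parallel; right.
    by exists (val u), y.
  by exists y, (val u).
Qed.

End Series_Parallel.

Lemma SPD_eliminable G : SPD G -> eliminable G.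
Proof.
elim=> [|G1 G2 _ e1 _ e2|G1 G2 _ e1 _ e2|G1 G2 iso _ e].
- exact: eliminable_arc.
- exact: eliminable_series.
- exact: eliminable_parallel.
- exact: eliminable_iso iso e.
Qed.

(** * Sequences of strings *)

Section Shuffle.
Variable A : Type.
Implicit Types X Y S Z : seq A.

Inductive shuffle : seq A -> seq A -> seq A -> Prop :=
| shuffle0 : shuffle [::] [::] [::]
| shuffleL x X Y S : shuffle X Y S -> shuffle (x :: X) Y (x :: S)
| shuffleR y X Y S : shuffle X Y S -> shuffle X (y :: Y) (y :: S).

Lemma shuffle0s Y : shuffle [::] Y Y.
Proof. by elim: Y => [|y Y IH]; constructor. Qed.

Lemma shuffles0 X : shuffle X [::] X.
Proof. by elim: X => [|y X IH]; constructor. Qed.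

Lemma shuffle0_inv Y S : shuffle [::] Y S -> S = Y.
Proof.
move: {-1}[::] (erefl (@nil A)) => X + sh; elim: sh => // y X' Y' S' _ IH e.
by rewrite IH.
Qed.

Lemma shuffleC X Y S : shuffle X Y S -> shuffle Y X S.
Proof. by elim=> *; constructor. Qed.

Lemma shuffle_cat X1 Y1 S1 X2 Y2 S2 :
  shuffle X1 Y1 S1 -> shuffle X2 Y2 S2 ->
  shuffle (X1 ++ X2) (Y1 ++ Y2) (S1 ++ S2).
Proof. by move=> + sh2; elim=> //= *; constructor. Qed.

Lemma shuffle_cons_inv a X Y S :
  shuffle (a :: X) Y S ->
  exists Y1 Y2 S2, [/\ Y = Y1 ++ Y2, S = Y1 ++ a :: S2 & shuffle X Y2 S2].
Proof.
move: {-1}(a :: X) (erefl (a :: X)) => aX + sh.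
elim: sh X => [//|x X' Y' S' sh _ X [-> ->]|y X' Y' S' _ IH X e].
  by exists [::], Y', S'.
have [Y1 [Y2 [S2 [-> -> sh]]]] := IH _ e.
by exists (y :: Y1), Y2, S2.
Qed.

Lemma shuffle_cat_inv X1 X2 Y S :
  shuffle (X1 ++ X2) Y S ->
  exists Y1 Y2 S1 S2,
    [/\ Y = Y1 ++ Y2, S = S1 ++ S2, shuffle X1 Y1 S1 & shuffle X2 Y2 S2].
Proof.
elim: X1 Y S => [|a X1 IH] Y S /= sh.
  by exists [::], Y, [::], S; split=> //; constructor.
have [Y1 [Y2 [S2 [-> -> sh2]]]] := shuffle_cons_inv sh.
have {sh2} [Y3 [Y4 [S3 [S4 [-> -> sh1 sh2]]]]] := IH _ _ sh2.
exists (Y1 ++ Y3), Y4, (Y1 ++ a :: S3), S4; split=> //; rewrite -?catA //.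
by apply: (@shuffle_cat [::] _ _ (a :: X1)); [exact: shuffle0s|constructor].
Qed.

(** Regroups three interleaved sequences so that one chain can be rearranged while the other counts
    as surrounding. *)
Lemma shuffle_assoc X Y Z S YZ :
  shuffle X YZ S -> shuffle Y Z YZ ->
  exists2 XZ, shuffle Y XZ S & shuffle X Z XZ.
Proof.
move=> sh; elim: sh Y Z => {S} [|x X' Y' S sh IH|y X' Y' S sh IH] Y Z sh2.
- inversion sh2; subst; exists [::]; constructor.
- by have [XZ sh3 sh4] := IH _ _ sh2; exists (x :: XZ); constructor.
- inversion sh2; subst.
  + have [XZ sh3 sh4] := IH _ _ H2; exists XZ => //; constructor=> //.
  + by have [XZ sh3 sh4] := IH _ _ H2; exists (y :: XZ); constructor.
Qed.

Lemma shuffle_assocl X Y Z S YZ :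
  shuffle X YZ S -> shuffle Y Z YZ ->
  exists2 XY, shuffle XY Z S & shuffle X Y XY.
Proof.
move=> sh1 /shuffleC sh2; have [XY sh3 sh4] := shuffle_assoc sh1 sh2.
by exists XY => //; apply: shuffleC.
Qed.

Lemma shuffle_filter (p : pred A) s :
  shuffle (filter p s) (filter (predC p) s) s.
Proof. by elim: s => [|x s IH] /=; [|case: (p x)]; constructor. Qed.

End Shuffle.

Lemma shuffle_map (A B : Type) (f : A -> B) X Y S :
  shuffle X Y S -> shuffle (map f X) (map f Y) (map f S).
Proof. by elim=> *; constructor. Qed.

Lemma shuffle_flatten_filter (A : Type) (p : pred A) (X Y S : seq (seq A)) :
  shuffle X Y S -> all p (flatten X) -> all (predC p) (flatten Y) ->
  (filter (predC p) (flatten S) = flatten Y) *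
  (filter p (flatten S) = flatten X).
Proof.
elim=> //= x X' Y' S' _ IH; rewrite all_cat.
- move=> /andP[px pX] pY; rewrite !filter_cat !IH //.
  rewrite (all_filterP px); split=> //.
  suff -> : [seq y <- x | predC p y] = [::] by [].
  by elim: x px => //= y x IHx /andP[-> /IHx].
- move=> pX /andP[px pY]; rewrite !filter_cat !IH //.
  rewrite (all_filterP px); split=> //.
  suff -> : [seq y <- x | p y] = [::] by [].
  by elim: x px => //= y x IHx /andP[/negbTE-> /IHx].
Qed.

Lemma shuffle_perm_flatten (A : eqType) (X Y S : seq (seq A)) :
  shuffle X Y S -> perm_eq (flatten S) (flatten X ++ flatten Y).
Proof.
elim=> //= x X' Y' S' _ IH; first by rewrite -catA perm_cat2l.
by rewrite perm_sym perm_catCA perm_cat2l perm_sym.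
Qed.

(** * Costs of orders and the exchange argument *)

Section Cost.
Variables (T : eqType) (iw ow : T -> nat).
Implicit Types (s a b e : seq T).

Definition inw s := sumn (map iw s).
Definition outw s := sumn (map ow s).

Lemma inw_cat s1 s2 : inw (s1 ++ s2) = inw s1 + inw s2.
Proof. by rewrite /inw map_cat sumn_cat. Qed.

Lemma outw_cat s1 s2 : outw (s1 ++ s2) = outw s1 + outw s2.
Proof. by rewrite /outw map_cat sumn_cat. Qed.

(* When [x] is placed in a topological order, the number of arcs passing over
   [x] is the number of arcs leaving the earlier vertices plus the number of
   arcs entering the later ones, minus the number of all arcs. *)
Fixpoint fits K i s o :=
  if s is x :: s' then (i + inw s' + o <= K) && fits K (i + ow x) s' o
  else true.

Lemma fits_cat K i s1 s2 o :
  fits K i (s1 ++ s2) o = fits K i s1 (inw s2 + o) && fits K (i + outw s1) s2 o.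
Proof.
elim: s1 i => [|x s1 IH] i /=; first by rewrite addn0.
by rewrite IH inw_cat andbA !addnA.
Qed.

(* A string is summarized by its numbers [p] of entering and [r] of leaving arcs
   and its peak [q], all relative to a cut of size [p] before the string. *)
Definition triple := (nat * nat * nat)%type.

(** The triple of a concatenation. The cost at a vertex counts arcs leaving earlier vertices and
    arcs entering later ones: inside the first string the [p2] arcs entering the second are added,
    inside the second the [r1] arcs leaving the first. *)
Definition comb (x y : triple) : triple :=
  let: (p1, q1, r1) := x in let: (p2, q2, r2) := y in
  (p1 + p2, maxn (q1 + p2) (r1 + q2), r1 + r2).

(* Strings that do not increase the cut come first, by increasing peak; the
   others follow, by decreasing peak relative to their end. *)
Definition leK (x y : triple) : bool :=
  let: (p1, q1, r1) := x in let: (p2, q2, r2) := y in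
  if r1 <= p1 then (if r2 <= p2 then q1 + p2 <= q2 + p1 else true)
  else (if r2 <= p2 then false else q2 + r1 <= q1 + r2).

Lemma leK_total : total leK.
Proof.
by move=> [[p1 q1] r1] [[p2 q2] r2] /=; do !case: ifP => //= ?; lia.
Qed.

Lemma leK_trans : transitive leK.
Proof.
move=> [[p2 q2] r2] [[p1 q1] r1] [[p3 q3] r3] /=.
by do !case: ifP => //= ?; lia.
Qed.

(** Single vertices need their own case because [(0, 0, 0)] is not neutral for [comb]: it would
    count a peak after the last vertex. *)
Fixpoint trip s : triple :=
  match s with
  | [::] => (0, 0, 0)
  | [:: x] => (iw x, 0, ow x)
  | x :: s' => comb (iw x, 0, ow x) (trip s')
  end.

(** Makes the triple a faithful summary: in every surrounding, the peak alone decides which bounds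
    the string respects. *)
Lemma tripE s : s != [::] -> exists q,
  trip s = (inw s, q, outw s) /\
  forall K i o, fits K i s o = (i + q + o <= K).
Proof.
elim: s => // x [|y s] IH _.
  exists 0; split; first by rewrite /inw /outw /= !addn0.
  by move=> K i o; rewrite /= /inw /= andbT.
have [q [E H]] := IH isT.
exists (maxn (inw (y :: s)) (ow x + q)); split.
  by rewrite [trip _]/(comb _ (trip (y :: s))) E.
move=> K i o; rewrite [fits _ _ _ _]/(_ && fits K (i + ow x) (y :: s) o) H.
move: (inw _) => m. by apply/andP/idP => [[]|]; lia.
Qed.

Lemma trip_cat a b : a != [::] -> b != [::] ->
  trip (a ++ b) = comb (trip a) (trip b).
Proof.
move=> + bN; elim: a => // x [|y a] IH _; first by case: b bN {IH}.
rewrite [trip (_ ++ _)]/(comb _ (trip ((y :: a) ++ b))) IH //.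
rewrite [trip (x :: _)]/(comb _ (trip (y :: a))).
case: (trip (y :: a)) => [[p1 q1] r1]; case: (trip b) => [[p2 q2] r2] /=.
by congr (_, _, _); lia.
Qed.

Definition leB a b := leK (trip a) (trip b).

Lemma leB_total : total leB.
Proof. by move=> a b; apply: leK_total. Qed.

Lemma leB_trans : transitive leB.
Proof. by move=> a b c; apply: leK_trans. Qed.

(** The quantification over the weights [i] before and [o] after the string makes the relation
    usable inside longer orders. *)
Definition better s1 s2 :=
  forall K i o, fits K i s2 o -> fits K i s1 o.

Lemma better_trans s1 s2 s3 : better s1 s2 -> better s2 s3 -> better s1 s3.
Proof. by move=> H1 H2 K i o /H2/H1. Qed.

Lemma better_context s1 s2 t1 t2 :
  inw t1 = inw t2 -> outw t1 = outw t2 -> better t1 t2 ->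
  better (s1 ++ t1 ++ s2) (s1 ++ t2 ++ s2).
Proof.
move=> ei eo H K i o; rewrite !fits_cat !inw_cat ei eo.
by move=> /and3P[-> /H-> ->].
Qed.

(** With triples [(p1, q1, r1)] and [(p2, q2, r2)], the claim is that the maximum of [q1 + p2] and
    [r1 + q2] is at most that of [q2 + p1] and [r2 + q1]. In each case of [leK], both terms on the
    left are bounded by a term on the right. *)
Lemma better_swap a b : a != [::] -> b != [::] -> leB a b ->
  better (a ++ b) (b ++ a).
Proof.
move=> aN bN; have [q1 [E1 H1]] := tripE aN; have [q2 [E2 H2]] := tripE bN.
rewrite /leB /= E1 E2 => le K i o; rewrite !fits_cat !H1 !H2.
by move: le => /=; do !case: ifP => //= ?; lia.
Qed.

Lemma perm_inw s1 s2 : perm_eq s1 s2 -> inw s1 = inw s2.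
Proof. by move=> s12; rewrite /inw (perm_sumn (perm_map iw s12)). Qed.

Lemma perm_outw s1 s2 : perm_eq s1 s2 -> outw s1 = outw s2.
Proof. by move=> s12; rewrite /outw (perm_sumn (perm_map ow s12)). Qed.

Lemma better_swap_in s1 s2 a b : a != [::] -> b != [::] -> leB a b ->
  better (s1 ++ a ++ b ++ s2) (s1 ++ b ++ a ++ s2).
Proof.
move=> aN bN le; rewrite [a ++ _]catA [b ++ _]catA; apply: better_context.
- exact/perm_inw/permEl/perm_catC.
- exact/perm_outw/permEl/perm_catC.
- exact: better_swap.
Qed.

(* If its key is below that of [a], then [e] moves before [a]; otherwise it is
   above that of [b], too, and [e] moves after [b]. *)
Lemma better_glue s1 s2 a e b : a != [::] -> b != [::] -> leB b a ->
  better (s1 ++ a ++ b ++ e ++ s2) (s1 ++ a ++ e ++ b ++ s2) \/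
  better (s1 ++ e ++ a ++ b ++ s2) (s1 ++ a ++ e ++ b ++ s2).
Proof.
move=> aN bN leba; case: (eqVneq e [::]) => [->|eN]; first by left.
case/orP: (leB_total a e) => le; last by right; apply: better_swap_in.
left; rewrite !(catA s1 a); apply: better_swap_in => //.
exact: leB_trans leba le.
Qed.

(** The form of exchange that survives later interleavings: [Y] is arbitrary and is kept as it is,
    only the strings of [X] are replaced. *)
Definition dominates (X' X : seq (seq T)) :=
  forall Y S, shuffle X Y S ->
  exists2 S', shuffle X' Y S' & better (flatten S') (flatten S).

Lemma dominates_refl X : dominates X X.
Proof. by move=> Y S sh; exists S. Qed.

Lemma dominates_trans X1 X2 X3 :
  dominates X1 X2 -> dominates X2 X3 -> dominates X1 X3.
Proof.
move=> H1 H2 Y S /H2[S2 /H1[S1 sh1 b1] b2]; exists S1 => //.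
exact: better_trans b1 b2.
Qed.

(** [Y2] is what separates [a] from [b]; [better_glue] moves it as one string to one side of
    both. *)
Lemma shuffle_pair_inv X1 X2 a b Y S :
  shuffle (X1 ++ [:: a, b & X2]) Y S ->
  exists S1 Y1 Y2 Y3 S3, [/\ Y = Y1 ++ Y2 ++ Y3,
    S = S1 ++ a :: Y2 ++ b :: S3, shuffle X1 Y1 S1 & shuffle X2 Y3 S3].
Proof.
move=> sh0; have [Y1 [Y' [S1 [S' [-> -> sh1 sh]]]]] := shuffle_cat_inv sh0.
have [Y2 [Y3 [S2 [-> -> sh2]]]] := shuffle_cons_inv sh.
have [Y4 [Y5 [S5 [-> -> sh5]]]] := shuffle_cons_inv sh2.
exists (S1 ++ Y2), (Y1 ++ Y2), Y4, Y5, S5; rewrite -?catA; split=> //.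
by rewrite -[X1]cats0; apply: shuffle_cat sh1 (shuffle0s _).
Qed.

Lemma shuffle_insert (U : Type) (X1 X2 Y1 Y2 Y3 S1 S3 M : seq U) :
  shuffle X1 Y1 S1 -> shuffle X2 Y3 S3 ->
  shuffle (X1 ++ M ++ X2) (Y1 ++ Y2 ++ Y3) (S1 ++ M ++ Y2 ++ S3) /\
  shuffle (X1 ++ M ++ X2) (Y1 ++ Y2 ++ Y3) (S1 ++ Y2 ++ M ++ S3).
Proof.
move=> sh1 sh3; split; apply: shuffle_cat => //.
  rewrite -[Y2 ++ Y3]cat0s; apply: shuffle_cat (shuffles0 _) _.
  by rewrite -[X2]cat0s; apply: shuffle_cat sh3; apply: shuffle0s.
rewrite -[M ++ X2]cat0s; apply: shuffle_cat (shuffle0s _) _.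
by rewrite -[Y3]cat0s; apply: shuffle_cat sh3; apply: shuffles0.
Qed.

Lemma dominates_glue X1 X2 a b : a != [::] -> b != [::] -> leB b a ->
  dominates (X1 ++ (a ++ b) :: X2) (X1 ++ [:: a, b & X2]).
Proof.
move=> aN bN le Y S sh.
have [S1 [Y1 [Y2 [Y3 [S3 [-> -> sh1 sh3]]]]]] := shuffle_pair_inv sh.
have [shA shB] := shuffle_insert Y2 [:: a ++ b] sh1 sh3.
case: (better_glue (flatten S1) (flatten S3) (flatten Y2) aN bN le) => bt.
  by eexists; first exact: shA; rewrite !flatten_cat /= !flatten_cat -!catA.
by eexists; first exact: shB; rewrite !flatten_cat /= !flatten_cat -!catA.
Qed.

(** The two strings are first brought together as in [dominates_glue]; as neighbours they can then
    be swapped. *)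
Lemma dominates_swap X1 X2 a b : a != [::] -> b != [::] -> leB b a ->
  dominates (X1 ++ [:: b, a & X2]) (X1 ++ [:: a, b & X2]).
Proof.
move=> aN bN le Y S sh.
have [S1 [Y1 [Y2 [Y3 [S3 [-> -> sh1 sh3]]]]]] := shuffle_pair_inv sh.
have [shA shB] := shuffle_insert Y2 [:: b; a] sh1 sh3.
case: (better_glue (flatten S1) (flatten S3) (flatten Y2) aN bN le) => bt.
- eexists; first exact: shA; rewrite !flatten_cat /= !flatten_cat cats0 -!catA.
  by apply: better_trans bt; apply: better_swap_in.
- eexists; first exact: shB; rewrite !flatten_cat /= !flatten_cat /= cats0 -!catA.
  apply: better_trans bt; rewrite !(catA (flatten S1)).
  exact: better_swap_in.
Qed.

(* A tight string can be kept together in every context: its parts would each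
   rather be swapped. *)
Inductive tight : seq T -> Prop :=
| tight1 x : tight [:: x]
| tight_cat a b : tight a -> tight b -> leB b a -> tight (a ++ b).

Lemma tight_neq0 a : tight a -> a != [::].
Proof. by elim=> // {}a b _ + _ _ _; case: a. Qed.

Definition singles s := [seq [:: x] | x <- s].

Lemma flatten_singles s : flatten (singles s) = s.
Proof. exact: flatten_seq1. Qed.

Lemma dominates_tight X1 X2 a : tight a ->
  dominates (X1 ++ a :: X2) (X1 ++ singles a ++ X2).
Proof.
move=> t; elim: t X1 X2 => [x|{}a b ta IHa tb IHb le] X1 X2.
  exact: dominates_refl.
have H1 := @dominates_glue X1 X2 _ _ (tight_neq0 ta) (tight_neq0 tb) le.
apply: dominates_trans H1 _.
apply: dominates_trans (IHa _ _) _.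
rewrite /singles map_cat -!/(singles _) -!catA.
rewrite catA [in X in dominates _ X]catA; exact: IHb.
Qed.

Definition tights (B : seq (seq T)) := forall a, a \in B -> tight a.

Lemma dominates_tights X1 B : tights B ->
  dominates (X1 ++ B) (X1 ++ singles (flatten B)).
Proof.
elim: B X1 => [|a B IH] X1 tB /=; first exact: dominates_refl.
have ta : tight a by apply: tB; rewrite inE eqxx.
rewrite /singles map_cat -!/(singles _).
apply: dominates_trans (@dominates_tight _ _ _ ta).
rewrite -cat_rcons -[X in dominates _ X]cat_rcons; apply: IH => b bB.
by apply: tB; rewrite inE bB orbT.
Qed.

Lemma dominates_bubble X1 Z0 Z1 a : a != [::] ->
  (forall b, b \in Z0 -> b != [::] /\ leB a b) ->
  dominates (X1 ++ a :: Z0 ++ Z1) (X1 ++ Z0 ++ a :: Z1).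
Proof.
move=> aN; elim: Z0 X1 => [|b Z0 IH] X1 H /=; first exact: dominates_refl.
have [bN le] : b != [::] /\ leB a b by apply: H; rewrite inE eqxx.
apply: dominates_trans (@dominates_swap _ _ _ _ bN aN le) _.
rewrite -cat_rcons -[X in dominates _ X]cat_rcons; apply: IH => c cZ.
by apply: H; rewrite inE cZ orbT.
Qed.

(** The head that [merge] selects is, by sortedness, in order before all strings of the other chain
    that precede it in [Z], so it can bubble to the front. The rest follows by induction on the
    total length. *)
Lemma dominates_merge X1 A B Z :
  shuffle A B Z -> all (predC1 [::]) (A ++ B) -> sorted leB A -> sorted leB B ->
  dominates (X1 ++ merge leB A B) (X1 ++ Z).
Proof.
have [m] := ubnP (size A + size B).
elim: m A B Z X1 => // m IH [|a A] [|b B] Z X1 lem sh.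
- move/shuffle0_inv: sh => -> *; exact: dominates_refl.
- move/shuffle0_inv: sh => -> *; exact: dominates_refl.
- move/shuffleC/shuffle0_inv: sh => -> *; exact: dominates_refl.
move=> nE sA sB.
move: nE; rewrite all_cat => /andP[/andP[aN nA] /andP[bN nB]].
have hA c : c \in a :: A -> c != [::] /\ leB a c.
  rewrite inE => /predU1P[->|cA]; first by split=> //; case/orP: (leB_total a a).
  by split; [exact: (allP nA)|apply: (allP (order_path_min leB_trans sA))].
have hB c : c \in b :: B -> c != [::] /\ leB b c.
  rewrite inE => /predU1P[->|cA]; first by split=> //; case/orP: (leB_total b b).
  by split; [exact: (allP nB)|apply: (allP (order_path_min leB_trans sB))].
have -> : merge leB (a :: A) (b :: B) =
    if leB a b then a :: merge leB A (b :: B) else b :: merge leB (a :: A) B.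
  by [].
case: ifP => le.
- have [Y1 [Y2 [S2 [eB -> sh2]]]] := shuffle_cons_inv sh.
  have H := @dominates_bubble X1 Y1 S2 a aN.
  apply: dominates_trans (H _); last first.
    move=> c cY; have [|cN lec] := hB c; first by rewrite eB mem_cat cY.
    by split=> //; exact: leB_trans lec.
  rewrite -!cat_rcons; apply: IH => //.
  + by rewrite eB; apply: (@shuffle_cat _ [::]) => //; apply: shuffle0s.
  + by rewrite all_cat; apply/andP; split=> //; apply/andP.
  + exact: path_sorted sA.
- have [Y1 [Y2 [S2 [eA -> sh2]]]] := shuffle_cons_inv (shuffleC sh).
  have H := @dominates_bubble X1 Y1 S2 b bN.
  apply: dominates_trans (H _); last first.
    move=> c cY; have [|cN lec] := hA c; first by rewrite eA mem_cat cY.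
    split=> //; apply: leB_trans lec.
    by case/orP: (leB_total a b) => //; rewrite le.
  rewrite -!cat_rcons; apply: IH => //.
  + by move: lem => /=; lia.
  + apply: shuffleC; rewrite eA; apply: (@shuffle_cat _ [::]) => //.
    exact: shuffle0s.
  + by rewrite all_cat; apply/andP; split=> //; apply/andP.
  + exact: path_sorted sB.
Qed.

(** [M] is the stretch of an order between the ends of an arc, [A] and [B] are two parallel chains
    inside it. The other vertices of [M] serve as the surrounding of [dominates]; hence their
    relative order is kept, and with it every constraint among them. *)
Lemma merge_chains A B M :
  uniq M -> tights A -> tights B -> sorted leB A -> sorted leB B ->
  subseq (flatten A) M -> subseq (flatten B) M ->
  ~~ has (mem (flatten A)) (flatten B) ->
  let p := mem (flatten A ++ flatten B) in
  exists M', [/\ perm_eq M' M, filter p M' = flatten (merge leB A B),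
    filter (predC p) M' = filter (predC p) M & better M' M].
Proof.
move=> uM tA tB sA sB subA subB dis p.
have uA : uniq (flatten A) by apply: subseq_uniq uM.
have uB : uniq (flatten B) by apply: subseq_uniq uM.
have fE X : uniq X -> subseq X M -> filter (mem X) M = X.
  by move=> uX sX; symmetry; apply/subseq_uniqP.
pose N := filter (predC (mem (flatten A))) M.
have sh1 : shuffle (singles (flatten A)) (singles N) (singles M).
  apply: shuffle_map; rewrite -{1}(fE _ uA subA); exact: shuffle_filter.
have sh2 : shuffle (singles (flatten B)) (singles (filter (predC p) M)) (singles N).
  apply: shuffle_map.
  have -> : filter (predC p) M = filter (predC (mem (flatten B))) N.
    rewrite -filter_predI; apply: eq_filter => x /=.
    by rewrite mem_cat negb_or andbC.
  rewrite -{1}(fE (flatten B)) //.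
  have -> : filter (mem (flatten B)) M = filter (mem (flatten B)) N.
    rewrite -filter_predI; apply: eq_filter => x /=.
    case xB: (x \in flatten B) => //=; symmetry; apply/negP => xA.
    by case/negP: dis; apply/hasP; exists x.
  exact: shuffle_filter.
(* The strings of [A] are gathered while [B] is still scattered in single vertices over the
   surrounding; then the roles are exchanged. *)
have [S1 sh3 b1] := dominates_tights (X1 := [::]) tA sh1.
have [Y2 sh4 sh5] := shuffle_assoc sh3 sh2.
have [S2 sh6 b2] := dominates_tights (X1 := [::]) tB sh4.
have [Z sh7 sh8] := shuffle_assocl sh6 sh5.
have nN : all (predC1 [::]) (A ++ B).
  apply/allP => a; rewrite mem_cat => /orP[aA|aB] /=.
    by apply: tight_neq0; apply: tA.
  by apply: tight_neq0; apply: tB.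
(* Both chains now consist of whole strings, interleaved as [Z], which sorting by key improves. *)
have [S3 sh9 b3] := dominates_merge (X1 := [::]) (shuffleC sh8) nN sA sB sh7.
rewrite /= in sh9; exists (flatten S3).
have pm : perm_eq (flatten (merge leB A B)) (flatten A ++ flatten B).
  by rewrite -flatten_cat; apply: perm_flatten; rewrite perm_merge.
have [] := @shuffle_flatten_filter _ p _ _ _ sh9.
- by apply/allP => x; rewrite (perm_mem pm).
- by rewrite flatten_singles; apply/allP => x; rewrite mem_filter => /andP[].
move=> e1 e2; split=> //; last 2 first.
- by rewrite e1 flatten_singles.
- rewrite -[X in better _ X]flatten_singles.
  exact: better_trans b3 (better_trans b2 b1).
have pM : perm_eq (filter p M ++ filter (predC p) M) M.
  by apply/permPl/perm_filterC.
apply: perm_trans pM; apply: perm_trans (shuffle_perm_flatten sh9) _.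
rewrite flatten_singles perm_cat2r; apply: perm_trans pm _.
apply: uniq_perm.
- by rewrite cat_uniq uA uB dis.
- exact: filter_uniq.
move=> x; rewrite mem_filter /= mem_cat.
case xA: (x \in flatten A) => /=; first by rewrite (mem_subseq subA).
case xB: (x \in flatten B) => //=; by rewrite (mem_subseq subB).
Qed.


Lemma shuffle_merge A B : shuffle A B (merge leB A B).
Proof.
elim: A B => [|a A IHA] B; first by case: B => *; apply: shuffle0s.
elim: B => [|b B IHB]; first exact: shuffles0.
have -> : merge leB (a :: A) (b :: B) =
    if leB a b then a :: merge leB A (b :: B) else b :: merge leB (a :: A) B.
  by [].
by case: ifP => _; constructor.
Qed.

(** One action of a stack algorithm that cuts a chain into tight strings. The top of the stack is
    the string read last, so [a] precedes [b] in the chain; [None] signals the end. *)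
Definition stack_step (st : seq (seq T)) (r : seq T) :=
  if st is b :: a :: st' then
    if leB a b then
      if r is x :: r' then Some ([:: x] :: st, r') else None
    else Some ((a ++ b) :: st', r)
  else if r is x :: r' then Some ([:: x] :: st, r') else None.

(** Only the part below the top is known to be sorted: a pushed or glued top has not yet been
    compared with its neighbour. *)
Definition stack_inv l (st : seq (seq T)) (r : seq T) :=
  [/\ flatten (rev st) ++ r = l, tights st
    & sorted (fun a b => leB b a) (behead st)].

Lemma stack_inv_step l st r st' r' :
  stack_inv l st r -> stack_step st r = Some (st', r') -> stack_inv l st' r'.
Proof.
have pushP x (s : seq (seq T)) (r0 : seq T) : stack_inv l s (x :: r0) ->
    sorted (fun a b => leB b a) s -> stack_inv l ([:: x] :: s) r0.
  move=> [<- ts _] ss; split=> //.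
    by rewrite rev_cons -cats1 flatten_cat /= -catA.
  by move=> a; rewrite inE => /predU1P[->|/ts]; first exact: tight1.
case: st => [|b [|a st]] /=.
- by case: r => // x r inv [<- <-]; apply: pushP.
- by case: r => // x r inv [<- <-]; apply: pushP.
case: ifP => le.
  case: r => // x r inv [<- <-]; apply: pushP => //.
  by case: inv => _ _ /= ->; rewrite le.
move=> [<- ts ss] [<- <-]; split.
- by rewrite !rev_cons -!cats1 !flatten_cat /= !cats0 -!catA.
- move=> c; rewrite inE => /predU1P[->|cst]; last first.
    by apply: ts; rewrite !inE cst !orbT.
  apply: tight_cat; try by apply: ts; rewrite !inE eqxx ?orbT.
  by case/orP: (leB_total a b) => //; rewrite le.
- exact: path_sorted ss.
Qed.

Lemma stack_inv_stop l st r : stack_inv l st r -> stack_step st r = None ->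
  [/\ r = [::], flatten (rev st) = l, tights (rev st) & sorted leB (rev st)].
Proof.
move=> [<- ts ss] stop; have r0 : r = [::].
  by case: r stop ss ts {l} => //= x r; case: st => [|b [|a st]] //=; case: ifP.
rewrite r0 cats0; split=> //; first by move=> a; rewrite mem_rev => /ts.
rewrite rev_sorted; case: st stop ss {ts} => [|b [|a st]] //=; rewrite r0.
by case: ifP => // ->.
Qed.

(** The layout in memory: every vertex carries the key of its string, so no boundaries between
    strings have to be stored. *)
Definition cells (B : seq (seq T)) : seq (T * triple) :=
  flatten [seq [seq (x, trip b) | x <- b] | b <- B].

Definition leC (c d : T * triple) := leK c.2 d.2.

Lemma cells_vertices B : map fst (cells B) = flatten B.
Proof.
elim: B => //= b B <-; rewrite /cells map_cat /=; congr (_ ++ _).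
by rewrite -map_comp map_id.
Qed.

Lemma merge_run (k : triple) b C c D : leK k c.2 ->
  merge leC ([seq (x, k) | x <- b] ++ C) (c :: D) =
  [seq (x, k) | x <- b] ++ merge leC C (c :: D).
Proof. by move=> le; elim: b => //= x b IH; rewrite {1}/leC le IH. Qed.

Lemma merge_run2 (k : triple) b C c D : ~~ leK c.2 k ->
  merge leC (c :: D) ([seq (x, k) | x <- b] ++ C) =
  [seq (x, k) | x <- b] ++ merge leC (c :: D) C.
Proof.
move=> le; elim: b => // x b IH.
have -> : merge leC (c :: D) ([seq (x, k) | x <- x :: b] ++ C) =
    if leC c (x, k) then c :: merge leC D ([seq (x, k) | x <- x :: b] ++ C)
    else (x, k) :: merge leC (c :: D) ([seq (x, k) | x <- b] ++ C).
  by [].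
by rewrite {1}/leC (negbTE le) IH.
Qed.

(** Keys are constant on a string, so every comparison within a run has the same outcome and merging
    cell by cell never cuts a string. *)
Lemma cells_merge A B : all (predC1 [::]) A -> all (predC1 [::]) B ->
  merge leC (cells A) (cells B) = cells (merge leB A B).
Proof.
have nonempty b B' : b != [::] ->
    exists c D, cells (b :: B') = c :: D /\ c.2 = trip b.
  by case: b => // x b _; eexists _, _; split.
elim: A B => [|a A IHA] B; first by case: (cells B); case: B.
elim: B => [|b B IHB] nA nB.
  by rewrite [cells [::]]/=; case: (cells _) => //; case: (a :: A).
have -> : merge leB (a :: A) (b :: B) =
    if leB a b then a :: merge leB A (b :: B) else b :: merge leB (a :: A) B.
  by [].
have [aN nA'] := andP nA; have [bN nB'] := andP nB.
have [c [C [ec kc]]] := nonempty a A aN; have [d [D [ed kd]]] := nonempty b B bN.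
case: ifP => le.
  by rewrite ed merge_run ?kd // -ed IHA.
by rewrite ec [cells (b :: B)]/= merge_run2 ?kc -?ec ?IHB // -/(leB a b) le.
Qed.

End Cost.

(** * Chains of a reduced digraph *)

Section Subseq.
Variable T : eqType.
Implicit Types (a b s t : seq T).

Lemma subseq_after x a s t : x \notin s ->
  subseq (x :: a) (s ++ x :: t) -> subseq a t.
Proof.
elim: s => [|y s IH] /=; first by rewrite eqxx.
by rewrite inE negb_or => /andP[/negbTE-> /IH].
Qed.

Lemma subseq_before x a s t : x \notin t ->
  subseq (rcons a x) (s ++ x :: t) -> subseq a s.
Proof.
move=> xt; rewrite -subseq_rev rev_rcons rev_cat rev_cons cat_rcons.
by move/subseq_after; rewrite mem_rev subseq_rev; apply.
Qed.

Lemma subseq_join x a b s : uniq s ->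
  subseq (rcons a x) s -> subseq (x :: b) s -> subseq (a ++ x :: b) s.
Proof.
move=> us sa sb; have /splitPr xs : x \in s.
  by apply: (mem_subseq sb); rewrite inE eqxx.
case: xs us sa sb => p q; rewrite cat_uniq /= negb_or.
move=> /and3P[_ /andP[xp _] /andP[xq _]] sa sb.
apply: cat_subseq; first exact: subseq_before sa.
by rewrite /= eqxx; apply: subseq_after sb.
Qed.

Lemma subseq_between x y a s : uniq s -> subseq (x :: rcons a y) s ->
  exists p m q, s = p ++ x :: m ++ y :: q /\
    (forall b, subseq (x :: rcons b y) s -> subseq b m).
Proof.
move=> us sub; have /splitPr xs : x \in s.
  by apply: (mem_subseq sub); rewrite inE eqxx.
case: xs us sub => p r us sub.
have xp : x \notin p.
  by move: us; rewrite cat_uniq /= negb_or => /and3P[_ /andP[]].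
have sub1 := subseq_after xp sub.
have /splitPr yr : y \in r by apply: (mem_subseq sub1); rewrite mem_rcons inE eqxx.
case: yr us sub1 {sub} => m q us _; exists p, m, q; split=> // b.
move/(subseq_after xp); apply: subseq_before.
by move: us; rewrite cat_uniq /= cat_uniq /= => /and4P[_ _ _ /and4P[]].
Qed.

Lemma shuffle_subseq_flatten (X Y S : seq (seq T)) : shuffle X Y S ->
  subseq (flatten X) (flatten S) /\ subseq (flatten Y) (flatten S).
Proof.
elim=> //= x X' Y' S' _ [sX sY].
  by split; [apply: cat_subseq|apply: subseq_trans sY (suffix_subseq _ _)].
by split; [apply: subseq_trans sX (suffix_subseq _ _)|apply: cat_subseq].
Qed.

End Subseq.

Section Chains.
Variables (T : eqType) (iw ow : T -> nat) (f : T -> nat).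
Variables (V : seq T) (E0 : rel T) (s t : T).
Hypothesis uV : uniq V.

Definition chains := T -> T -> seq (seq T).

Definition compatible (E : rel T) (L : chains) (o : seq T) :=
  forall u w, E u w -> subseq (u :: rcons (flatten (L u w)) w) o.

(** With empty chains, [compatible] asks only that the tail of each arc precede its head:
    [compatible E0 no_chains] is the topological orders. *)
Definition no_chains : chains := fun _ _ => [::].

(* [L u w] is the chain of the arc [uw] of the reduced digraph [E], and [l] an
   elimination order of what is left. *)
Record reduct (E : rel T) (L : chains) (l : seq T) : Prop := Reduct {
  reduct_tight : forall u w, tights iw ow (L u w) /\ sorted (leB iw ow) (L u w);
  reduct_nil : forall u w, ~~ E u w -> L u w = [::];
  reduct_disjoint : forall u w x y z, x \in flatten (L u w) -> E y z ->
    [/\ x != y, x != z & x \in flatten (L y z) -> u = y /\ w = z];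
  reduct_cover : forall x, x \in V ->
    (exists y, E x y || E y x) \/ (exists u w, x \in flatten (L u w));
  reduct_mem : forall x y, E x y -> x \in V /\ y \in V;
  reduct_increasing : increasing f E;
  reduct_elimable : elimable E s t l;
  reduct_sound : forall o, uniq o -> compatible E L o -> compatible E0 no_chains o;
  reduct_dominates : forall o, perm_eq o V -> compatible E0 no_chains o ->
    exists o', [/\ perm_eq o' V, compatible E L o' & better iw ow o' o]
}.

Definition reduce_chains (E : rel T) (L : chains) v u w B : chains :=
  fun x y => if (x == u) && (y == w) then merge (leB iw ow) B (L u w)
             else if (x == v) || (y == v) then [::] else L x y.

(** [B] is the concatenated chain cut into tight strings. Soundness passes on because [B] and the
    old chain of [uw] are both subsequences of their merge. Domination passes on because any order
    compatible with the old chains contains [B] and that chain between [u] and [w], where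
    [merge_chains] applies. *)
Lemma reduct_step E L l v u w B : reduct E L l -> legal E v u w ->
  flatten B = flatten (L u v) ++ v :: flatten (L v w) ->
  tights iw ow B -> sorted (leB iw ow) B ->
  exists l', size l = (size l').+1 /\
    reduct (elim E v) (reduce_chains E L v u w B) l'.
Proof.
case=> tight_ nil disj cover Emem inc elE sound dom lg fB tB sB.
have [vs vt [l' [sz el']]] := elimable_any inc elE lg.
exists l'; split=> //.
have [Hu Hw] := lg.
have Euv : E u v by rewrite Hu.
have Evw : E v w by rewrite Hw.
have uv : u != v by apply/eqP => e; move: (inc _ _ Euv); rewrite e ltnn.
have wv : w != v by apply/eqP => e; move: (inc _ _ Evw); rewrite e ltnn.
have uw : u != w.
  apply/eqP => e; have := ltn_trans (inc _ _ Euv) (inc _ _ Evw).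
  by rewrite e ltnn.
have E'uw : elim E v u w by rewrite /elim uv wv Euv Evw orbT.
have E'E x y : elim E v x y -> (x == u) && (y == w) = false -> E x y.
  by rewrite /elim Hu Hw => /and3P[_ _] + H; rewrite H orbF.
set L' := reduce_chains _ _ _ _ _ _.
have L'uw : L' u w = merge (leB iw ow) B (L u w) by rewrite /L' /reduce_chains !eqxx.
have memB x : (x \in flatten B) = [|| x \in flatten (L u v), x == v | x \in flatten (L v w)].
  by rewrite fB mem_cat inE.
have memL' x : (x \in flatten (L' u w)) = (x \in flatten B) || (x \in flatten (L u w)).
  rewrite L'uw -mem_cat -flatten_cat; apply: perm_mem; apply: perm_flatten.
  by rewrite perm_merge.
have L'E x y : (x == u) && (y == w) = false -> x != v -> y != v -> L' x y = L x y.
  by rewrite /L' /reduce_chains => -> /negbTE-> /negbTE->.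
have Lv0 x y c : c \in flatten (L x y) -> E x y.
  by apply: contraTT => /nil ->.
have L'0 x y c : c \in flatten (L' x y) -> (x == u) && (y == w) = false ->
    [/\ x != v, y != v & c \in flatten (L x y)].
  by rewrite /L' /reduce_chains => + H; rewrite H; case: (x == v); case: (y == v).
have vNL x y : v \notin flatten (L x y).
  by apply/negP => /disj/(_ Euv)[_]; rewrite eqxx.
(* A vertex of the new chain is [v] or lies on one of the three chains that were combined, so its
   separation from the other arcs is inherited from theirs. *)
have other x y z : x \in flatten (L' u w) -> elim E v y z ->
    [/\ x != y, x != z & (y == u) && (z == w) = false -> x \notin flatten (L y z)].
  move=> xL Eyz; have [yv zv _] := and3P Eyz.
  have [c [d [Ecd xcd cdyz]]] : exists c d, [/\ x = v \/ E c d,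
      x = v \/ x \in flatten (L c d) &
      x = v \/ ((y == u) && (z == w) = false -> ~ (c = y /\ d = z))].
    move: xL; rewrite memL' memB -!orbA => /or4P[h|/eqP->|h|h].
    - exists u, v; split; right=> //; first by move=> _ [_ e]; rewrite e eqxx in zv.
    - by exists u, v; split; left.
    - exists v, w; split; right=> //; first by move=> _ [e _]; rewrite e eqxx in yv.
    - exists u, w; split; right=> //; first exact: Lv0 h.
      by move=> + [e1 e2]; rewrite e1 e2 !eqxx.
  case: (eqVneq x v) => [->|xv].
    by split=> //; rewrite eq_sym.
  case: xcd cdyz => [e|xcd]; first by rewrite e eqxx in xv.
  case=> [e|cdyz]; first by rewrite e eqxx in xv.
  case yz: ((y == u) && (z == w)); last first.
    have [xy xz H] := disj _ _ _ _ _ xcd (E'E _ _ Eyz yz).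
    by split=> // e; apply/negP => /H; apply: cdyz.
  case/andP: yz => /eqP -> /eqP ->; split=> //.
    by have [] := disj _ _ _ _ _ xcd Euv.
  by have [] := disj _ _ _ _ _ xcd Evw.
split.
- move=> x y; rewrite /L' /reduce_chains; case: ifP => _; last by case: ifP.
  have [tl sl] := tight_ u w; split; last exact: (merge_sorted (@leB_total _ iw ow)).
  by move=> b; rewrite mem_merge mem_cat => /orP[/tB|/tl].
- move=> x y; rewrite /elim => nE; rewrite /L' /reduce_chains.
  case: ifP nE => [/andP[/eqP-> /eqP->]|xyuw]; first by rewrite uv wv Euv Evw orbT.
  case: (x == v) => //=; case: (y == v) => //=; rewrite negb_or.
  by case/andP => /nil.
- move=> x1 y1 x y z xL Eyz; case x1y1: ((x1 == u) && (y1 == w)).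
    case/andP: x1y1 => /eqP ex1 /eqP ey1; subst x1 y1.
    have [xy xz H] := other _ _ _ xL Eyz; split=> // xyz.
    case yz: ((y == u) && (z == w)); first by case/andP: yz => /eqP-> /eqP->.
    have [_ _ xyz'] := L'0 _ _ _ xyz yz.
    by case/negP: (H yz).
  have [x1v y1v xL1] := L'0 _ _ _ xL x1y1.
  have [yv zv _] := and3P Eyz.
  case yz: ((y == u) && (z == w)).
    case/andP: yz => /eqP-> /eqP->.
    have [xu _ H1] := disj _ _ _ _ _ xL1 Euv.
    have [_ xw H2] := disj _ _ _ _ _ xL1 Evw.
    split=> //; rewrite memL' memB -!orbA => /or4P[/H1[_ e]|/eqP e|/H2[e _]|h].
    - by rewrite e eqxx in y1v.
    - by move: xL1; rewrite e (negbTE (vNL _ _)).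
    - by rewrite e eqxx in x1v.
    - by have [_ _] := disj _ _ _ _ _ xL1 (Lv0 _ _ _ h); apply.
  have [xy xz H] := disj _ _ _ _ _ xL1 (E'E _ _ Eyz yz).
  by split=> //; rewrite L'E.
- move=> x xV; case: (eqVneq x v) => [->|xv].
    by right; exists u, w; rewrite memL' memB eqxx orbT.
  case: (cover x xV) => [[y Exy]|[a [b xab]]].
    left; case: (eqVneq y v) Exy => [->|yv Exy].
      rewrite Hu Hw => /orP[/eqP->|/eqP->]; [by exists w; rewrite E'uw|].
      by exists u; rewrite E'uw orbT.
    by exists y; rewrite /elim xv yv /=; case/orP: Exy => ->; rewrite ?orbT.
  right; case abuv: ((a == u) && (b == v)).
    case/andP: abuv xab => /eqP-> /eqP-> h; exists u, w.
    by rewrite memL' memB h.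
  case abvw: ((a == v) && (b == w)).
    case/andP: abvw xab => /eqP-> /eqP-> h; exists u, w.
    by rewrite memL' memB h !orbT.
  have Eab := Lv0 _ _ _ xab.
  case abuw: ((a == u) && (b == w)).
    case/andP: abuw xab => /eqP-> /eqP-> h; exists u, w.
    by rewrite memL' h !orbT.
  exists a, b; rewrite L'E //.
    by apply/eqP => e; move: Eab abvw; rewrite e Hw eqxx /= => ->.
  by apply/eqP => e; move: Eab abuv; rewrite e Hu eqxx andbT => ->.
- move=> x y; rewrite /elim => /and3P[_ _ /orP[/Emem//|/andP[/Emem[xV _] /Emem[_ yV]]]].
  by [].
- exact: increasing_elim.
- exact: el'.
- move=> o uo co; apply: sound => // a b Eab.
  have := co u w E'uw; rewrite L'uw => suw.
  have [sB' sL'] := shuffle_subseq_flatten (shuffle_merge iw ow B (L u w)).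
  have chain c : subseq c (flatten (merge (leB iw ow) B (L u w))) ->
      subseq (u :: rcons c w) o.
    move=> sc; apply: subseq_trans suw; rewrite /= eqxx -!cats1.
    exact: cat_subseq.
  case abuv: ((a == u) && (b == v)).
    case/andP: abuv => /eqP-> /eqP->; apply: subseq_trans (chain _ sB').
    by rewrite fB rcons_cat rcons_cons -cat_rcons -cat_cons prefix_subseq.
  case abvw: ((a == v) && (b == w)).
    case/andP: abvw => /eqP-> /eqP->; apply: subseq_trans (chain _ sB').
    by rewrite fB rcons_cat -cat_cons suffix_subseq.
  case abuw: ((a == u) && (b == w)).
    by case/andP: abuw => /eqP-> /eqP->; apply: chain.
  have av : a != v.
    by apply/eqP => e; move: Eab abvw; rewrite e Hw eqxx /= => ->.
  have bv : b != v.
    by apply/eqP => e; move: Eab abuv; rewrite e Hu eqxx andbT => ->.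
  by rewrite -(L'E _ _ abuw av bv); apply: co; rewrite /elim av bv Eab.
- move=> o0 po0 co0; have [o [po co bo]] := dom _ po0 co0.
  have uo : uniq o by rewrite (perm_uniq po).
  have subB : subseq (u :: rcons (flatten B) w) o.
    rewrite fB rcons_cat -cat_cons; apply: subseq_join => //; first exact: (co _ _ Euv).
    exact: (co _ _ Evw).
  (* Only the stretch [m] between [u] and [w] is rearranged. *)
  have [p [m [q [oE between]]]] := subseq_between uo subB.
  have um : uniq m.
    by move: uo; rewrite oE cat_uniq /= cat_uniq => /and4P[_ _ _ /andP[]].
  have dis : ~~ has (mem (flatten B)) (flatten (L u w)).
    apply/hasP => -[x xL]; have Euw := Lv0 _ _ _ xL.
    rewrite /= memB => /or3P[h|/eqP e|h].
    - have [_ _ /(_ xL)[_ e]] := disj _ _ _ _ _ h Euw.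
      by rewrite e eqxx in wv.
    - by move: xL; rewrite e (negbTE (vNL _ _)).
    - have [_ _ /(_ xL)[e _]] := disj _ _ _ _ _ h Euw.
      by rewrite -e eqxx in uv.
  have subL : subseq (flatten (L u w)) m.
    case Euw: (E u w); first by apply: between; apply: co.
    by rewrite nil ?Euw ?sub0seq.
  have [tl sl] := tight_ u w.
  have [m' [pm mp mp' bm]] :=
    merge_chains um tB tl sB sl (between _ subB) subL dis.
  exists (p ++ u :: m' ++ w :: q); split.
  + apply: perm_trans po; rewrite oE perm_cat2l perm_cons perm_cat2r.
    exact: pm.
  + move=> a b Eab; case abuw: ((a == u) && (b == w)).
      case/andP: abuw => /eqP-> /eqP->; rewrite L'uw -mp.
      apply: subseq_trans (suffix_subseq _ _); rewrite /= eqxx -cats1.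
      apply: cat_subseq; first exact: filter_subseq.
      by rewrite sub1seq inE eqxx.
    have [av bv _] := and3P Eab; rewrite L'E //.
    set P := mem (flatten B ++ flatten (L u w)) in mp mp'.
    (* The other arcs and their chains avoid the vertices of the new chain; they lie in the filtered
       part of the order, which the rearrangement does not change. *)
    have out x : x \in a :: rcons (flatten (L a b)) b -> predC P x.
      have -> : predC P x = (x \notin flatten (L' u w)) by rewrite memL' -mem_cat.
      rewrite inE mem_rcons inE => xab; apply/negP => /other/(_ Eab).
      case=> xa xb /(_ abuw); move: xab; rewrite (negbTE xa) (negbTE xb) /=.
      by move=> ->.
    have : subseq (a :: rcons (flatten (L a b)) b) (filter (predC P) o).
      rewrite subseq_filter co ?(E'E _ _ Eab) // andbT; exact/allP.
    rewrite oE !filter_cat /= !filter_cat /= -mp' => h.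
    apply: subseq_trans (filter_subseq (predC P) _).
    by rewrite !filter_cat /= !filter_cat.
  + apply: better_trans bo; rewrite oE.
    have := @better_context _ iw ow (p ++ [:: u]) (w :: q) m' m.
    rewrite -!catA /=; apply; [exact: perm_inw|exact: perm_outw|exact: bm].
Qed.

(** Every vertex is an end of the last arc or on its chain, so the chain with its ends is the only
    compatible order. By domination it is at least as good as every topological order. *)
Lemma reduct_single E L : reduct E L [::] -> forall o, perm_eq o V ->
  compatible E L o -> o = s :: rcons (flatten (L s t)) t.
Proof.
case=> _ nil _ cover _ _ /= EE _ _ o po co.
have Est : E s t by rewrite EE !eqxx.
have sub := co _ _ Est.
have uo : uniq o by rewrite (perm_uniq po).
symmetry; apply/eqP; rewrite -(size_subseq_leqif sub) eqn_leq size_subseq //.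
apply: uniq_leq_size => // x; rewrite (perm_mem po) => /cover.
rewrite inE mem_rcons inE => -[[y]|[u [w xuw]]].
  by rewrite !EE => /orP[/andP[->]|/andP[_ ->]]; rewrite ?orbT.
have : E u w by apply: contraTT xuw => /nil ->.
by rewrite EE => /andP[/eqP e1 /eqP e2]; rewrite -e1 -e2 xuw !orbT.
Qed.

Lemma reduct_init l : (forall x, x \in V -> exists y, E0 x y || E0 y x) ->
  (forall x y, E0 x y -> x \in V /\ y \in V) -> increasing f E0 ->
  elimable E0 s t l -> reduct E0 no_chains l.
Proof.
move=> cover mem inc el; split=> //.
- by move=> x /cover; left.
- by move=> o po co; exists o; split=> // K i o'.
Qed.

(** Sorting by the potential gives one topological order, a seed from which [reduct_dominates]
    produces orders compatible with the chains. *)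
Lemma exists_compatible : (forall x y, E0 x y -> x \in V /\ y \in V) ->
  increasing f E0 -> exists2 o, perm_eq o V & compatible E0 no_chains o.
Proof.
move=> mem inc; exists (sort (relpre f leq) V); first by rewrite perm_sort.
move=> u w Euw; have [uVm wVm] := mem _ _ Euw; rewrite /=.
set o := sort _ _; have so : sorted (relpre f leq) o.
  by apply: sort_sorted => x y; apply: leq_total.
have uo : u \in o by rewrite mem_sort.
have wo : w \in o by rewrite mem_sort.
have lt := inc _ _ Euw.
case/splitPr: wo so uo => p q so; rewrite mem_cat inE => /or3P[up|/eqP e|uq].
- rewrite -[[:: u; w]]/([:: u] ++ [:: w]); apply: cat_subseq; rewrite sub1seq //.
  by rewrite inE eqxx.
- by rewrite e ltnn in lt.
- have tr : transitive (relpre f leq) by move=> x y z; apply: leq_trans.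
  move: so; rewrite sorted_cat_cons => /andP[_ /(order_path_min tr)/allP/(_ u uq)].
  by rewrite /= leqNgt lt.
Qed.

End Chains.

(** * Array segments as lists *)

Section Segments.
Variable A : Type.
Implicit Type g : nat -> A.

Definition seg g lo hi := [seq g i | i <- iota lo (hi - lo)].

Lemma size_seg g lo hi : size (seg g lo hi) = hi - lo.
Proof. by rewrite size_map size_iota. Qed.

Lemma seg_nil g lo hi : hi <= lo -> seg g lo hi = [::].
Proof. by rewrite /seg -subn_eq0 => /eqP->. Qed.

Lemma seg_recl g lo hi : lo < hi -> seg g lo hi = g lo :: seg g lo.+1 hi.
Proof. by move=> lt; rewrite /seg -subSS subSn. Qed.

Lemma seg_cat g lo mid hi : lo <= mid -> mid <= hi ->
  seg g lo hi = seg g lo mid ++ seg g mid hi.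
Proof.
move=> le1 le2; rewrite /seg -map_cat; congr map.
have -> : hi - lo = (mid - lo) + (hi - mid) by lia.
by rewrite iotaD subnKC.
Qed.

Lemma seg_recr g lo hi : lo <= hi -> seg g lo hi.+1 = rcons (seg g lo hi) (g hi).
Proof.
move=> le; rewrite (@seg_cat _ _ hi) // -cats1; congr (_ ++ _).
by rewrite seg_recl // seg_nil.
Qed.

Lemma eq_seg g g' lo hi : (forall i, lo <= i -> i < hi -> g i = g' i) ->
  seg g lo hi = seg g' lo hi.
Proof.
move=> e; apply/eq_in_map => i; rewrite mem_iota => /andP[le lt]; apply: e; lia.
Qed.

Lemma seg_shift g g' lo lo' m :
  (forall i, i < m -> g (lo + i) = g' (lo' + i)) ->
  seg g lo (lo + m) = seg g' lo' (lo' + m).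
Proof.
elim: m => [|m IH] e; first by rewrite !seg_nil ?addn0.
rewrite !addnS !seg_recr ?leq_addr // e // IH // => i lt; apply: e; exact: ltnW.
Qed.

End Segments.

Lemma map_seg (A B : Type) (h : A -> B) (g : nat -> A) lo hi :
  map h (seg g lo hi) = seg (h \o g) lo hi.
Proof. by rewrite /seg -map_comp. Qed.



(* The chains are stored as segments of the arrays [aCV] (vertices) and [aCP],
   [aCQ], [aCR] (keys).  The segment of the arc [uw] starts at [aBASE] and has
   length [aLEN], at the address of [uw] in the matrix.  New segments are
   allocated from [rTOP] on, so that no segment is ever overwritten. *)
Notation rN := 0 (only parsing).
Notation rX := 1 (only parsing).
Notation rY := 2 (only parsing).
Notation rROW := 3 (only parsing).
Notation rARCS := 4 (only parsing).
Notation rLEFT := 5 (only parsing).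
Notation rTOP := 6 (only parsing).
Notation rV := 7 (only parsing).
Notation rU := 8 (only parsing).
Notation rW := 9 (only parsing).
Notation rI := 10 (only parsing).
Notation rJ := 11 (only parsing).
Notation rE := 12 (only parsing).
Notation rF := 13 (only parsing).
Notation rD := 14 (only parsing).
Notation rSP := 15 (only parsing).
Notation rGO := 16 (only parsing).
Notation rFLAG := 17 (only parsing).
Notation rOUT := 18 (only parsing).
Notation rIN := 19 (only parsing).
Notation rQ := 20 (only parsing).

Notation aMAT := 0 (only parsing).
Notation aPOS := 1 (only parsing).
Notation aROW := 2 (only parsing).
Notation aIN := 3 (only parsing).
Notation aOUT := 4 (only parsing).
Notation aDI := 5 (only parsing).
Notation aDO := 6 (only parsing).
Notation aBASE := 7 (only parsing).
Notation aLEN := 8 (only parsing).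
Notation aCV := 9 (only parsing).
Notation aCP := 10 (only parsing).
Notation aCQ := 11 (only parsing).
Notation aCR := 12 (only parsing).
Notation aSP := 13 (only parsing).
Notation aSQ := 14 (only parsing).
Notation aSR := 15 (only parsing).
Notation aSE := 16 (only parsing).

Declare Scope prog_scope.
Delimit Scope prog_scope with prog.
Notation "p ;; q" := (Seq p q) (at level 90, right associativity) : prog_scope.
Notation "x <~ e" := (Assign x e) (at level 80) : prog_scope.
Notation "a @ i <~ e" := (Write a i e) (at level 80, i at level 10) : prog_scope.
Definition Incr x := Assign x (Add (Reg x) (Const 1)).

(** * Searching *)

Definition search_body r c := 
  (If c (r <~ Reg rX) Skip;; Incr rX)%prog.
Definition search r c :=
  (rX <~ Const 0;; While (Sub (Reg rN) (Reg rX)) (search_body r c))%prog.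

(** The scan passes through all [x < n] and keeps the last hit; any hit serves. *)
Lemma runs_search r c s (P : pred nat) n :
  r != rN -> r != rX -> reg s rN = n -> (exists2 x, x < n & P x) ->
  (forall s', (forall x, x != r -> x != rX -> reg s' x = reg s x) ->
     (forall a i, arr s' a i = arr s a i) -> reg s' rX < n ->
     (eval s' c != 0) = P (reg s' rX)) ->
  runs (search r c) s ((expr_cost c + 20) * n.+1)
    (fun s' => reg s' r < n /\ P (reg s' r)).
Proof.
move=> rn rx sn [x0 x0n Px0] cP.
set T := (_ * _); pose body := search_body r c.
have le : (2 + n.+1 * (3 + cost body).+1).+1 <= T by rewrite /T /=; nia.
apply: (runs_le le).
apply: runs_seq; apply: runs_denote => //; set s1 := denote _ _.
pose I k s := reg s rX + k = n /\
  ((exists2 y, y < reg s rX & P y) -> reg s r < n /\ P (reg s r)).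
have same s2 : frame body s1 s2 ->
    (forall x, x != r -> x != rX -> reg s2 x = reg s x) /\
    (forall a i, arr s2 a i = arr s a i).
  move=> [fr fa]; split=> [x xr x1|a i]; last by rewrite fa.
  rewrite fr /= ?(negbTE x1) //.
  by rewrite !inE (negbTE xr) (negbTE x1).
apply: (runs_for (I := I)) => //.
- by rewrite /I /=; split=> // -[].
- move=> k s2 /same[sr sa] [Xk H] /= lt.
  have s2n : reg s2 rN = n by rewrite sr // eq_sym.
  exists k.-1; first lia.
  have Xn : reg s2 rX < n by lia.
  have cE := cP s2 sr sa Xn.
  have x1r : (1 == r) = false by rewrite eq_sym (negbTE rx).
  case: ifP => c0; rewrite /I /= (negbTE rx) ?eqxx ?x1r; split; try lia.
  move=> [y yX Py]; apply: H; exists y => //.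
  by move: yX; rewrite addn1 ltnS leq_eqVlt => /predU1P[e|//]; move: Py; rewrite e -cE c0.
- move=> k s2 /same[sr sa] [Xk H] /= e; apply: H; exists x0 => //.
  have s2n : reg s2 rN = n by rewrite sr // eq_sym.
  lia.
Qed.

(** * Copying a chain *)

Definition copy_body :=
  (aCV @ Reg rD <~ Read aCV (Reg rJ);; Incr rD;; Incr rJ)%prog.
Definition copy := While (Sub (Reg rF) (Reg rJ)) copy_body.

(** The source ends at or below the start of the destination, so no cell is overwritten before it is
    read. *)
Lemma runs_copy s : reg s rF <= reg s rD -> reg s rJ <= reg s rF ->
  runs copy s (20 * (reg s rF - reg s rJ).+1) (fun s' =>
    [/\ reg s' rD = reg s rD + (reg s rF - reg s rJ),
        forall i, i < reg s rD -> arr s' aCV i = arr s aCV i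
      & seg (arr s' aCV) (reg s rD) (reg s' rD) =
        seg (arr s aCV) (reg s rJ) (reg s rF)]).
Proof.
move=> leFD leJF; set m := _ - _.
have le : m.+1 * (3 + cost copy_body).+1 <= 20 * m.+1 by rewrite /=; nia.
apply: (runs_le le).
pose I k s' := exists2 j, j + k = m & [/\ reg s' rJ = reg s rJ + j,
  reg s' rD = reg s rD + j,
  forall i, i < reg s rD -> arr s' aCV i = arr s aCV i
  & forall i, i < j -> arr s' aCV (reg s rD + i) = arr s aCV (reg s rJ + i)].
apply: (runs_for (I := I)) => //.
- by exists 0; rewrite ?addn0.
- move=> k s2 [fr _] [j jk [EJ ED lo hi]] /= lt.
  have EF := fr rF isT; exists k.-1; first lia.
  exists j.+1; first lia.
  split; rewrite /= ?EJ ?ED ?addn1 ?addnS //.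
    by move=> i lti; rewrite ifN ?lo //; lia.
  move=> i; rewrite ltnS leq_eqVlt => /predU1P[->|ltij].
    by rewrite eqxx lo //; lia.
  by rewrite ifN ?hi //; lia.
- move=> k s2 [fr _] [j jk [EJ ED lo hi]] /= e.
  have EF := fr rF isT; have jm : j = m by lia.
  rewrite jm in ED; split=> //; rewrite ED.
  have -> : reg s rF = reg s rJ + m by lia.
  by apply: seg_shift => i lti; apply: hi; lia.
Qed.

(** * Splitting a chain into tight strings *)

(** Branch-free form of [leK]. Sums are compared, since differences are truncated. *)
Definition LeKey p1 q1 r1 p2 q2 r2 :=
  Or (And (Le r1 p1) (Or (Not (Le r2 p2)) (Le (Add q1 p2) (Add q2 p1))))
     (And (Not (Le r1 p1)) (And (Not (Le r2 p2)) (Le (Add q2 r1) (Add q1 r2)))).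
Arguments LeKey : simpl never.

Lemma eval_LeKey s p1 q1 r1 p2 q2 r2 :
  eval s (LeKey p1 q1 r1 p2 q2 r2) =
  leK (eval s p1, eval s q1, eval s r1) (eval s p2, eval s q2, eval s r2).
Proof.
set x := leK _ _.
have -> : x = (eval s r1 <= eval s p1) && (~~ (eval s r2 <= eval s p2) ||
      (eval s (Add q1 p2) <= eval s (Add q2 p1))) ||
    ~~ (eval s r1 <= eval s p1) && (~~ (eval s r2 <= eval s p2) &&
      (eval s (Add q2 r1) <= eval s (Add q1 r2))).
  by rewrite /x /leK; case: (_ <= _) => //=; case: (_ <= _); rewrite //= orbF.
apply: eval_Or; apply: eval_And.
- exact: eval_Le.
- by apply: eval_Or; [apply: eval_Not|]; apply: eval_Le.
- by apply: eval_Not; apply: eval_Le.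
- by apply: eval_And; [apply: eval_Not|]; apply: eval_Le.
Qed.

Section Decompose.
Variables iw ow : nat -> nat.

Definition slot s i : triple := (arr s aSP i, arr s aSQ i, arr s aSR i).

(** Slots are numbered from 1, so the stack pointer is the height of the stack; [aSE] holds the
    position just after the last vertex of a string. *)
Fixpoint slots s lo (st : seq (seq nat)) :=
  if st is b :: st' then
    [/\ slot s (size st) = trip iw ow b,
        arr s aSE (size st) = lo + size (flatten (rev st)) & slots s lo st']
  else True.

Lemma slots_ext s s' lo st :
  (forall i, i <= size st -> slot s' i = slot s i /\ arr s' aSE i = arr s aSE i) ->
  slots s lo st -> slots s' lo st.
Proof.
elim: st => //= b st IH e [s1 s2 s3]; have [-> ->] := e _ (leqnn _).
by split=> //; apply: IH s3 => i le; apply: e; apply: leqW.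
Qed.

Lemma slots_nth s lo B1 b B2 : slots s lo (rev (B1 ++ b :: B2)) ->
  slot s (size B1).+1 = trip iw ow b /\
  arr s aSE (size B1).+1 = lo + size (flatten B1) + size b.
Proof.
rewrite rev_cat rev_cons cat_rcons; elim: (rev B2) => [|c C IH] /= [] //.
rewrite size_rev => -> -> _; split=> //.
by rewrite rev_cons revK flatten_rcons size_cat addnA.
Qed.

Definition test_top e :=
 (rFLAG <~ Const 0;;
  If (Sub (Reg rSP) (Const 1)) (rFLAG <~ Not e) Skip)%prog.

Definition compare_top := test_top
  (LeKey (Read aSP (Sub (Reg rSP) (Const 1)))
         (Read aSQ (Sub (Reg rSP) (Const 1)))
         (Read aSR (Sub (Reg rSP) (Const 1)))
         (Read aSP (Reg rSP)) (Read aSQ (Reg rSP)) (Read aSR (Reg rSP))).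

(** Implements [comb]: with truncated subtraction, [X + (Q - X)] is the maximum. The glued string
    ends where the old top ended. *)
Definition glue_top :=
 (rY <~ Reg rSP;;
  rSP <~ Sub (Reg rSP) (Const 1);;
  rX <~ Add (Read aSQ (Reg rSP)) (Read aSP (Reg rY));;
  rQ <~ Add (Read aSR (Reg rSP)) (Read aSQ (Reg rY));;
  aSQ @ Reg rSP <~ Add (Reg rX) (Sub (Reg rQ) (Reg rX));;
  aSP @ Reg rSP <~ Add (Read aSP (Reg rSP)) (Read aSP (Reg rY));;
  aSR @ Reg rSP <~ Add (Read aSR (Reg rSP)) (Read aSR (Reg rY));;
  aSE @ Reg rSP <~ Read aSE (Reg rY))%prog.

Definition push_next :=
 (Incr rSP;;
  aSP @ Reg rSP <~ Read aIN (Read aCV (Reg rI));;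
  aSQ @ Reg rSP <~ Const 0;;
  aSR @ Reg rSP <~ Read aOUT (Read aCV (Reg rI));;
  Incr rI;;
  aSE @ Reg rSP <~ Reg rI)%prog.

Definition stack_action :=
  If (Reg rFLAG) glue_top
     (If (Sub (Reg rE) (Reg rI)) push_next (rGO <~ Const 0)%prog).

Definition decompose :=
 (rI <~ Reg rTOP;; rSP <~ Const 0;; rGO <~ Const 1;;
  While (Reg rGO) (compare_top;; stack_action))%prog.

Lemma test_topP e s (b : bool) :
  (1 < reg s rSP -> eval (set_reg s rFLAG 0) e = b) ->
  let s' := denote (test_top e) s in
  [/\ reg s' rFLAG = (1 < reg s rSP) && ~~ b,
      forall x, x != rFLAG -> reg s' x = reg s x
    & forall a i, arr s' a i = arr s a i].
Proof.
move=> eb; rewrite /= ltnNge -subn_eq0; case: ifP => sp1 /=; split=> //.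
- by rewrite eb; [case: (b)|rewrite ltnNge -subn_eq0].
- by move=> x /negbTE->.
- by move=> x /negbTE->.
Qed.

Lemma compare_topP s lo st : reg s rSP = size st -> slots s lo st ->
  let s' := denote compare_top s in
  [/\ reg s' rFLAG = nat_of_bool (if st is b :: a :: _ then ~~ leB iw ow a b else false),
      forall x, x != rFLAG -> reg s' x = reg s x
    & forall a i, arr s' a i = arr s a i].
Proof.
move=> ESP sl; pose b := if st is b :: a :: _ then leB iw ow a b else false.
have [|H1 H2 H3] := @test_topP (LeKey (Read aSP (Sub (Reg rSP) (Const 1)))
         (Read aSQ (Sub (Reg rSP) (Const 1)))
         (Read aSR (Sub (Reg rSP) (Const 1)))
         (Read aSP (Reg rSP)) (Read aSQ (Reg rSP)) (Read aSR (Reg rSP))) s b.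
  rewrite eval_LeKey /b ESP {b}; case: st ESP sl => [|c [|a st]] // ESP [sb _ [sa _ _]] _.
  by rewrite /= ESP subn1 /= /leB -[trip _ _ a]sa -[trip _ _ c]sb.
split=> //; rewrite [LHS]H1 ESP /b.
by case: (st) => [|c [|a st']].
Qed.

Lemma glue_topP s lo b a st : a != [::] -> b != [::] ->
  reg s rSP = (size st).+2 -> slots s lo [:: b, a & st] ->
  let s' := denote glue_top s in
  reg s' rSP = (size st).+1 /\ slots s' lo ((a ++ b) :: st).
Proof.
move=> aN bN ESP [sb eb [sa ea sl]].
rewrite /= ESP subn1 /=; split=> //; split.
- rewrite /slot /= !eqxx /= trip_cat // -[trip _ _ a]sa -[trip _ _ b]sb /=.
  by congr (_, _, _); lia.
- rewrite /= eqxx eb /= !rev_cons -!cats1 !flatten_cat /= !size_cat /=.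
  by rewrite ?size_cat /= ?cats0 ?size_cat; lia.
- apply: slots_ext sl => i le; by rewrite /slot /= !ltn_eqF.
Qed.

Lemma push_nextP s lo x st : arr s aCV (reg s rI) = x ->
  arr s aIN x = iw x -> arr s aOUT x = ow x ->
  reg s rI = lo + size (flatten (rev st)) ->
  reg s rSP = size st -> slots s lo st ->
  let s' := denote push_next s in
  [/\ reg s' rSP = (size st).+1, reg s' rI = (reg s rI).+1
    & slots s' lo ([:: x] :: st)].
Proof.
move=> Ex Ein Eout EI ESP sl; rewrite /= ESP addn1; split=> //; first by rewrite addn1.
split.
- by rewrite /slot /= !eqxx /= Ex Ein Eout.
- by rewrite /= eqxx rev_cons -cats1 flatten_cat size_cat /= EI; lia.
- apply: slots_ext sl => i le; by rewrite /slot /= !ltn_eqF.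
Qed.

(** Linear by amortization. The measure is twice the number of unread vertices plus the height of
    the stack plus the flag [rGO]; a push, a gluing and the final stop each lower it by one. *)
Lemma runs_decompose s : reg s rTOP <= reg s rE ->
  (forall x, x \in seg (arr s aCV) (reg s rTOP) (reg s rE) ->
     arr s aIN x = iw x /\ arr s aOUT x = ow x) ->
  runs decompose s (1000 * (reg s rE - reg s rTOP).+1) (fun s' =>
    exists B, [/\ flatten B = seg (arr s aCV) (reg s rTOP) (reg s rE),
      tights iw ow B, sorted (leB iw ow) B & slots s' (reg s rTOP) (rev B)]).
Proof.
set lo := reg s rTOP; set hi := reg s rE; set l := seg _ _ _ => lohi inout.
have sz : size l = hi - lo by rewrite size_seg.
set T := (_ * _); pose body := (compare_top;; stack_action)%prog.
have cb : cost body <= 300 by vm_compute.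
have le : (2 + (2 + (2 + (2 * size l).+2 * (1 + cost body).+1).+1).+1).+1 <= T by rewrite /T sz; nia.
apply: (runs_le le).
do 3 (apply: runs_seq; apply: runs_denote => //).
set s1 := denote _ _.
pose I k s' := exists st r, [/\ stack_inv iw ow l st r,
  reg s' rSP = size st /\ slots s' lo st,
  r = seg (arr s aCV) (reg s' rI) hi /\ reg s' rI <= hi,
  reg s' rGO <= 1 /\ (reg s' rGO = 0 -> stack_step iw ow st r = None)
  & k = 2 * size r + size st + reg s' rGO].
apply: (runs_while (I := I)).
- by exists [::], l; split=> //; rewrite addn0 addn1.
- move=> k s2 [fr fa] [st [r [inv [ESP sl] [er leI] [GO1 GO0] ->]]] nz.
  have EE : reg s2 rE = hi by rewrite fr.
  have GO : reg s2 rGO = 1 by move: nz GO1 => /=; case: (reg s2 _) => [|[]].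
  have [flr ts _] := inv.
  exists (2 * size r + size st); first lia.
  apply: runs_seq; apply: runs_denote => //; apply: runs_denote => //.
  set s3 := denote compare_top s2.
  have [H1 H2 H3] := compare_topP ESP sl; rewrite -/s3 in H1 H2 H3.
  have sl3 : slots s3 lo st by apply: slots_ext sl => i _; rewrite /slot !H3.
  have ESP3 : reg s3 rSP = size st by rewrite H2.
  have EI3 : reg s3 rI = lo + size (flatten (rev st)).
    rewrite H2 //; have := congr1 size flr.
    by rewrite size_cat sz er size_seg; lia.
  have EE3 : reg s3 rE = hi by rewrite H2.
  have EGO3 : reg s3 rGO = 1 by rewrite H2.
  pose flag := if st is b :: a :: _ then ~~ leB iw ow a b else false.
  rewrite -/flag in H1; rewrite /stack_action denote_If [eval _ _]/= H1.
  rewrite (_ : ((flag : nat) != 0) = flag); last by case: (flag).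
  case: ifP => fl.
    case: st @flag fl H1 inv ESP3 sl3 ts {ESP sl EI3 flr GO0} => [|b [|a st]] //= nle _ inv.
    move=> ESP3 sl3 ts; set s4 := denote glue_top s3.
    have [fr4 fa4] := @denote_frame glue_top s3 isT; rewrite -/s4 in fr4 fa4.
    have aN : a != [::] by apply: (@tight_neq0 _ iw ow); apply: ts; rewrite !inE eqxx orbT.
    have bN : b != [::] by apply: (@tight_neq0 _ iw ow); apply: ts; rewrite !inE eqxx.
    have [ESP4 sl4] := glue_topP aN bN ESP3 sl3; rewrite -/s4 in ESP4 sl4.
    have EI4 : reg s4 rI = reg s2 rI by rewrite fr4 // H2.
    exists ((a ++ b) :: st), r; split=> //.
    - apply: stack_inv_step inv _; by rewrite /= (negbTE nle).
    - by rewrite EI4.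
    - by rewrite fr4 // EGO3.
    - by rewrite fr4 // EGO3 /=; lia.
  rewrite denote_If [eval _ _]/= EE3 H2 //.
  move/negbT in fl.
  have noglue : forall x r', r = x :: r' -> stack_step iw ow st r = Some ([:: x] :: st, r').
    move=> x r' ->; move: fl; rewrite /flag; case: (st) => [|b [|a st']] //=.
    by rewrite negbK => ->.
  have [lt|ge] := ltnP (reg s2 rI) hi.
    rewrite ifT; last by rewrite subn_eq0 -ltnNge.
    pose x := arr s aCV (reg s2 rI).
    rewrite seg_recl // -/x in er.
    set s4 := denote push_next s3.
    have [fr4 fa4] := @denote_frame push_next s3 isT; rewrite -/s4 in fr4 fa4.
    have [xi xo] : arr s aIN x = iw x /\ arr s aOUT x = ow x.
      by apply: inout; rewrite -/l -flr er mem_cat inE eqxx orbT.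
    have [|||ESP4 EI4 sl4] := @push_nextP s3 lo x st _ _ _ EI3 ESP3 sl3.
    - by rewrite H3 H2 // fa.
    - by rewrite H3 fa.
    - by rewrite H3 fa.
    exists ([:: x] :: st), (seg (arr s aCV) (reg s2 rI).+1 hi); split=> //.
    - by apply: stack_inv_step inv _; apply: noglue.
    - by rewrite EI4 H2.
    - by rewrite fr4 // EGO3.
    - by rewrite fr4 // EGO3 er /=; lia.
  rewrite ifF; last by apply/negbTE; rewrite negbK subn_eq0.
  have r0 : r = [::] by rewrite er seg_nil.
  exists st, r; split=> //=; last lia.
  - split; first by rewrite H2.
    by apply: slots_ext sl3.
  - by rewrite H2.
  - split=> // _; move: fl; rewrite /flag r0; case: (st) => [|b [|a st']] //=.
    by rewrite negbK => ->.
- move=> k s2 _ [st [r [inv [_ sl] _ [_ GO0] _]]] /= GO.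
  have [_ fB tB sB] := stack_inv_stop inv (GO0 GO).
  by exists (rev st); rewrite revK.
Qed.

End Decompose.

Definition cell s i : nat * triple :=
  (arr s aCV i, (arr s aCP i, arr s aCQ i, arr s aCR i)).

(** * Writing the keys of the strings *)

Section Fill.
Variables iw ow : nat -> nat.

Definition next_string :=
  If (Le (Read aSE (Reg rJ)) (Reg rI)) (Incr rJ) Skip.

Definition fill_cell :=
 (aCP @ Reg rI <~ Read aSP (Reg rJ);;
  aCQ @ Reg rI <~ Read aSQ (Reg rJ);;
  aCR @ Reg rI <~ Read aSR (Reg rJ);;
  Incr rI)%prog.

Definition fill_body := (next_string;; fill_cell)%prog.

Definition fill :=
 (rI <~ Reg rTOP;; rJ <~ Const 1;;
  While (Sub (Reg rE) (Reg rI)) fill_body)%prog.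

(** [rI] walks over the positions of the chain and [rJ] over the slots of the stack. Tight strings
    are nonempty, so advancing [rJ] by at most one per position keeps up. *)
Lemma runs_fill s B : reg s rTOP < reg s rE ->
  flatten B = seg (arr s aCV) (reg s rTOP) (reg s rE) -> tights iw ow B ->
  slots iw ow s (reg s rTOP) (rev B) ->
  runs fill s (100 * (reg s rE - reg s rTOP).+1) (fun s' =>
    seg (cell s') (reg s rTOP) (reg s rE) = cells iw ow B /\
    forall i, i < reg s rTOP -> cell s' i = cell s i).
Proof.
set lo := reg s rTOP; set hi := reg s rE => lohi flB tB sl.
set T := (_ * _).
have le : (2 + (2 + (hi - lo).+1 * (3 + cost fill_body).+1).+1).+1 <= T.
  by rewrite /T /=; nia.
apply: (runs_le le).
do 2 (apply: runs_seq; apply: runs_denote => //).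
set s1 := denote _ _.
have nonempty (b : seq nat) : b \in B -> 0 < size b.
  by move=> /tB/(@tight_neq0 _ iw ow); case: b.
have szB : size (flatten B) = hi - lo by rewrite flB size_seg.
(* [b1] is the part of [b] already filled. [b2] may be empty: then [rJ] still points to the finished
   string and is advanced in the next round. *)
pose I k s' := exists B1 b B2 b1 b2,
  [/\ B = B1 ++ b :: B2, b = b1 ++ b2,
    reg s' rJ = (size B1).+1 /\ reg s' rI = lo + size (flatten B1) + size b1,
    reg s' rI + k = hi
  & seg (cell s') lo (reg s' rI) =
      cells iw ow B1 ++ [seq (x, trip iw ow b) | x <- b1] /\
    forall i, i < lo -> cell s' i = cell s i].
apply: (runs_for (I := I)) => //.
- case: B flB tB sl szB nonempty @I => [|b B] flB _ _ szB _; first by move: szB => /=; lia.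
  exists [::], b, B, [::], b; rewrite /= addn0 addn0 seg_nil //; split=> //; lia.
- move=> k s2 [fr fa] [B1 [b [B2 [b1 [b2 [eB eb [EJ EI] Ik [sgc cl]]]]]]] lt; rewrite /= in lt.
  have EE : reg s2 rE = hi by rewrite fr.
  have sl2 : slots iw ow s2 lo (rev (B1 ++ b :: B2)).
    by rewrite -eB; apply: slots_ext sl => i _; rewrite /slot !fa.
  exists k.-1; first lia.
  have [SJ EJ'] := slots_nth sl2; rewrite -EJ in SJ EJ'.
  have IE : reg s2 rI < hi by lia.
  (* the string containing position [I], once [J] has been advanced *)
  have [B1' [c [B2' [x [c1 [c2 [eB' ec lenI stJ sg]]]]]]] : exists B1' c B2' x c1 c2,
      [/\ B = B1' ++ c :: B2', c = c1 ++ x :: c2,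
        reg s2 rI = lo + size (flatten B1') + size c1,
        (if 1 - (arr s2 aSE (reg s2 rJ) - reg s2 rI) != 0 then reg s2 rJ + 1
         else reg s2 rJ) = (size B1').+1
      & cells iw ow B1 ++ [seq (x, trip iw ow b) | x <- b1] =
        cells iw ow B1' ++ [seq (x, trip iw ow c) | x <- c1]].
    case: b2 eb => [|x c2] eb; last first.
      exists B1, b, B2, x, b1, c2; split=> //.
      have -> : 1 - (arr s2 aSE (reg s2 rJ) - reg s2 rI) = 0.
        by rewrite EJ' EI eb size_cat /=; lia.
      by rewrite EJ.
    rewrite cats0 in eb; case: B2 eB sl2 => [|c B2] eB sl2.
      have := szB; rewrite eB flatten_cat /= cats0 size_cat -eb.
      by rewrite -eb in EI; lia.
    have := nonempty c; rewrite eB mem_cat !inE eqxx !orbT => /(_ isT).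
    case: c eB sl2 => // x c2 eB sl2 _.
    exists (rcons B1 b), (x :: c2), B2, x, [::], c2; split=> //.
    - by rewrite cat_rcons.
    - by rewrite flatten_rcons size_cat EI eb /=; lia.
    - have -> : 1 - (arr s2 aSE (reg s2 rJ) - reg s2 rI) = 1.
        by rewrite EJ' EI eb; lia.
      by rewrite EJ size_rcons addn1.
    - by rewrite -cats1 /cells map_cat flatten_cat /= !cats0 eb.
  have sl3 : slots iw ow s2 lo (rev (B1' ++ c :: B2')).
    by rewrite -eB' eB.
  have [SJ3 _] := slots_nth sl3;
  have cvx : arr s2 aCV (reg s2 rI) = x.
    rewrite fa //; have : nth 0 (flatten B) (reg s2 rI - lo) = x.
      rewrite lenI eB' ec flatten_cat /= -catA nth_cat ifN; last lia.
      rewrite nth_cat ifN; last lia.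
      by rewrite (_ : _ - _ - _ - _ = 0) //; lia.
    move=> <-; rewrite flB /seg (nth_map 0) ?size_iota; last lia.
    by rewrite nth_iota; [congr arr|]; lia.
  have -> : denote fill_body s2 = denote fill_cell (denote next_string s2) by [].
  set s3 := denote next_string s2.
  have a3 a i : arr s3 a i = arr s2 a i by rewrite /s3 /=; case: ifP.
  have r3 y : y != rJ -> reg s3 y = reg s2 y.
    by rewrite /s3 /= => /negbTE yJ; case: ifP => //= _; rewrite yJ.
  have J3 : reg s3 rJ = (size B1').+1 by rewrite -stJ /s3 /=; case: ifP.
  clearbody s3; set s4 := denote fill_cell s3.
  have I4 : reg s4 rI = (reg s2 rI).+1 by rewrite /= r3 // addn1.
  have [fr4 fa4] := @denote_frame fill_cell s3 isT; rewrite -/s4 in fr4 fa4.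
  have c4 i : cell s4 i = if i == reg s2 rI then (x, trip iw ow c) else cell s2 i.
    rewrite /cell (fa4 aCV isT) /s4 /= (r3 rI) // ?a3.
    case: eqP => [->|_] //; rewrite cvx -SJ3; congr (_, _).
    by rewrite J3.

  exists B1', c, B2', (rcons c1 x), c2; split=> //.
  - by rewrite cat_rcons.
  - by rewrite fr4 // J3 I4 size_rcons lenI addnS.
  - by rewrite I4; lia.
  rewrite I4; split; last first.
    by move=> i lti; rewrite c4 ltn_eqF ?cl //; lia.
  rewrite seg_recr; last lia.
  rewrite c4 eqxx map_rcons -rcons_cat -sg -sgc; congr rcons.
  by apply: eq_seg => i lei lti; rewrite c4 ltn_eqF.
- move=> k s2 [fr fa] [B1 [b [B2 [b1 [b2 [eB eb [EJ EI] Ik [sgc cl]]]]]]] /= e.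
  have EE : reg s2 rE = hi by rewrite fr.
  have IE : reg s2 rI = hi by lia.
  rewrite IE in sgc; split=> //; rewrite sgc.
  have : size (flatten B) = size (flatten B1) + size b1 by rewrite szB; lia.
  rewrite eB eb flatten_cat /= !size_cat => sz0.
  have b20 : b2 = [::] by apply: size0nil; lia.
  have B20 : B2 = [::].
    case: B2 eB sz0 {EJ} => // c B2 eB sz0.
    have := nonempty c; rewrite eB mem_cat !inE eqxx !orbT => /(_ isT).
    move=> c0; exfalso; rewrite /= size_cat in sz0; lia.
  by rewrite B20 b20 /cells map_cat flatten_cat /= !cats0.
Qed.

End Fill.

(** * Merging *)

Definition choose e :=
  If (Sub (Reg rE) (Reg rI))
     (If (Sub (Reg rF) (Reg rJ)) (rFLAG <~ e)%prog (rFLAG <~ Const 1)%prog)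
     (rFLAG <~ Const 0)%prog.

Definition move_cell r :=
 (aCV @ Reg rD <~ Read aCV (Reg r);;
  aCP @ Reg rD <~ Read aCP (Reg r);;
  aCQ @ Reg rD <~ Read aCQ (Reg r);;
  aCR @ Reg rD <~ Read aCR (Reg r);;
  Incr r;;
  Incr rD)%prog.

Definition merge_body :=
 (choose (LeKey (Read aCP (Reg rI)) (Read aCQ (Reg rI)) (Read aCR (Reg rI))
                (Read aCP (Reg rJ)) (Read aCQ (Reg rJ)) (Read aCR (Reg rJ)));;
  If (Reg rFLAG) (move_cell rI) (move_cell rJ))%prog.

Definition merge_loop :=
  While (Add (Sub (Reg rE) (Reg rI)) (Sub (Reg rF) (Reg rJ))) merge_body.

Lemma chooseP e s (b : bool) : eval s e = b ->
  let s' := denote (choose e) s in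
  [/\ reg s' rFLAG = nat_of_bool ((reg s rI < reg s rE) &&
         ((reg s rJ < reg s rF) ==> b)),
      forall x, x != rFLAG -> reg s' x = reg s x
    & forall a i, arr s' a i = arr s a i].
Proof.
move=> eb; rewrite /= !subn_eq0 -!ltnNge; case: ltnP => _ /=.
  by case: ltnP => _ /=; rewrite ?eb; split=> // x /negbTE->.
by split=> // x /negbTE->.
Qed.

Lemma move_cellP r s : r != rD ->
  let s' := denote (move_cell r) s in
  [/\ reg s' r = (reg s r).+1, reg s' rD = (reg s rD).+1,
      forall x, x != r -> x != rD -> reg s' x = reg s x
    & forall i, cell s' i = if i == reg s rD then cell s (reg s r) else cell s i].
Proof.
move=> rD; rewrite /= eqxx (negbTE rD) (eq_sym 14) (negbTE rD) !addn1; split=> //.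
  by move=> x /negbTE-> /negbTE->.
by move=> i; rewrite /cell /=; case: eqP => // ->; rewrite ?eqxx //=; do !case: ifP.
Qed.

(** The destination lies above both sources, so their cells stay intact. The invariant is that the
    output so far, followed by the merge of the two rests, is the whole merge. *)
Lemma runs_merge s : reg s rE <= reg s rD -> reg s rF <= reg s rD ->
  reg s rI <= reg s rE -> reg s rJ <= reg s rF ->
  runs merge_loop s
    (300 * (reg s rE - reg s rI + (reg s rF - reg s rJ)).+1) (fun s' =>
  [/\ reg s rD <= reg s' rD,
      seg (cell s') (reg s rD) (reg s' rD) =
      merge (@leC nat) (seg (cell s) (reg s rI) (reg s rE))
                (seg (cell s) (reg s rJ) (reg s rF))
    & forall i, i < reg s rD -> cell s' i = cell s i]).
Proof.
move=> leED leFD leIE leJF; set m := (_ + _).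
have cb : cost merge_body <= 250 by vm_compute.
have le : m.+1 * (7 + cost merge_body).+1 <= 300 * m.+1 by nia.
apply: (runs_le le).
pose I k s' := [/\ reg s' rI <= reg s rE, reg s' rJ <= reg s rF,
  k = reg s rE - reg s' rI + (reg s rF - reg s' rJ),
  reg s rD <= reg s' rD /\ (forall i, i < reg s rD -> cell s' i = cell s i) 
  & seg (cell s') (reg s rD) (reg s' rD) ++
      merge (@leC nat) (seg (cell s) (reg s' rI) (reg s rE))
                (seg (cell s) (reg s' rJ) (reg s rF)) =
    merge (@leC nat) (seg (cell s) (reg s rI) (reg s rE))
                (seg (cell s) (reg s rJ) (reg s rF))].
apply: (runs_for (I := I)) => //.
- by rewrite /I; split=> //; rewrite seg_nil.
- move=> k s2 [fr _] [leI leJ -> [leD low] inv] lt; rewrite /= in lt.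
  have EE : reg s2 rE = reg s rE by rewrite fr.
  have EF : reg s2 rF = reg s rF by rewrite fr.
  rewrite EE EF in lt.
  exists (reg s rE - reg s2 rI + (reg s rF - reg s2 rJ)).-1; first lia.
  rewrite /merge_body.
  set e := LeKey _ _ _ _ _ _; set b := leC (cell s2 (reg s2 rI)) (cell s2 (reg s2 rJ)).
  have eb : eval s2 e = b by rewrite /e eval_LeKey.
  have [H1 H2 _] := chooseP eb.
  have -> : denote (choose e;; If (Reg rFLAG) (move_cell rI) (move_cell rJ))%prog s2 =
    denote (If (Reg rFLAG) (move_cell rI) (move_cell rJ)) (denote (choose e) s2) by [].
  have cl3 i : cell (denote (choose e) s2) i = cell s2 i.
    by have [_ _ H3] := chooseP eb; rewrite /cell !H3.
  move: (denote (choose e) s2) H1 H2 cl3 => s3 H1 H2 cl3.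
  rewrite denote_If [eval _ _]/= H1 EE EF {H1}.
  have I3 : reg s3 rI = reg s2 rI by rewrite H2.
  have J3 : reg s3 rJ = reg s2 rJ by rewrite H2.
  have D3 : reg s3 rD = reg s2 rD by rewrite H2.
  have cI : reg s2 rI < reg s rE -> cell s2 (reg s2 rI) = cell s (reg s2 rI).
    by move=> h; apply: low; lia.
  have cJ : reg s2 rJ < reg s rF -> cell s2 (reg s2 rJ) = cell s (reg s2 rJ).
    by move=> h; apply: low; lia.
  have sg' s4 c : (forall i, cell s4 i = if i == reg s2 rD then c else cell s2 i) ->
      seg (cell s4) (reg s rD) (reg s2 rD).+1 =
      rcons (seg (cell s2) (reg s rD) (reg s2 rD)) c.
    move=> H; rewrite seg_recr // H eqxx; congr rcons.
    by apply: eq_seg => i _ h; rewrite H ltn_eqF.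
  case: ifP.
    case: ltnP => //= ltI; rewrite implybE => fl.
    have [//|I4 D4 r4 c4] := @move_cellP rI s3.
    set s4 := denote _ _ in I4 D4 r4 c4 *.
    have c4' i : cell s4 i = if i == reg s2 rD then cell s (reg s2 rI) else cell s2 i.
      by rewrite c4 D3 I3 !cl3 -cI.
    rewrite I3 in I4; rewrite D3 in D4.
    split; rewrite ?I4 ?D4 ?(r4 rJ) ?J3 //; try lia.
    + split; first lia.
      by move=> i h; rewrite c4' ltn_eqF ?low //; lia.
    rewrite (sg' _ _ c4') -inv cat_rcons; congr (_ ++ _).
    rewrite [in RHS]seg_recl //; case: (ltnP (reg s2 rJ) (reg s rF)) fl => ltJ fl.
      rewrite (seg_recl _ ltJ) /=.
      by rewrite -cI // -cJ // -/b; case: (b) fl.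
    by rewrite (seg_nil _ ltJ) /=; case: seg.
  move=> fl.
  have ltJ : reg s2 rJ < reg s rF.
    by move: fl; case: (ltnP (reg s2 rI)) => hI; case: (ltnP (reg s2 rJ)) => hJ //= _; lia.
  have [//|J4 D4 r4 c4] := @move_cellP rJ s3.
  set s4 := denote _ _ in J4 D4 r4 c4 *.
  have c4' i : cell s4 i = if i == reg s2 rD then cell s (reg s2 rJ) else cell s2 i.
    by rewrite c4 D3 J3 !cl3 -cJ.
  rewrite J3 in J4; rewrite D3 in D4.
  split; rewrite ?J4 ?D4 ?(r4 rI) ?I3 //; try lia.
  + split; first lia.
    by move=> i h; rewrite c4' ltn_eqF ?low //; lia.
  rewrite (sg' _ _ c4') -inv cat_rcons; congr (_ ++ _).
  rewrite [in RHS](seg_recl _ ltJ); case: (ltnP (reg s2 rI) (reg s rE)) fl => ltI fl.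
    rewrite (seg_recl _ ltI) /=.
    by rewrite -cI // -cJ // -/b; move: fl; rewrite ltJ; case: (b).
  by rewrite (seg_nil _ ltI).
- move=> k s2 [fr _] [leI leJ _ [leD low] inv] e; rewrite /= in e.
  have EE : reg s2 rE = reg s rE by rewrite fr.
  have EF : reg s2 rF = reg s rF by rewrite fr.
  split=> //; rewrite -inv (@seg_nil _ _ (reg s2 rI)); last lia.
  by rewrite (@seg_nil _ _ (reg s2 rJ)) ?cats0 //; lia.
Qed.

(** * One elimination step *)

Lemma index_inj n x y x' y' : y < n -> y' < n ->
  (x * n + y == x' * n + y') = (x == x') && (y == y').
Proof.
move=> yn yn'; apply/eqP/andP => [e|[/eqP-> /eqP->]//].
have n0 : 0 < n by lia.
move: (congr1 (modn^~ n) e) (congr1 (divn^~ n) e).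
rewrite !modnMDl !divnMDl // !modn_small // !divn_small // !addn0.
by move=> -> ->.
Qed.

Lemma count1P (T : eqType) (p : pred T) (s : seq T) : uniq s -> count p s = 1 ->
  exists2 u, u \in s & {in s, forall x, p x = (x == u)}.
Proof.
move=> us; rewrite -size_filter; case E: (filter p s) => [|u [|]] // _.
have H x : (x \in s) && p x = (x == u).
  by rewrite andbC -mem_filter E inE.
by exists u => [|x xs]; [have := H u|have := H x]; rewrite ?eqxx ?xs //; case/andP.
Qed.

Lemma eq_count_nat (T : eqType) (p1 p2 p3 p4 : pred T) s :
  (forall x, p1 x + p2 x = p3 x + p4 x) ->
  count p1 s + count p2 s = count p3 s + count p4 s.
Proof. by move=> H; elim: s => //= x s IH; have := H x; lia. Qed.

Definition Pair a x y := Read a (Add (Read aROW x) y).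
Definition RU := Reg rU.
Definition RV := Reg rV.
Definition RW := Reg rW.

Definition series_copy :=
 (rD <~ Reg rTOP;;
  rJ <~ Pair aBASE RU RV;;
  rF <~ Add (Reg rJ) (Pair aLEN RU RV);;
  copy;;
  aCV @ Reg rD <~ RV;;
  Incr rD;;
  rJ <~ Pair aBASE RV RW;;
  rF <~ Add (Reg rJ) (Pair aLEN RV RW);;
  copy;;
  rE <~ Reg rD)%prog.

Lemma runs_series_copy s (u v w b1 l1 b2 l2 : nat) :
  reg s rU = u -> reg s rV = v -> reg s rW = w ->
  eval s (Pair aBASE RU RV) = b1 -> eval s (Pair aLEN RU RV) = l1 ->
  eval s (Pair aBASE RV RW) = b2 -> eval s (Pair aLEN RV RW) = l2 ->
  b1 + l1 <= reg s rTOP -> b2 + l2 <= reg s rTOP ->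
  runs series_copy s (100 * (l1 + l2).+1) (fun s' =>
    [/\ reg s' rE = reg s rTOP + l1.+1 + l2, reg s' rD = reg s' rE,
        seg (arr s' aCV) (reg s rTOP) (reg s' rE) =
          seg (arr s aCV) b1 (b1 + l1) ++ v :: seg (arr s aCV) b2 (b2 + l2)
      & forall i, i < reg s rTOP -> arr s' aCV i = arr s aCV i]).
Proof.
move=> Eu Ev Ew /= Eb1 El1 Eb2 El2 le1 le2; set top := reg s rTOP.
rewrite Eu Ev in Eb1 El1; rewrite Ev Ew in Eb2 El2.
set T := 100 * _.
(* The sum follows the commands of [series_copy]; each successor accounts for one [Seq]. *)
have le : (2 + (6 + (8 + (20 * l1.+1 +
    (3 + (4 + (6 + (8 + (20 * l2.+1 + 2).+1).+1).+1).+1).+1).+1).+1).+1).+1 <= T.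
  by rewrite /T; lia.
apply: (runs_le le).
do 3 (apply: runs_seq; apply: runs_denote => //).
set s1 := denote _ _.
have J1 : reg s1 rJ = b1 by rewrite /= Eu Ev.
have F1 : reg s1 rF = b1 + l1 by rewrite /= Eu Ev Eb1 El1.
have D1 : reg s1 rD = top by [].
have A1 a i : arr s1 a i = arr s a i by [].
have R1 x : x \notin [:: rD; rJ; rF] -> reg s1 x = reg s x.
  by rewrite !inE !negb_or /= => /and3P[/negbTE-> /negbTE-> /negbTE->].
clearbody s1.
apply: runs_seq.
have e1 : reg s1 rF - reg s1 rJ = l1 by rewrite J1 F1; lia.
have := @runs_copy s1; rewrite e1 D1 F1 J1 => /(_ le1 (leq_addr _ _)) r1.
apply: (runs_weaken (runs_frame r1)) => // s2 [[fr2 fa2] [D2 low2 seg2]].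
rewrite D2 in seg2.
do 4 (apply: runs_seq; apply: runs_denote => //).
set s3 := denote _ _.
have B2 a i : a != aCV -> arr s2 a i = arr s a i.
  by move=> ai; rewrite fa2 ?A1 // inE.
have R2 x : x \notin [:: rD; rJ; rF] -> reg s2 x = reg s x.
  move=> h; rewrite fr2 ?R1 //; move: h; rewrite !inE !negb_or => /and3P[-> -> _] //.
have J3 : reg s3 rJ = b2 by rewrite /= !B2 // !R2 // Ev Ew.
have F3 : reg s3 rF = b2 + l2 by rewrite /= !B2 // !R2 // Ev Ew Eb2 El2.
have D3 : reg s3 rD = top + l1.+1 by rewrite /= D2 addn1 addnS.
have A3 i : arr s3 aCV i = if i == top + l1 then v else arr s2 aCV i.
  by rewrite /= D2 R2 // Ev.
clearbody s3.
apply: runs_seq.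
have e3 : reg s3 rF - reg s3 rJ = l2 by rewrite J3 F3; lia.
have := @runs_copy s3; rewrite e3 D3 F3 J3 => /(_ _ (leq_addr _ _)) r3.
have le3 : b2 + l2 <= top + l1.+1 by lia.
apply: (runs_weaken (r3 le3)) => // s4 [D4 low4 seg4].
apply: runs_denote => //; rewrite /= D4; rewrite D4 in seg4.
have low3 i : i < top -> arr s3 aCV i = arr s aCV i.
  by move=> h; rewrite A3 ltn_eqF ?low2 ?A1 //; lia.
split=> //; last by move=> i h; rewrite low4 ?low3 //; lia.
rewrite (@seg_cat _ _ _ (top + l1.+1)); [|lia|lia].
rewrite seg4 addnS seg_recr ?leq_addr // cat_rcons.
rewrite low4 ?A3 ?eqxx; last lia.
congr (_ ++ _ :: _); last by apply: eq_seg => i _ h; apply: low3; lia.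
transitivity (seg (arr s2 aCV) top (top + l1)).
  by apply: eq_seg => i _ h; rewrite low4 ?A3 ?ltn_eqF //; lia.
by rewrite seg2; apply: eq_seg => i _ h; rewrite A1.
Qed.

Definition merge_chain :=
 (rI <~ Reg rTOP;;
  rJ <~ Pair aBASE RU RW;;
  rF <~ Add (Reg rJ) (Pair aLEN RU RW);;
  merge_loop)%prog.

Lemma runs_merge_chain s b l :
  eval s (Pair aBASE RU RW) = b -> eval s (Pair aLEN RU RW) = l ->
  reg s rTOP <= reg s rE -> reg s rE = reg s rD -> b + l <= reg s rTOP ->
  runs merge_chain s (400 * (reg s rE - reg s rTOP + l).+1) (fun s' =>
  [/\ reg s rE <= reg s' rD,
      seg (cell s') (reg s rE) (reg s' rD) =
      merge (@leC nat) (seg (cell s) (reg s rTOP) (reg s rE))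
                (seg (cell s) b (b + l))
    & forall i, i < reg s rE -> cell s' i = cell s i]).
Proof.
move=> /= Eb El leTE ED le; set m := _ + l.
have leT : (2 + (6 + (8 + 300 * m.+1).+1).+1).+1 <= 400 * m.+1 by lia.
apply: (runs_le leT).
do 3 (apply: runs_seq; apply: runs_denote => //).
set s1 := denote _ _.
have I1 : reg s1 rI = reg s rTOP by [].
have J1 : reg s1 rJ = b by [].
have F1 : reg s1 rF = b + l by rewrite /= Eb El.
have E1 : reg s1 rE = reg s rE by [].
have D1 : reg s1 rD = reg s rE by rewrite ED.
have c1 i : cell s1 i = cell s i by [].
clearbody s1.
have := @runs_merge s1; rewrite I1 J1 F1 E1 D1 leqnn addKn -/m.
move=> /(_ isT) r; apply: (runs_weaken (r _ leTE (leq_addr _ _))) => //; first lia.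
move=> s2 [h1 h2 h3]; split=> //; first by rewrite h2; congr merge; apply: eq_seg.
by move=> i /h3 ->.
Qed.

(** If [uw] is already an arc, the new one merges with it, and [u] and [w] each lose a neighbour.
    Otherwise they exchange [v] for each other and keep their degrees. *)
Definition lower_degrees :=
  If (Pair aMAT RU RW)
     (aDO @ RU <~ Sub (Read aDO RU) (Const 1);;
      aDI @ RW <~ Sub (Read aDI RW) (Const 1))%prog Skip.

Definition At x y := Add (Read aROW x) y.

(** Degrees 0 keep [v] from being selected again. The merged chain lies between [rE] and [rD], and
    the free space now starts behind it. *)
Definition update :=
 (lower_degrees;;
  aMAT @ (At RU RW) <~ Const 1;;
  aMAT @ (At RU RV) <~ Const 0;;
  aMAT @ (At RV RW) <~ Const 0;;
  aDI @ RV <~ Const 0;;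
  aDO @ RV <~ Const 0;;
  aBASE @ (At RU RW) <~ Reg rE;;
  aLEN @ (At RU RW) <~ Sub (Reg rD) (Reg rE);;
  aLEN @ (At RU RV) <~ Const 0;;
  aLEN @ (At RV RW) <~ Const 0;;
  rTOP <~ Reg rD;;
  rLEFT <~ Sub (Reg rLEFT) (Const 1))%prog.

Definition Reducible :=
  And (And (Le (Read aDI (Reg rX)) (Const 1)) (Le (Const 1) (Read aDI (Reg rX))))
      (And (Le (Read aDO (Reg rX)) (Const 1)) (Le (Const 1) (Read aDO (Reg rX)))).

Definition step :=
 (search rV Reducible;;
  search rU (Pair aMAT (Reg rX) RV);;
  search rW (Pair aMAT RV (Reg rX));;
  series_copy;;
  decompose;;
  fill;;
  merge_chain;;
  update)%prog.

Section Step.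
Variables (n : nat) (iw ow : nat -> nat).

(** [aIN] and [aOUT] hold the degrees with multiplicity in the input, from which costs are computed;
    [aDI] and [aDO] hold the degrees of the reduced relation. The matrix is reused in place: a
    nonzero entry stands for an arc. *)
Record rep s (E : rel nat) (L : chains nat) : Prop := Rep {
  rep_n : reg s rN = n;
  rep_row : forall x, x < n -> arr s aROW x = x * n;
  rep_in : forall x, x < n -> arr s aIN x = iw x;
  rep_out : forall x, x < n -> arr s aOUT x = ow x;
  rep_mat : forall x y, x < n -> y < n -> (arr s aMAT (x * n + y) != 0) = E x y;
  rep_indeg : forall y, y < n -> arr s aDI y = count (E^~ y) (iota 0 n);
  rep_outdeg : forall x, x < n -> arr s aDO x = count (E x) (iota 0 n);
  rep_bound : forall x y, x < n -> y < n ->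
    arr s aBASE (x * n + y) + arr s aLEN (x * n + y) <= reg s rTOP;
  rep_chain : forall x y, x < n -> y < n ->
    seg (cell s) (arr s aBASE (x * n + y))
        (arr s aBASE (x * n + y) + arr s aLEN (x * n + y)) = cells iw ow (L x y)
}.

Definition chain_output s u v w B (L : chains nat) :=
  [/\ reg s rU = u, reg s rV = v, reg s rW = w,
      reg s rTOP <= reg s rE /\ reg s rE <= reg s rD
    & seg (cell s) (reg s rE) (reg s rD) = cells iw ow (merge (leB iw ow) B (L u w))].

Lemma lower_degreesP s u w :
  reg s rU = u -> reg s rW = w -> arr s aROW u = u * n ->
  let b := arr s aMAT (u * n + w) != 0 in
  let s' := denote lower_degrees s in
  [/\ forall y, arr s' aDI y = arr s aDI y - (b && (y == w)),
      forall x, arr s' aDO x = arr s aDO x - (b && (x == u)),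
      reg s' =1 reg s
    & forall a, a != aDI -> a != aDO -> forall i, arr s' a i = arr s a i].
Proof.
move=> Eu Ew Er; rewrite /= Eu Er Ew; case: ifP => _ /=; split=> //.
- by move=> y; rewrite ?Ew; case: eqP => [->|]; rewrite ?subn0.
- by move=> y; rewrite ?Eu; case: eqP => [->|]; rewrite ?subn0.
- by move=> a /negbTE-> /negbTE->.
- by move=> y; rewrite subn0.
- by move=> y; rewrite subn0.
Qed.

Lemma updateP s E L u v w B : rep s E L -> chain_output s u v w B L ->
  legal E v u w -> (forall x y, E x y -> x < n /\ y < n) ->
  u != v -> w != v -> u != w ->
  (forall x y, ~~ E x y -> L x y = [::]) ->
  let s' := denote update s in
  rep s' (elim E v) (reduce_chains iw ow E L v u w B) /\
  reg s' rLEFT = (reg s rLEFT).-1.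
Proof.
move=> [En Erow Ein Eout Emat Edi Edo Ebd Ech] [Eu Ev Ew [leE leD] Eseg] lg mem uv wv uw nil.
have [Hu Hw] := lg.
have [un vn] : u < n /\ v < n by apply: mem; rewrite Hu.
have [_ wn] : v < n /\ w < n by apply: mem; rewrite Hw.
have -> : denote update s = denote (aMAT @ (At RU RW) <~ Const 1;;
  aMAT @ (At RU RV) <~ Const 0;;
  aMAT @ (At RV RW) <~ Const 0;;
  aDI @ RV <~ Const 0;;
  aDO @ RV <~ Const 0;;
  aBASE @ (At RU RW) <~ Reg rE;;
  aLEN @ (At RU RW) <~ Sub (Reg rD) (Reg rE);;
  aLEN @ (At RU RV) <~ Const 0;;
  aLEN @ (At RV RW) <~ Const 0;;
  rTOP <~ Reg rD;;
  rLEFT <~ Sub (Reg rLEFT) (Const 1))%prog (denote lower_degrees s) by [].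
have [] := lower_degreesP Eu Ew (Erow _ un); rewrite Emat //.
move: (denote lower_degrees s) => s1 di1 do1 r1 a1.
set s2 := denote _ _.
have row1 x : x < n -> arr s1 aROW x = x * n by move=> xn; rewrite a1 // Erow.
have regs : (reg s1 rU = u) * (reg s1 rV = v) * (reg s1 rW = w) *
    (arr s1 aROW u = u * n) * (arr s1 aROW v = v * n).
  by rewrite !r1 !row1.
have idx x y x' y' : y < n -> y' < n -> (x * n + y == x' * n + y') = (x == x') && (y == y').
  exact: index_inj.
have mat2 x y : x < n -> y < n -> arr s2 aMAT (x * n + y) =
    if (x == v) && (y == w) then 0 else if (x == u) && (y == v) then 0 else
    if (x == u) && (y == w) then 1 else arr s aMAT (x * n + y).
  by move=> xn yn; rewrite /= !regs !idx // a1.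
have len2 x y : x < n -> y < n -> arr s2 aLEN (x * n + y) =
    if (x == v) && (y == w) then 0 else if (x == u) && (y == v) then 0 else
    if (x == u) && (y == w) then reg s rD - reg s rE else arr s aLEN (x * n + y).
  by move=> xn yn; rewrite /= !regs !idx // a1 // !r1.
have base2 x y : x < n -> y < n -> arr s2 aBASE (x * n + y) =
    if (x == u) && (y == w) then reg s rE else arr s aBASE (x * n + y).
  by move=> xn yn; rewrite /= !regs !idx // a1 // !r1.
have di2 y : arr s2 aDI y = if y == v then 0 else arr s aDI y - (E u w && (y == w)).
  by rewrite /= !regs di1.
have do2 y : arr s2 aDO y = if y == v then 0 else arr s aDO y - (E u w && (y == u)).
  by rewrite /= !regs do1.
have top2 : reg s2 rTOP = reg s rD by rewrite /= r1.
have left2 : reg s2 rLEFT = (reg s rLEFT).-1 by rewrite /= r1 subn1.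
have same a i : a \notin [:: aMAT; aBASE; aLEN; aDI; aDO] -> arr s2 a i = arr s a i.
  rewrite !inE !negb_or => /and5P[h1 h2 h3 h4 h5]; rewrite -(a1 a) //.
  by rewrite /= (negbTE h1) (negbTE h2) (negbTE h3) (negbTE h4) (negbTE h5).
have cell2 i : cell s2 i = cell s i by rewrite /cell !same.
have n2 : reg s2 rN = n by rewrite /= r1.
clearbody s2.
have E'E x y : elim E v x y = [&& x != v, y != v & E x y || (x == u) && (y == w)].
  by rewrite /elim Hu Hw.
have count1 z : z < n -> count (pred1 z) (iota 0 n) = 1.
  by move=> zn; rewrite count_uniq_mem ?iota_uniq // mem_iota zn.
have countb (b : bool) z : z < n -> count (fun x => b && (x == z)) (iota 0 n) = b.
  by case: b => zn; rewrite ?count_pred0 //; apply: count1.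
split=> //; split=> //.
- by move=> x xn; rewrite same // Erow.
- by move=> x xn; rewrite same // Ein.
- by move=> x xn; rewrite same // Eout.
- move=> x y xn yn; rewrite mat2 // E'E.
  case: (eqVneq x v) => [->|xv] /=.
    rewrite [v == u]eq_sym (negbTE uv) /=; case: ifP => //= yw.
    by rewrite Emat // Hw.
  case: (eqVneq y v) => [->|yv] /=.
    rewrite [v == w]eq_sym (negbTE wv) /= andbT andbF; case: ifP => //= xu.
    by rewrite Emat // Hu.
  by rewrite andbF; case: ifP => _; rewrite ?orbT // orbF Emat.
- move=> y yn; rewrite di2; case: (eqVneq y v) => [->|yv].
    by rewrite (@eq_count _ _ pred0) ?count_pred0 // => x; rewrite /= E'E eqxx andbF.
  case: (eqVneq y w) => [->|yw]; last first.
    rewrite andbF subn0 Edi //; apply: eq_count => x; rewrite /= E'E yv (negbTE yw) andbF orbF.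
    by case: (eqVneq x v) => // ->; rewrite Hw (negbTE yw).
  (* Balance of the in-neighbours of [w]: [v] disappears, and [u] is added unless it was one before.
     The out-neighbours of [u] are treated in the same way below. *)
  have := @eq_count_nat _ (elim E v ^~ w) (pred1 v) (E^~ w)
    (fun x => ~~ E u w && (x == u)) (iota 0 n).
  rewrite count1 // countb // Edi // andbT => H.
  suff : forall x, elim E v x w + (x == v) = E x w + (~~ E u w && (x == u)).
    by move=> /H; case: (E u w) => /=; lia.
  move=> x; rewrite E'E wv eqxx andbT /=; case: (eqVneq x v) => [->|xv] /=.
    by rewrite Hw eqxx [v == u]eq_sym (negbTE uv) andbF.
  by case: (eqVneq x u) => [->|xu]; rewrite ?andbF ?orbF ?andbT //=; case: (E u w).
- move=> x xn; rewrite do2; case: (eqVneq x v) => [->|xv].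
    by rewrite (@eq_count _ _ pred0) ?count_pred0 // => y; rewrite /= E'E eqxx.
  case: (eqVneq x u) => [->|xu]; last first.
    rewrite andbF subn0 Edo //; apply: eq_count => y.
    rewrite /= E'E xv (negbTE xu) /= orbF.
    by case: (eqVneq y v) => // ->; rewrite Hu (negbTE xu).
  have := @eq_count_nat _ (elim E v u) (pred1 v) (E u)
    (fun y => ~~ E u w && (y == w)) (iota 0 n).
  rewrite count1 // countb // Edo // andbT => H.
  suff : forall y, elim E v u y + (y == v) = E u y + (~~ E u w && (y == w)).
    by move=> /H; case: (E u w) => /=; lia.
  move=> y; rewrite E'E uv eqxx /=; case: (eqVneq y v) => [->|yv] /=.
    by rewrite Hu eqxx [v == w]eq_sym (negbTE wv) andbF.
  by case: (eqVneq y w) => [->|yw]; rewrite ?andbF ?orbF ?andbT //=; case: (E u w).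
- move=> x y xn yn; rewrite base2 // len2 // top2.
  case xyuw: ((x == u) && (y == w)).
    have [/eqP-> /eqP->] := andP xyuw.
    by rewrite (negbTE uv) (negbTE wv) andbF /= subnKC.
  have := Ebd x y xn yn; case: ifP => _; [lia|case: ifP => _; lia].
- move=> x y xn yn; rewrite base2 // len2 // /reduce_chains.
  rewrite (eq_seg (g' := cell s)); last by move=> i _ _; apply: cell2.
  case xyuw: ((x == u) && (y == w)).
    have [/eqP-> /eqP->] := andP xyuw.
    by rewrite (negbTE uv) (negbTE wv) andbF /= subnKC.
  case: ifP => [/andP[-> _]|vw]; first by rewrite addn0 seg_nil.
  case: ifP => [/andP[_ ->]|uv']; first by rewrite addn0 seg_nil // orbT.
  rewrite Ech //; case: ifP => // /orP[/eqP ex|/eqP ey].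
    by rewrite nil // ex Hw; move: vw; rewrite ex eqxx /= => ->.
  by rewrite nil // ey Hu; move: uv'; rewrite ey eqxx andbT => ->.
Qed.

Definition tables := [:: aMAT; aROW; aIN; aOUT; aDI; aDO; aBASE; aLEN].

(** All chains lie below [rTOP], so work in the free space above it leaves the representation
    valid. *)
Lemma rep_ext s s' E L : rep s E L -> reg s' rN = reg s rN ->
  reg s' rTOP = reg s rTOP ->
  (forall a, a \in tables -> forall i, arr s' a i = arr s a i) ->
  (forall i, i < reg s rTOP -> cell s' i = cell s i) -> rep s' E L.
Proof.
move=> [En Erow Ein Eout Emat Edi Edo Ebd Ech] eN eT eA eC; split.
- by rewrite eN.
- by move=> x xn; rewrite eA // Erow.
- by move=> x xn; rewrite eA // Ein.
- by move=> x xn; rewrite eA // Eout.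
- by move=> x y xn yn; rewrite eA // Emat.
- by move=> x xn; rewrite eA // Edi.
- by move=> x xn; rewrite eA // Edo.
- by move=> x y xn yn; rewrite !eA // eT Ebd.
- move=> x y xn yn; rewrite !eA // -Ech //; apply: eq_seg => i _ h; apply: eC.
  by have := Ebd x y xn yn; lia.
Qed.

Lemma rep_frame p s s' E L : rep s E L -> frame p s s' ->
  rN \notin assigned p -> rTOP \notin assigned p ->
  all (fun a => a \notin written p) tables ->
  (forall i, i < reg s rTOP -> cell s' i = cell s i) -> rep s' E L.
Proof.
move=> rs [fr fa] nN nT /allP nA eC; apply: (rep_ext rs) => //.
- exact: fr.
- exact: fr.
- by move=> a /nA; apply: fa.
Qed.

Lemma size_cells B : size (cells iw ow B) = size (flatten B).
Proof. by rewrite -(cells_vertices iw ow) size_map. Qed.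

(** The vertex found by the search need not be the one assumed to exist, so [v], [u], [w] are
    existential in the conclusion; [elimable_any] makes every choice acceptable. *)
Lemma runs_step s E L : rep s E L ->
  (exists v u w, legal E v u w) ->
  (forall x y, E x y -> [/\ x < n, y < n & x != y]) ->
  (forall x y, E x y -> E y x = false) ->
  (forall x y, ~~ E x y -> L x y = [::]) ->
  (forall x y, tights iw ow (L x y)) ->
  (forall x y, size (flatten (L x y)) <= n) ->
  (forall x y z, z \in flatten (L x y) -> z < n) ->
  runs step s (4000 * n.+1) (fun s' => exists v u w B,
    [/\ legal E v u w,
        flatten B = flatten (L u v) ++ v :: flatten (L v w),
        tights iw ow B /\ sorted (leB iw ow) B,
        rep s' (elim E v) (reduce_chains iw ow E L v u w B)
      & reg s' rLEFT = (reg s rLEFT).-1]).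
Proof.
move=> rs [v0 [u0 [w0 [Hu0 Hw0]]]] mem asym nil tL szL inL.
have [u0n v0n _] : [/\ u0 < n, v0 < n & u0 != v0] by apply: mem; rewrite Hu0.
have [_ w0n _] : [/\ v0 < n, w0 < n & v0 != w0] by apply: mem; rewrite Hw0.
have len x y : x < n -> y < n -> arr s aLEN (x * n + y) = size (flatten (L x y)).
  by move=> xn yn; have /(congr1 size) := rep_chain rs xn yn;
     rewrite size_seg addKn size_cells.
set T := 4000 * _.
(* One summand for each command of [step], the lengths of the three chains involved being bounded by
   [n]. *)
have leT : (60 * n.+1 + (40 * n.+1 + (40 * n.+1 + (100 * (n + n).+1 +
    (1000 * (n.+1 + n).+1 + (100 * (n.+1 + n).+1 + (400 * (n.+1 + n + n).+1 +
      cost update).+1).+1).+1).+1).+1).+1).+1 <= T.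
  have cu : cost update <= 200 by vm_compute.
  by rewrite /T; lia.
apply: (runs_le leT).
pose P x := (count (E^~ x) (iota 0 n) == 1) && (count (E x) (iota 0 n) == 1).
apply: runs_seq; have /runs_frame r1 : runs (search rV Reducible) s (60 * n.+1)
    (fun s' => reg s' rV < n /\ P (reg s' rV)).
  apply: (@runs_le _ _ (53 * n.+1)); first lia.
  apply: runs_search => //; first exact: rep_n rs.
  - exists v0 => //; apply/andP; split; apply/eqP.
      rewrite (eq_count (a2 := pred1 u0)); last exact: Hu0.
      by rewrite count_uniq_mem ?iota_uniq // mem_iota u0n.
    rewrite (eq_count (a2 := pred1 w0)); last exact: Hw0.
    by rewrite count_uniq_mem ?iota_uniq // mem_iota w0n.
  - move=> s' _ fa xn; rewrite (_ : eval _ _ = P (reg s' rX)); first by case: (P _).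
    rewrite /P !eqn_leq -(rep_indeg rs) // -(rep_outdeg rs) // -!fa.
    by apply: eval_And; apply: eval_And; apply: eval_Le.
apply: (runs_weaken r1) => // s1 [fr1 [vn Pv]] {r1}.
have rs1 : rep s1 E L by apply: (rep_frame rs fr1) => // i _; rewrite /cell !fr1.2.
set v := reg s1 rV in vn Pv *.
have [/eqP/(count1P (iota_uniq _ _))[u un Hu] /eqP/(count1P (iota_uniq _ _))[w wn Hw]] := andP Pv.
rewrite !mem_iota /= in un wn.
have lg : legal E v u w.
  split=> x; apply/idP/eqP => [Ex|->].
  - have [xn _ _] := mem _ _ Ex; apply/eqP; rewrite -Hu ?mem_iota //.
  - by rewrite Hu ?mem_iota.
  - have [_ xn _] := mem _ _ Ex; apply/eqP; rewrite -Hw ?mem_iota //.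
  - by rewrite Hw ?mem_iota.
have Euv : E u v by rewrite lg.1.
have Evw : E v w by rewrite lg.2.
have [_ _ uv] := mem _ _ Euv; have [_ _ vw] := mem _ _ Evw.
have uw : u != w.
  by apply/eqP => e; have := asym _ _ Euv; rewrite e Evw.
apply: runs_seq; have /runs_frame r2 : runs (search rU (Pair aMAT (Reg rX) RV)) s1
    (40 * n.+1) (fun s' => reg s' rU < n /\ pred1 u (reg s' rU)).
  apply: (@runs_le _ _ (25 * n.+1)); first lia.
  apply: runs_search => //; first exact: rep_n rs1.
  - by exists u => //=.
  - move=> s' fr fa xn; rewrite /= (fr rV) // !fa -/v (rep_row rs1) //.
    by rewrite (rep_mat rs1) // lg.1.
apply: (runs_weaken r2) => // s2 [fr2 [_ /eqP U2]] {r2}.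
have rs2 : rep s2 E L by apply: (rep_frame rs1 fr2) => // i _; rewrite /cell !fr2.2.
have V2 : reg s2 rV = v by rewrite fr2.1.
apply: runs_seq; have /runs_frame r3 : runs (search rW (Pair aMAT RV (Reg rX))) s2
    (40 * n.+1) (fun s' => reg s' rW < n /\ pred1 w (reg s' rW)).
  apply: (@runs_le _ _ (25 * n.+1)); first lia.
  apply: runs_search => //; first exact: rep_n rs2.
  - by exists w => //=.
  - move=> s' fr fa xn; rewrite /= (fr rV) // !fa V2 (rep_row rs2) //.
    by rewrite (rep_mat rs2) // lg.2.
apply: (runs_weaken r3) => // s3 [fr3 [_ /eqP W3]] {r3}.
have rs3 : rep s3 E L by apply: (rep_frame rs2 fr3) => // i _; rewrite /cell !fr3.2.
have V3 : reg s3 rV = v by rewrite fr3.1.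
have U3 : reg s3 rU = u by rewrite fr3.1.
have left3 : reg s3 rLEFT = reg s rLEFT by rewrite fr3.1 // fr2.1 // fr1.1.
have len3 x y : x < n -> y < n -> arr s3 aLEN (x * n + y) = size (flatten (L x y)).
  by move=> xn yn; rewrite fr3.2 // fr2.2 // fr1.2 // len.
clearbody v; clear s1 s2 fr1 fr2 fr3 rs1 rs2 V2 U2 vn Pv Hu Hw.
have vn : v < n by have [] := mem _ _ Evw.
set l1 := size (flatten (L u v)); set l2 := size (flatten (L v w)).
set l3 := size (flatten (L u w)).
have [lel1 lel2 lel3] : [/\ l1 <= n, l2 <= n & l3 <= n] by rewrite /l1 /l2 /l3.
rewrite add0n in un; rewrite add0n in wn.
have read t a rx ry x y : rep t E L -> reg t rx = x -> reg t ry = y ->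
    x < n -> y < n -> eval t (Pair a (Reg rx) (Reg ry)) = arr t a (x * n + y).
  by move=> rt /= -> -> xn yn; rewrite (rep_row rt).
apply: runs_seq.
have r4 := @runs_series_copy s3 u v w _ _ _ _ U3 V3 W3
  (read s3 aBASE rU rV _ _ rs3 U3 V3 un vn)
  (etrans (read s3 aLEN rU rV _ _ rs3 U3 V3 un vn) (len3 _ _ un vn))
  (read s3 aBASE rV rW _ _ rs3 V3 W3 vn wn)
  (etrans (read s3 aLEN rV rW _ _ rs3 V3 W3 vn wn) (len3 _ _ vn wn)).
have bd1 := rep_bound rs3 un vn; have bd2 := rep_bound rs3 vn wn.
have ch1 := rep_chain rs3 un vn; have ch2 := rep_chain rs3 vn wn.
rewrite len3 // -/l1 in bd1 ch1; rewrite len3 // -/l2 in bd2 ch2.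
apply: (runs_weaken (runs_frame (r4 bd1 bd2))); first lia.
move=> s4 [fr4 [E4 D4 seg4 low4]] {r4}.
have rs4 : rep s4 E L.
  by apply: (rep_frame rs3 fr4) => // i h; rewrite /cell low4 // !fr4.2.
have T4 : reg s4 rTOP = reg s3 rTOP by rewrite fr4.1.
rewrite -T4 in E4 seg4.
have chE b l x y : seg (cell s3) b (b + l) = cells iw ow (L x y) ->
    seg (arr s3 aCV) b (b + l) = flatten (L x y).
  by move=> h; rewrite -(cells_vertices iw ow) -h map_seg.
rewrite (chE _ _ _ _ ch1) (chE _ _ _ _ ch2) in seg4.
have mem4 x : x \in seg (arr s4 aCV) (reg s4 rTOP) (reg s4 rE) ->
    arr s4 aIN x = iw x /\ arr s4 aOUT x = ow x.
  rewrite seg4 => h; have xn : x < n.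
    by move: h; rewrite mem_cat inE => /or3P[/inL|/eqP->|/inL].
  by rewrite (rep_in rs4) ?(rep_out rs4).
have le4 : reg s4 rTOP <= reg s4 rE by lia.
have sz4 : reg s4 rE - reg s4 rTOP = l1.+1 + l2 by lia.
apply: runs_seq; have /runs_frame r5 := runs_decompose le4 mem4.
apply: (runs_weaken r5); first by rewrite sz4; lia.
move=> s5 [fr5 [B [fB tB sB sl5]]] {r5}.
rewrite seg4 in fB.
have rs5 : rep s5 E L by apply: (rep_frame rs4 fr5) => // i h; rewrite /cell !fr5.2.
have T5 : reg s5 rTOP = reg s4 rTOP by rewrite fr5.1.
have E5 : reg s5 rE = reg s4 rE by rewrite fr5.1.
have seg5 : flatten B = seg (arr s5 aCV) (reg s5 rTOP) (reg s5 rE).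
  by rewrite fB -seg4 T5 E5; apply: eq_seg => i _ _; rewrite fr5.2.
rewrite -T5 in sl5.
have lt5 : reg s5 rTOP < reg s5 rE by lia.
apply: runs_seq; have /runs_frame r6 := runs_fill lt5 seg5 tB sl5.
apply: (runs_weaken r6); first by rewrite T5 E5 sz4; lia.
move=> s6 [fr6 [seg6 low6]] {r6}.
have rs6 : rep s6 E L by apply: (rep_frame rs5 fr6).
have T6 : reg s6 rTOP = reg s5 rTOP by rewrite fr6.1.
have E6 : reg s6 rE = reg s5 rE by rewrite fr6.1.
have D6 : reg s6 rE = reg s6 rD by rewrite E6 E5 -D4 fr6.1 // fr5.1.
have U6 : reg s6 rU = u by rewrite fr6.1 // fr5.1 // fr4.1.
have V6 : reg s6 rV = v by rewrite fr6.1 // fr5.1 // fr4.1.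
have W6 : reg s6 rW = w by rewrite fr6.1 // fr5.1 // fr4.1.
have left6 : reg s6 rLEFT = reg s rLEFT by rewrite fr6.1 // fr5.1 // fr4.1.
rewrite -T6 -E6 in seg6.
have le6 : reg s6 rTOP <= reg s6 rE by lia.
have ch3 := rep_chain rs6 un wn; have bd3 := rep_bound rs6 un wn.
have len6 : arr s6 aLEN (u * n + w) = l3.
  by rewrite /l3 -size_cells -ch3 size_seg addKn.
apply: runs_seq.
have /runs_frame r7 := @runs_merge_chain s6 _ _
  (read s6 aBASE rU rW _ _ rs6 U6 W6 un wn)
  (read s6 aLEN rU rW _ _ rs6 U6 W6 un wn) le6 D6 bd3.
apply: (runs_weaken r7); first by rewrite len6 T6 E6 T5 E5 sz4; lia.
move=> s7 [fr7 [leD7 seg7 low7]] {r7}.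
have T7 : reg s7 rTOP = reg s6 rTOP by rewrite fr7.1.
have E7 : reg s7 rE = reg s6 rE by rewrite fr7.1.
have rs7 : rep s7 E L by apply: (rep_frame rs6 fr7) => // i h; apply: low7; lia.
have out7 : chain_output s7 u v w B L.
  split; rewrite ?T7 ?E7 //; try by rewrite fr7.1.
  rewrite seg7 ch3 seg6; apply: cells_merge; apply/allP => b bB.
    by apply: tight_neq0; apply: tB.
  by apply: tight_neq0; apply: (tL u w).
apply: runs_denote => //.
have [||rs8 left8] := updateP rs7 out7 lg _ uv _ uw nil.
- by move=> x y /mem[].
- by rewrite eq_sym.
exists v, u, w, B; split=> //.
by rewrite left8 fr7.1 // left6.
Qed.

End Step.

(** * Reading the matrix *)

Definition psum (g : nat -> nat) k := sumn [seq g i | i <- iota 0 k].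

Lemma psumS g k : psum g k.+1 = psum g k + g k.
Proof. by rewrite /psum -addn1 iotaD map_cat sumn_cat /= addn0. Qed.

(** Column sums after [x] full rows and [y] entries of row [x] have been read; [row_sums] refers to
    the same moment. *)
Definition col_sums s a (g : nat -> nat -> nat) n x y :=
  forall z, z < n -> arr s a z = psum (g^~ z) x + (if z < y then g x z else 0).

Definition row_sums s a (g : nat -> nat -> nat) n x y :=
  forall z, z < n -> arr s a z =
    if z < x then psum (g z) n else if z == x then psum (g x) y else 0.

Definition Entry := Read aMAT (Add (Reg rROW) (Reg rY)).
Definition Nonzero e := Sub (Const 1) (Sub (Const 1) e).

Definition init_cell :=
 (aIN @ Reg rY <~ Add (Read aIN (Reg rY)) Entry;;
  aOUT @ Reg rX <~ Add (Read aOUT (Reg rX)) Entry;;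
  rARCS <~ Add (Reg rARCS) Entry;;
  aDI @ Reg rY <~ Add (Read aDI (Reg rY)) (Nonzero Entry);;
  aDO @ Reg rX <~ Add (Read aDO (Reg rX)) (Nonzero Entry);;
  Incr rY)%prog.

Definition init_row :=
 (aROW @ Reg rX <~ Reg rROW;;
  rY <~ Const 0;;
  While (Sub (Reg rN) (Reg rY)) init_cell;;
  rROW <~ Add (Reg rROW) (Reg rN);;
  Incr rX)%prog.

(** The row counter starts at 0 because the input state has it so. [rLEFT] is the number of
    eliminations to come: all vertices but the two terminals. *)
Definition init :=
 (While (Sub (Reg rN) (Reg rX)) init_row;;
  rLEFT <~ Sub (Reg rN) (Const 2))%prog.

Section Init.
Variables (n : nat) (M : nat -> nat -> nat).

Definition nz x y := nat_of_bool (M x y != 0).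
Definition arcs := psum (fun x => psum (M x) n).

Definition read_upto s x y :=
  [/\ [/\ reg s rN = n, reg s rX = x & reg s rROW = x * n],
      (forall i j, i < n -> j < n -> arr s aMAT (i * n + j) = M i j),
      col_sums s aIN M n x y /\ col_sums s aDI nz n x y,
      row_sums s aOUT M n x y /\ row_sums s aDO nz n x y
    & reg s rARCS = arcs x + psum (M x) y].

Lemma col_sums_next s a g x : col_sums s a g n x n -> col_sums s a g n x.+1 0.
Proof. by move=> H z zn; rewrite H // zn psumS /= addn0. Qed.

Lemma row_sums_next s a g x : row_sums s a g n x n -> row_sums s a g n x.+1 0.
Proof.
move=> H z zn; rewrite H // [z < x.+1]ltnS [z <= x]leq_eqVlt [psum _ 0]/=.
by case: (eqVneq z x) => [->|_] /=; rewrite ?ltnn // if_same.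
Qed.

Lemma col_sums_cell s s' a g x y : y < n -> col_sums s a g n x y ->
  (forall z, arr s' a z = if z == y then arr s a y + g x y else arr s a z) ->
  col_sums s' a g n x y.+1.
Proof.
move=> yn H e z zn; rewrite e; case: (eqVneq z y) => [->|zy].
  by rewrite H // ltnn leqnn addn0.
by rewrite H // [z < y.+1]ltnS [z <= y]leq_eqVlt (negbTE zy).
Qed.

Lemma row_sums_cell s s' a g x y : x < n -> row_sums s a g n x y ->
  (forall z, arr s' a z = if z == x then arr s a x + g x y else arr s a z) ->
  row_sums s' a g n x y.+1.
Proof.
move=> xn H e z zn; rewrite e; case: (eqVneq z x) => [->|zx].
  by rewrite H // ltnn eqxx psumS.
by rewrite H // (negbTE zx).
Qed.

Lemma read_upto_cell s x y : read_upto s x y -> reg s rY = y -> x < n -> y < n ->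
  read_upto (denote init_cell s) x y.+1.
Proof.
move=> [[En Ex Erow] Emat [cI cD] [rO rD] Earcs] Ey xn yn.
have entry : arr s aMAT (reg s rROW + reg s rY) = M x y by rewrite Erow Ey Emat.
have nzE : 1 - (1 - M x y) = nz x y by rewrite /nz; case: (M x y).
split; rewrite /= ?entry //.
- by split; [apply: col_sums_cell cI _|apply: col_sums_cell cD _] => // z;
    rewrite /= ?entry ?nzE Ey.
- by split; [apply: row_sums_cell rO _|apply: row_sums_cell rD _] => // z;
    rewrite /= ?entry ?nzE Ex.
- by rewrite Earcs psumS addnA.
Qed.

Lemma runs_init s : reg s rN = n -> (forall x, x != rN -> reg s x = 0) ->
  (forall a, a != aMAT -> forall i, arr s a i = 0) ->
  (forall i j, i < n -> j < n -> arr s aMAT (i * n + j) = M i j) ->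
  runs init s (200 * (n.+1 * n.+1)) (fun s' =>
    [/\ read_upto s' n 0, forall x, x < n -> arr s' aROW x = x * n
      & reg s' rLEFT = n - 2]).
Proof.
move=> En r0 a0 Emat.
set T1 := 3 + (2 + (n.+1 * (3 + cost init_cell).+1 + (4 + 4).+1).+1).+1.
have cc : cost init_cell <= 80 by vm_compute.
set T := 200 * _.
have leT : (n.+1 * (3 + T1.+1).+1 + 4).+1 <= T by rewrite /T /T1; nia.
apply: (runs_le leT); apply: runs_seq.
pose I k s' := exists2 x, x + k = n & read_upto s' x 0 /\
  forall z, z < x -> arr s' aROW z = z * n.
apply: (runs_while (I := I)).
- exists 0 => //; split=> //; split; rewrite ?(r0 rX) ?(r0 rROW) ?(r0 rARCS) //.
  + by split=> z zn; rewrite a0.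
  + by split=> z zn; rewrite a0 //; case: ifP.
- move=> k s2 _ [x xk [rd row]] /= lt.
  have [[En2 Ex2 Erow2] Emat2 [cI cD] [rO rD] Earcs] := rd.
  exists k.-1; first lia.
  have xn : x < n by lia.
  do 2 (apply: runs_seq; apply: runs_denote => //).
  set s3 := denote _ _; apply: runs_seq.
  have rd3 : read_upto s3 x 0 by [].
  have Y3 : reg s3 rY = 0 by [].
  have row3 z : z < x.+1 -> arr s3 aROW z = z * n.
    rewrite ltnS leq_eqVlt /= Ex2 Erow2 => /predU1P[->|zx]; first by rewrite eqxx.
    by rewrite ltn_eqF // row.
  clearbody s3.
  pose J k s' := exists2 y, y + k = n & read_upto s' x y /\ reg s' rY = y.
  apply: (runs_for (I := J)) => //.
  + by exists 0.
  + move=> k4 s4 fr4 [y yk [rd4 Y4]] /= lt4.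
    have n4 : reg s4 rN = n by case: rd4 => -[].
    have yn : y < n by lia.
    exists k4.-1; first lia.
    exists y.+1; first lia.
    by split; [apply: read_upto_cell|rewrite /= Y4 addn1].
  + move=> k4 s4 [_ fa4] [y yk [rd4 Y4]] /= e4.
    have [[n4 x4 row4] m4 [cI4 cD4] [rO4 rD4] arcs4] := rd4.
    have yn : y = n by lia.
    rewrite yn in cI4 cD4 rO4 rD4 arcs4.
    apply: runs_seq; apply: runs_denote => //; apply: runs_denote => //.
    exists x.+1; first lia.
    split; last by move=> z zx; rewrite /= fa4 // row3.
    split; rewrite /= ?n4 ?x4 ?row4 ?addn1 //.
    * by rewrite mulSn addnC.
    * by split; apply: col_sums_next.
    * by split; apply: row_sums_next.
    * by rewrite arcs4 /arcs psumS /psum /= addn0.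
- move=> k s2 _ [x xk [rd row]] /= e.
  have xn : x = n by case: rd => -[n2 x2 _] _ _ _ _; lia.
  rewrite xn in rd row; apply: runs_denote => //=.
  by case: (rd) => -[-> _ _] _ _ _ _; split.
Qed.

End Init.

(** * Writing the answer *)

Definition list_order :=
 (rD <~ Reg rTOP;;
  aCV @ Reg rD <~ RU;;
  Incr rD;;
  rJ <~ Pair aBASE RU RV;;
  rF <~ Add (Reg rJ) (Pair aLEN RU RV);;
  copy;;
  aCV @ Reg rD <~ RV;;
  Incr rD)%prog.

Lemma runs_list_order s (u v b l : nat) :
  reg s rU = u -> reg s rV = v ->
  eval s (Pair aBASE RU RV) = b -> eval s (Pair aLEN RU RV) = l ->
  b + l <= reg s rTOP ->
  runs list_order s (100 * l.+1) (fun s' =>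
    reg s' rD = reg s rTOP + l.+2 /\
    seg (arr s' aCV) (reg s rTOP) (reg s' rD) =
      u :: rcons (seg (arr s aCV) b (b + l)) v).
Proof.
move=> Eu Ev /= Eb El le; set top := reg s rTOP.
rewrite Eu Ev in Eb El.
set T := 100 * _.
have leT : (2 + (3 + (4 + (6 + (8 + (20 * l.+1 + (3 + 4).+1).+1).+1).+1).+1).+1).+1 <= T.
  by rewrite /T; lia.
apply: (runs_le leT).
do 5 (apply: runs_seq; apply: runs_denote => //).
set s1 := denote _ _.
have J1 : reg s1 rJ = b by rewrite /= Eu Ev.
have F1 : reg s1 rF = b + l by rewrite /= Eu Ev Eb El.
have D1 : reg s1 rD = top.+1 by rewrite /= addn1.
have V1 : reg s1 rV = v by [].
have A1 i : arr s1 aCV i = if i == top then u else arr s aCV i by rewrite /= Eu.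
clearbody s1; apply: runs_seq.
have e1 : reg s1 rF - reg s1 rJ = l by rewrite J1 F1; lia.
have := @runs_copy s1; rewrite e1 D1 F1 J1 => /(_ _ (leq_addr _ _)) r1.
have le1 : b + l <= top.+1 by lia.
apply: (runs_weaken (runs_frame (r1 le1))) => // s2 [[fr2 _] [D2 low2 seg2]].
rewrite D2 in seg2.
apply: runs_seq; apply: runs_denote => //; apply: runs_denote => //.
set s3 := denote _ _.
have D3 : reg s3 rD = top + l.+2 by rewrite /= D2; lia.
have A3 i : arr s3 aCV i = if i == top.+1 + l then v else arr s2 aCV i.
  by rewrite /= D2 fr2 // V1.
clearbody s3; rewrite D3; split=> //.
rewrite seg_recl; last lia.
rewrite A3 ltn_eqF; last lia.
rewrite low2 // A1 eqxx; congr (_ :: _).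
rewrite !addnS -addSn seg_recr ?leq_addr // A3 eqxx; congr rcons.
transitivity (seg (arr s2 aCV) top.+1 (top.+1 + l)).
  by apply: eq_seg => i _ h; rewrite A3 ltn_eqF.
by rewrite seg2; apply: eq_seg => i _ h; rewrite A1 ltn_eqF //; lia.
Qed.

(** At vertex [x], [rOUT] is the weight leaving the earlier vertices and [rIN] the weight entering
    the later ones. Their sum exceeds the number of arcs over [x] by the number of all arcs, which
    [score] subtracts once at the end. Adding the truncated difference to [rQ] takes the maximum. *)
Definition score_cell :=
 (rX <~ Read aCV (Reg rI);;
  aPOS @ Reg rX <~ Sub (Reg rI) (Reg rTOP);;
  rIN <~ Sub (Reg rIN) (Read aIN (Reg rX));;
  rY <~ Add (Reg rOUT) (Reg rIN);;
  rQ <~ Add (Reg rQ) (Sub (Reg rY) (Reg rQ));;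
  rOUT <~ Add (Reg rOUT) (Read aOUT (Reg rX));;
  Incr rI)%prog.

Definition score :=
 (rI <~ Reg rTOP;; rOUT <~ Const 0;; rIN <~ Reg rARCS;; rQ <~ Const 0;;
  While (Sub (Reg rD) (Reg rI)) score_cell;;
  rN <~ Sub (Reg rQ) (Reg rARCS))%prog.

Lemma runs_score s iw ow o : uniq o ->
  seg (arr s aCV) (reg s rTOP) (reg s rD) = o ->
  (forall x, x \in o -> arr s aIN x = iw x /\ arr s aOUT x = ow x) ->
  reg s rARCS = inw iw o ->
  runs score s (100 * (size o).+1) (fun s' =>
    (exists2 q, reg s' rN = q - inw iw o &
       forall K, (q <= K) = fits iw ow K 0 o 0) /\
    (forall i, i < size o -> arr s' aPOS (nth 0 o i) = i)).
Proof.
move=> uo so inout Ea; set top := reg s rTOP in so *; set d := reg s rD in so *.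
have sz : size o = d - top by rewrite -so size_seg.
have leT : (2 + (2 + (2 + (2 +
    ((size o).+1 * (3 + cost score_cell).+1 + 4).+1).+1).+1).+1).+1 <= 100 * (size o).+1.
  by rewrite /=; nia.
apply: (runs_le leT).
do 4 (apply: runs_seq; apply: runs_denote => //).
set s1 := denote _ _; apply: runs_seq.
have nthE i : i < size o -> nth 0 o i = arr s aCV (top + i).
  move=> lt; rewrite -so /seg (nth_map 0) ?size_iota; last lia.
  by rewrite nth_iota //; lia.
(* [o1] has been processed: [rQ] accounts for its vertices, and the remaining [fits] for those of
   [o2]. *)
pose I k s' := exists o1 o2, [/\ o = o1 ++ o2 /\ size o2 = k,
  reg s' rI = top + size o1, reg s' rIN = inw iw o2 /\ reg s' rOUT = outw ow o1,
  forall K, (reg s' rQ <= K) && fits iw ow K (outw ow o1) o2 0 = fits iw ow K 0 o 0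
  & forall i, i < size o1 -> arr s' aPOS (nth 0 o i) = i].
apply: (runs_for (I := I)) => //.
- exists [::], o; split=> //; first by rewrite addn0.
- move=> k s2 [fr fa] [o1 [o2 [[eo sz2] EI [EIN EOUT] EQ pos]]] /= lt.
  have ED : reg s2 rD = d by rewrite fr.
  case: o2 eo sz2 EIN EQ => [|x o2] eo sz2 EIN EQ.
    by rewrite eo cats0 in sz; lia.
  have lto : size o1 < size o by rewrite eo size_cat /=; lia.
  have cv : arr s2 aCV (reg s2 rI) = x.
    by rewrite fa // EI -nthE // eo nth_cat ltnn subnn.
  have [xi xo] : arr s2 aIN x = iw x /\ arr s2 aOUT x = ow x.
    by rewrite !fa //; apply: inout; rewrite eo mem_cat inE eqxx orbT.
  exists k.-1; first by rewrite -sz2.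
  have TT : reg s2 rTOP = top by rewrite fr.
  have IN2 : reg s2 rIN - iw x = inw iw o2 by rewrite EIN [inw _ _]/(_ + inw iw o2) addKn.
  exists (rcons o1 x), o2; split.
  + by rewrite cat_rcons; split=> //; rewrite -sz2.
  + by rewrite /= EI size_rcons addn1 addnS.
  + rewrite /= cv xi xo IN2 EOUT; split=> //.
    by rewrite -cats1 outw_cat /outw /= addn0.
  + move=> K; have ox : outw ow [:: x] = ow x by rewrite /outw /= addn0.
    rewrite -EQ /= cv xi IN2 EOUT -cats1 outw_cat ox andbA addn0; congr (_ && _).
    set a := outw _ _; set b := inw _ _.
    by apply/idP/andP => [|[]]; lia.
  + move=> i; rewrite size_rcons ltnS leq_eqVlt => /predU1P[->|lti].
      by rewrite /= cv eo nth_cat ltnn subnn /= eqxx EI TT addKn.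
    rewrite /= cv (_ : nth 0 o i == x = false) ?pos //.
    have xE : x = nth 0 o (size o1) by rewrite eo nth_cat ltnn subnn.
    rewrite xE nth_uniq //; last lia.
    by rewrite ltn_eqF.
- move=> k s2 [fr fa] [o1 [o2 [[eo sz2] EI [EIN EOUT] EQ pos]]] /= e.
  have ED : reg s2 rD = d by rewrite fr.
  have o20 : o2 = [::].
    by apply: size0nil; have := congr1 size eo; rewrite size_cat; lia.
  rewrite o20 cats0 in eo; rewrite -eo in pos.
  apply: runs_denote => //; split=> //=.
  exists (reg s2 rQ); first by rewrite (fr rARCS) //= Ea.
  by move=> K; rewrite -EQ o20 andbT.
Qed.

(** * The whole program *)

(** The input does not mark the terminals. After the loop only the source has an out-neighbour and
    only the sink an in-neighbour, so two scans of the degree tables find them. *)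
Definition whole :=
 (init;;
  While (Reg rLEFT) step;;
  search rU (Read aDO (Reg rX));;
  search rV (Read aDI (Reg rX));;
  list_order;;
  score)%prog.

Lemma psum_exchange (g : nat -> nat -> nat) m k :
  psum (fun x => psum (g x) m) k = psum (fun y => psum (g^~ y) k) m.
Proof.
elim: k => [|k IH]; first by rewrite /psum /=; elim: (iota 0 m).
rewrite psumS IH; elim: m {IH} => // m IH.
by rewrite !psumS -IH; lia.
Qed.

Section Whole.
Variables (n : nat) (M : nat -> nat -> nat) (f : nat -> nat) (s t : nat) (l : seq nat).

Definition adjacent : rel nat := fun x y => [&& x < n, y < n & M x y != 0].
Definition indegree y := psum (M^~ y) n.
Definition outdegree x := psum (M x) n.

Hypotheses (inc : increasing f adjacent)
  (cover : forall x, x < n -> exists y, adjacent x y || adjacent y x)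
  (el : elimable adjacent s t l) (sz : (size l).+2 = n).

Let V := iota 0 n.
Let reduct_of := reduct indegree outdegree f V adjacent s t.

Lemma exists_order : exists2 o, perm_eq o V & compatible adjacent (@no_chains nat) o.
Proof.
apply: (exists_compatible (f := f)) => // x y /and3P[xn yn _].
by rewrite !mem_iota xn yn.
Qed.

Lemma runs_whole st : reg st rN = n -> (forall x, x != rN -> reg st x = 0) ->
  (forall a, a != aMAT -> forall i, arr st a i = 0) ->
  (forall i j, i < n -> j < n -> arr st aMAT (i * n + j) = M i j) ->
  runs whole st (5000 * n ^ 2) (fun s' => exists o q,
    [/\ perm_eq o V, compatible adjacent (@no_chains nat) o,
        forall o', perm_eq o' V -> compatible adjacent (@no_chains nat) o' ->
          better indegree outdegree o o',
        reg s' rN = q - inw indegree o /\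
        (forall K, (q <= K) = fits indegree outdegree K 0 o 0)
      & forall i, i < n -> arr s' aPOS (nth 0 o i) = i]).
Proof.
move=> En r0 a0 EM; have [o0 po0 co0] := exists_order.
have uV : uniq V by apply: iota_uniq.
have n2 : 2 <= n by rewrite -sz.
set C := _ * n ^ 2.
(* Reading the matrix is quadratic, the loop evaluates its test at most [n - 1] times, and the rest
   is linear. As [n] is at least 2, the lower order terms fit into [5000 * n ^ 2]. *)
have leT : (200 * (n.+1 * n.+1) + ((size l).+1 * (1 + 4000 * n.+1).+1 +
   (22 * n.+1 + (22 * n.+1 + (100 * n.+1 + 100 * n.+1).+1).+1).+1).+1).+1 <= C.
  have szl : size l = n - 2 by rewrite -sz subn2.
  rewrite /C -mulnn szl {C}; nia.
apply: (runs_le leT).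
apply: runs_seq; have /runs_frame r1 := runs_init En r0 a0 EM.
apply: (runs_weaken r1) => //.
move=> s1 [fr1 [[[n1 x1 row1] mat1 [cI cD] [rowO rowD] arcs1] ROW1 left1]] {r1}.
have rep1 : rep n indegree outdegree s1 adjacent (@no_chains nat).
  split=> //.
  - by move=> x xn; rewrite cI // addn0.
  - by move=> x xn; rewrite rowO // xn.
  - by move=> x y xn yn; rewrite mat1 // /adjacent xn yn.
  - move=> y yn; rewrite cD // addn0 /psum sumn_count; apply: eq_in_count => x.
    by rewrite mem_iota /adjacent yn => /= ->.
  - move=> x xn; rewrite rowD // xn /psum sumn_count; apply: eq_in_count => y.
    by rewrite mem_iota /adjacent xn => /= ->.
  - by move=> x y _ _; rewrite !fr1.2 // !a0.
  - by move=> x y _ _; rewrite !fr1.2 // !a0 // addn0 seg_nil.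
have red1 : reduct_of adjacent (@no_chains nat) l.
  apply: reduct_init => //.
  - by move=> x; rewrite mem_iota => /cover.
  - by move=> x y /and3P[xn yn _]; rewrite !mem_iota xn yn.
pose I k s' := exists E L l', [/\ reduct_of E L l', rep n indegree outdegree s' E L,
  reg s' rLEFT = size l' & size l' = k].
apply: runs_seq; apply: (runs_while (I := I)).
- by exists adjacent, (@no_chains nat), l; split=> //; rewrite left1 -sz subn2.
- move=> k s2 _ [E [L [l' [red rs Eleft szl']]]] /= nz.
  exists k.-1; first by rewrite -szl' -Eleft; lia.
  have [tight_ nil disj cov mem incE elE sound dom] := red.
  have mem' x y : E x y -> x < n /\ y < n.
    by move=> /mem; rewrite !mem_iota.
  have [o1 [po1 co1 _]] := dom _ po0 co0.
  (* A compatible order exists and contains every chain as a subsequence; this bounds the chain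
     lengths by [n] and makes each step linear. *)
  have sub x y : size (flatten (L x y)) <= n /\ forall z, z \in flatten (L x y) -> z < n.
    case Exy: (E x y); last by rewrite nil ?Exy.
    have so := co1 _ _ Exy.
    have so' : subseq (flatten (L x y)) o1.
      apply: subseq_trans so; rewrite -cat1s -cats1.
      by apply: subseq_trans (suffix_subseq _ _); apply: prefix_subseq.
    split; first by have := size_subseq so'; rewrite (perm_size po1) size_iota.
    by move=> z /(mem_subseq so'); rewrite (perm_mem po1) mem_iota.
  have [|||||||] := @runs_step n indegree outdegree s2 E L rs.
  - case: l' red elE Eleft {szl'} => [|v l'] _ /=; first by move=> _ e; rewrite e in nz.
    by case=> _ _ [u [w lg]] _ _; exists v, u, w.
  - move=> x y Exy; have [xn yn] := mem' _ _ Exy; split=> //.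
    by apply/eqP => e; have := incE _ _ Exy; rewrite e ltnn.
  - move=> x y Exy; apply/negP => Eyx.
    by have := ltn_trans (incE _ _ Exy) (incE _ _ Eyx); rewrite ltnn.
  - exact: nil.
  - by move=> x y; have [] := tight_ x y.
  - by move=> x y; have [] := sub x y.
  - by move=> x y z; have [_] := sub x y; apply.
  move=> s3 [t3 [ex3 le3 [v [u [w [B [lg fB [tB sB] rs3 left3]]]]]]].
  exists s3, t3; split=> //.
  have [l2 [szl2 red2]] := reduct_step uV red lg fB tB sB.
  exists (elim E v), (reduce_chains indegree outdegree E L v u w B), l2.
  by split=> //; rewrite ?left3 ?Eleft -?szl' szl2.
- move=> k s2 fr2 [E [L [l' [red rs Eleft szl']]]] /= z.
  have l'0 : l' = [::] by apply: size0nil; rewrite -Eleft.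
  rewrite {}l'0 in red.
  have [tight_ nil disj cov mem incE /= elE sound dom] := red.
  have sE : E s t by rewrite elE !eqxx.
  have [sn tn] : s < n /\ t < n by move: (mem _ _ sE); rewrite !mem_iota.
  have [o [po co bo]] := dom _ po0 co0.
  have eo := reduct_single uV red po co.
  have uo : uniq o by rewrite (perm_uniq po).
  have szo : size o = n by rewrite (perm_size po) size_iota.
  have cnt p x : x < n -> (forall y, p y = (y == x)) -> count p (iota 0 n) = 1.
    move=> xn e; rewrite (eq_count (a2 := pred1 x)) //.
    by rewrite count_uniq_mem ?iota_uniq // mem_iota xn.
  have n2' := rep_n rs.
  have outE x : x < n -> (arr s2 aDO x != 0) = (x == s).
    move=> xn; rewrite (rep_outdeg rs) //; case: (eqVneq x s) => [->|xs].
      by rewrite (cnt _ t) // => y; rewrite elE eqxx.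
    by rewrite (@eq_count _ _ pred0) ?count_pred0 // => y; rewrite elE (negbTE xs).
  have inE' x : x < n -> (arr s2 aDI x != 0) = (x == t).
    move=> xn; rewrite (rep_indeg rs) //; case: (eqVneq x t) => [->|xt].
      by rewrite (cnt _ s) // => y; rewrite /= elE eqxx andbT.
    by rewrite (@eq_count _ _ pred0) ?count_pred0 // => y; rewrite /= elE (negbTE xt) andbF.
  apply: runs_seq.
  have /runs_frame r3 : runs (search rU (Read aDO (Reg rX))) s2 (22 * n.+1)
      (fun s' => reg s' rU < n /\ pred1 s (reg s' rU)).
    apply: (@runs_search _ _ _ (pred1 s)) => //; first by exists s => //=.
    by move=> s' _ fa xn; rewrite /= fa outE.
  apply: (runs_weaken r3) => // s3 [fr3 [_ /eqP U3]] {r3}.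
  have rs3 : rep n indegree outdegree s3 E L.
    by apply: (rep_frame rs fr3) => // i _; rewrite /cell !fr3.2.
  apply: runs_seq.
  have /runs_frame r4 : runs (search rV (Read aDI (Reg rX))) s3 (22 * n.+1)
      (fun s' => reg s' rV < n /\ pred1 t (reg s' rV)).
    apply: (@runs_search _ _ _ (pred1 t)) => //; first exact: rep_n rs3.
      by exists t => //=.
    by move=> s' _ fa xn; rewrite /= fa fr3.2 // inE'.
  apply: (runs_weaken r4) => // s4 [fr4 [_ /eqP V4]] {r4}.
  have rs4 : rep n indegree outdegree s4 E L.
    by apply: (rep_frame rs3 fr4) => // i _; rewrite /cell !fr4.2.
  have U4 : reg s4 rU = s by rewrite fr4.1.
  have at4 a : eval s4 (Pair a RU RV) = arr s4 a (s * n + t).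
    by rewrite /= U4 V4 (rep_row rs4).
  have bd4 := rep_bound rs4 sn tn; have ch4 := rep_chain rs4 sn tn.
  have len4 : arr s4 aLEN (s * n + t) = size (flatten (L s t)).
    by rewrite -(size_cells indegree outdegree) -ch4 size_seg addKn.
  have szL : (size (flatten (L s t))).+2 = n by rewrite -szo eo /= size_rcons.
  apply: runs_seq.
  have /runs_frame r5 := runs_list_order U4 V4 (at4 aBASE) (at4 aLEN) bd4.
  apply: (runs_weaken r5); first by rewrite len4; lia.
  move=> s5 [fr5 [D5 seg5]] {r5}.
  have seg5' : seg (arr s5 aCV) (reg s5 rTOP) (reg s5 rD) = o.
    rewrite eo -(cells_vertices indegree outdegree) -ch4 map_seg -[RHS]seg5.
    by rewrite fr5.1.
  have io x : x \in o -> arr s5 aIN x = indegree x /\ arr s5 aOUT x = outdegree x.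
    rewrite (perm_mem po) mem_iota => /= xn.
    by rewrite !fr5.2 // (rep_in rs4) ?(rep_out rs4).
  have arcs5 : reg s5 rARCS = inw indegree o.
    rewrite fr5.1 // fr4.1 // fr3.1 // fr2.1 // arcs1 [psum _ 0]/= addn0.
    by rewrite /arcs psum_exchange (perm_inw _ po).
  apply: (runs_weaken (runs_score uo seg5' io arcs5)); first by rewrite szo.
  move=> s6 [[q Eq qK] pos]; exists o, q; split=> //.
  + exact: sound.
  (* Domination turns [o'] into a compatible order that is no worse, and the only compatible order
     is [o]. *)
  + move=> o' po' co'; have [o2 [po2 co2 bo2]] := dom _ po' co'.
    by rewrite eo -(reduct_single uV red po2 co2).
  + by rewrite -szo.
Qed.
End Whole.

(** * Orders of a digraph *)

Lemma nth_allpairs (S T R : Type) (h : S -> T -> R) d x0 y0 s t i j :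
  i < size s -> j < size t ->
  nth d [seq h x y | x <- s, y <- t] (i * size t + j) = h (nth x0 s i) (nth y0 t j).
Proof.
move=> + jt; elim: s i => // x s IH [|i] lt; rewrite allpairs_cons nth_cat size_map.
  by rewrite mul0n jt (nth_map y0).
by rewrite mulSn -addnA ltnNge leq_addr addKn IH.
Qed.

Lemma subseq2P (T : eqType) (x y : T) o : uniq o -> x \in o -> y \in o ->
  subseq [:: x; y] o = (index x o < index y o).
Proof.
move=> + /splitPr xo; case: xo => p q; rewrite cat_uniq /= negb_or.
move=> /and3P[_ /andP[xp dis] /andP[xq _]] yo.
have ix : index x (p ++ x :: q) = size p.
  by rewrite index_cat (negbTE xp) /= eqxx addn0.
move: yo; rewrite ix index_cat mem_cat inE; case: (boolP (y \in p)) => yp /=.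
  move=> _; rewrite ltnNge ltnW ?index_mem //; apply/negP => sub.
  have yq : y \in q by rewrite -sub1seq; apply: subseq_after sub.
  by case/hasP: dis; exists y.
case: (eqVneq y x) => [->|yx] /= => [_|yq].
  rewrite addn0 ltnn; apply/negP => sub.
  by case/negP: xq; rewrite -sub1seq; apply: subseq_after sub.
rewrite addnS ltnS leq_addr; apply: subseq_trans (suffix_subseq _ _).
by rewrite /= eqxx sub1seq.
Qed.

Lemma in_drop_uniq (T : eqType) (x : T) s k : uniq s -> x \in s ->
  (x \in drop k s) = (k <= index x s).
Proof.
move=> us xs; rewrite leqNgt -in_take //; move: us xs.
rewrite -{1 2}(cat_take_drop k s) cat_uniq mem_cat => /and3P[_ /hasPn dis _].
by case: (boolP (x \in drop k s)) => [/dis/negbTE->|_] //=; rewrite orbF => ->.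
Qed.

Lemma fitsP (T : eqType) (iw ow : T -> nat) K i o b :
  reflect (forall k, k < size o ->
     i + outw ow (take k o) + (inw iw (drop k.+1 o) + b) <= K) (fits iw ow K i o b).
Proof.
elim: o i => [|x o IH] i /=; first by constructor.
apply: (iffP andP) => [[h /IH H] [|k] lt|H].
- by rewrite drop0 addn0 addnA.
- by have := H k lt; rewrite /outw /=; lia.
- split; first by have := H 0 isT; rewrite /= drop0 addn0 addnA.
  by apply/IH => k lt; have := H k.+1 lt; rewrite /outw /=; lia.
Qed.

Lemma sum_fibers (A : finType) (T : eqType) (P : pred A) (h : A -> T) s : uniq s ->
  sumn [seq #|[set a | P a && (h a == y)]| | y <- s] = #|[set a | P a && (h a \in s)]|.
Proof.
elim: s => [_|y s IH] /=.
  by apply/esym/eqP; rewrite cards_eq0; apply/eqP/setP => a; rewrite !inE andbF.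
move=> /andP[ys /IH->].
rewrite -[RHS](cardsID [set a | h a == y]); congr (_ + _); apply: eq_card => a.
  rewrite !inE; case: (P a); case: (h a == y); rewrite ?orbT ?andbF //.
rewrite !inE; case: (P a); rewrite /= ?andbF //.
by case: (eqVneq (h a) y) => //= ->; rewrite (negbTE ys).
Qed.

Section Digraph.
Variable G : digraph.
Local Notation n := #|vertex G|.

Definition rank (u : vertex G) : nat := enum_rank u.

Lemma rank_inj : injective rank.
Proof. by move=> u v /val_inj/enum_rank_inj. Qed.

Lemma rank_lt u : rank u < n.
Proof. exact: ltn_ord. Qed.

Lemma rank_onto i : i < n -> exists u, i = rank u.
Proof.
move=> lt; exists (enum_val (Ordinal lt)); by rewrite /rank enum_valK.
Qed.

Definition entry i j :=
  #|[set a : arc G | (rank (tail a) == i) && (rank (head a) == j)]|.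

Lemma entry_rank u v : entry (rank u) (rank v) = multiplicity u v.
Proof. by apply: eq_card => a; rewrite !inE !(inj_eq rank_inj). Qed.

Lemma adjacent_rank u v : adjacent n entry (rank u) (rank v) = edge u v.
Proof. by rewrite /adjacent !rank_lt entry_rank -lt0n. Qed.

Lemma input_entry i j : i < n -> j < n ->
  arr (input G) 0 (i * n + j) = entry i j.
Proof.
move=> /rank_onto[u ->] /rank_onto[v ->]; rewrite entry_rank /=.
have := @nth_allpairs _ _ _ (@multiplicity G) 0 u u (enum (vertex G)) (enum (vertex G))
  (rank u) (rank v).
rewrite -cardE => ->; try exact: rank_lt.
by rewrite !nth_enum_rank.
Qed.

Lemma outdegree_card x : x < n ->
  outdegree n entry x = #|[set a : arc G | rank (tail a) == x]|.
Proof.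
move=> xn; rewrite /outdegree /psum sum_fibers ?iota_uniq //.
by apply: eq_card => a; rewrite !inE mem_iota add0n rank_lt leq0n !andbT.
Qed.

Lemma indegree_card y : y < n ->
  indegree n entry y = #|[set a : arc G | rank (head a) == y]|.
Proof.
move=> yn; rewrite /indegree /psum.
rewrite (eq_map (g := fun x => #|[set a : arc G | (rank (head a) == y) && (rank (tail a) == x)]|)).
  rewrite sum_fibers ?iota_uniq //.
  by apply: eq_card => a; rewrite !inE mem_iota add0n rank_lt leq0n !andbT.
by move=> x; apply: eq_card => a; rewrite !inE andbC.
Qed.

Lemma outw_card s : uniq s -> all (gtn n) s ->
  outw (outdegree n entry) s = #|[set a : arc G | rank (tail a) \in s]|.
Proof.
move=> us /allP sn; rewrite -(sum_fibers xpredT) //; congr sumn.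
by apply/eq_in_map => x /sn xn; rewrite outdegree_card.

Qed.

Lemma inw_card s : uniq s -> all (gtn n) s ->
  inw (indegree n entry) s = #|[set a : arc G | rank (head a) \in s]|.
Proof.
move=> us /allP sn; rewrite -(sum_fibers xpredT) //; congr sumn.
by apply/eq_in_map => x /sn xn; rewrite indegree_card.
Qed.

Section Order.
Variables (o : seq nat) (sigma : {ffun vertex G -> 'I_n}).
Hypotheses (po : perm_eq o (iota 0 n))
  (sigmaE : forall u, index (rank u) o = sigma u).

Let uo : uniq o.
Proof. by rewrite (perm_uniq po) iota_uniq. Qed.

Let mo u : rank u \in o.
Proof. by rewrite (perm_mem po) mem_iota rank_lt. Qed.

Let so : size o = n.
Proof. by rewrite (perm_size po) size_iota. Qed.

Lemma topological_compatible :
  topological sigma <-> compatible (adjacent n entry) (@no_chains nat) o.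
Proof.
split=> [/and3P[_ _ /forallP inc] x y|co].
  case/and3P=> /rank_onto[u ->] /rank_onto[v ->].
  rewrite entry_rank cards_eq0 => /set0Pn[a].
  rewrite inE => /andP[/eqP<- /eqP<-].
  by rewrite /= subseq2P // !sigmaE inc.
have inj : injective sigma.
  move=> u v e; apply: rank_inj; rewrite -(nth_index 0 (mo u)) -(nth_index 0 (mo v)).
  by rewrite !sigmaE e.
apply/and3P; split; first exact/injectiveP.
  have [g _ gK] := inj_card_bij inj (eq_leq (card_ord _)).
  by apply/forallP => i; apply/codomP; exists (g i).
apply/forallP => a; have := co (rank (tail a)) (rank (head a)).
rewrite /adjacent !rank_lt /= subseq2P // !sigmaE; apply.
by rewrite entry_rank cards_eq0; apply/set0Pn; exists a; rewrite inE !eqxx.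
Qed.

Lemma inw_arcs : inw (indegree n entry) o = #|arc G|.
Proof.
rewrite inw_card //; last first.
  by apply/allP => x; rewrite (perm_mem po) mem_iota.
by rewrite -cardsT; apply: eq_card => a; rewrite !inE mo.
Qed.

(** In a topological order every arc starts before position [i] or ends after it, and it does both
    exactly when it passes over [i]. Counting the union and the intersection of these two sets of
    arcs gives the identity. *)
Lemma crossing_arcs (i : 'I_n) : topological sigma ->
  #|[set a : arc G | (sigma (tail a) < i) && (i < sigma (head a))]| + #|arc G| =
  outw (outdegree n entry) (take i o) + inw (indegree n entry) (drop i.+1 o).
Proof.
case/and3P=> _ _ /forallP inc.
have on : all (gtn n) o by apply/allP => x; rewrite (perm_mem po) mem_iota.
have [tn dn] : all (gtn n) (take i o) /\ all (gtn n) (drop i.+1 o).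
  by split; [have := on; rewrite -{1}(cat_take_drop i o)|have := on;
    rewrite -{1}(cat_take_drop i.+1 o)]; rewrite all_cat => /andP[].
rewrite outw_card ?take_uniq // inw_card ?drop_uniq //.
rewrite -cardsUI addnC -cardsT; congr (_ + _); apply: eq_card => a; rewrite !inE;
  rewrite in_take // in_drop_uniq // !sigmaE //.
by have := inc a; lia.
Qed.

(** The shift by [#|arc G|] comes from [crossing_arcs] and is common to all orders, so comparing
    [fits] compares cutwidths. *)
Lemma order_mcw_fits K : topological sigma ->
  (order_mcw sigma + #|arc G| <= K) =
  fits (indegree n entry) (outdegree n entry) K 0 o 0.
Proof.
(* The bound [#|arc G| <= K] is obtained at position 0; without vertices there is no such position,
   but there are no arcs either. *)
move=> top; have n0 : 0 < n \/ #|arc G| = 0.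
  case: (posnP #|arc G|) => [->|/card_gt0P[a _]]; [by right|left].
  exact: leq_ltn_trans (rank_lt (tail a)).
apply/idP/fitsP => [le k|H].
  rewrite so => kn; rewrite add0n addn0 -(crossing_arcs (Ordinal kn) top).
  apply: leq_trans le; rewrite leq_add2r.
  exact: (leq_bigmax (Ordinal kn)).
have bound (i : 'I_n) :
    #|[set a : arc G | (sigma (tail a) < i) && (i < sigma (head a))]| + #|arc G| <= K.
  by have := H i; rewrite so ltn_ord add0n addn0 -(crossing_arcs i top); apply.
have leK : #|arc G| <= K.
  case: n0 => [n0|->//]; apply: leq_trans (bound (Ordinal n0)).
  exact: leq_addl.
suff : order_mcw sigma <= K - #|arc G| by lia.
by apply/bigmax_leqP => i _; have := bound i; lia.
Qed.

End Order.

Lemma order_of_list o : perm_eq o (iota 0 n) ->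
  exists sigma : {ffun vertex G -> 'I_n}, forall u, index (rank u) o = sigma u.
Proof.
move=> po; have lt u : index (rank u) o < n.
  by rewrite -[X in _ < X](size_iota 0) -(perm_size po) index_mem (perm_mem po) mem_iota rank_lt.
by exists [ffun u => Ordinal (lt u)] => u; rewrite ffunE.
Qed.

Lemma list_of_order (sigma : {ffun vertex G -> 'I_n}) : topological sigma ->
  exists2 o, perm_eq o (iota 0 n) & forall u, index (rank u) o = sigma u.
Proof.
case/and3P=> /injectiveP inj _ _.
have [g gK Kg] := inj_card_bij inj (eq_leq (card_ord _)).
pose o := [seq rank (g i) | i <- enum 'I_n]; exists o.
  apply: uniq_perm; rewrite ?iota_uniq //.
    by rewrite map_inj_uniq ?enum_uniq // => i j /rank_inj/(can_inj Kg).
  move=> x; rewrite mem_iota add0n /=; apply/mapP/idP => [[i _ ->]|/rank_onto[u ->]].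
    exact: rank_lt.
  by exists (sigma u); rewrite ?mem_enum // gK.
move=> u; rewrite /o -{1}(gK u) (index_map (f := fun i => rank (g i))).
  exact: index_enum_ord.
by move=> i j /rank_inj/(can_inj Kg).
Qed.

End Digraph.

(** The program sees vertices as numbers. Passing to ranks is a gluing with no further arcs. *)
Lemma SPD_adjacent (G : tdigraph) : SPD G ->
  exists f s t l,
    let E := adjacent #|vertex G| (@entry G) in
    [/\ increasing f E,
        forall x, x < #|vertex G| -> exists y, E x y || E y x,
        elimable E s t l & (size l).+2 = #|vertex G|].
Proof.
move=> /SPD_eliminable[l [f [sz el inc _ [_ cov]]]].
have adj (u v : vertex G) : adjacent #|vertex G| (@entry G) (rank u) (rank v) = edge u v.
  exact: adjacent_rank.
exists (fun i => f (nth (source G) (enum (vertex G)) i)), (rank (source G)), (rank (sink G)).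
exists (map (@rank G) l ++ [::]) => E; split.
- move=> x y exy; have [xn yn _] := and3P exy.
  have [u ex] := rank_onto xn; have [v ey] := rank_onto yn; subst x y.
  by rewrite /rank !nth_enum_rank; apply: inc; rewrite -adj.
- move=> x /rank_onto[u ->]; have [v uv] := cov u; exists (rank v).
  by rewrite /E !adj.
- have [sl tl] := elimable_internal el.
  apply: (elimable_glued (@rank_inj G) (R := fun _ _ => False) _ el).
  + move=> x y; split=> [exy|[[u [v [-> ->]]]|//]]; last by rewrite /E adj.
    have [xn yn _] := and3P exy; left.
    have [u ex] := rank_onto xn; have [v ey] := rank_onto yn; subst x y.
    by exists u, v; rewrite -adj.
  + by move=> v _ x; split.
  + by rewrite mem_map //; apply: rank_inj.
  + by rewrite mem_map //; apply: rank_inj.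
  + move=> F FE x y; apply/idP/andP => [/FE[[-> ->]|//]|[/eqP-> /eqP->]]; first by rewrite !eqxx.
    by apply/FE; left.
- by rewrite cats0 size_map.
Qed.

Theorem theorem4p9 :
  exists (p : prog) (C : nat),
    forall G : tdigraph, SPD G ->
      exists (s : state) (t : nat)
             (sigma : {ffun vertex G -> 'I_#|vertex G|}),
        [/\ exec p (input G) s t,
            t <= C * #|vertex G| ^ 2,
            output s (mcw G) sigma,
            topological sigma
          & order_mcw sigma = mcw G].
Proof.
exists whole, 5000 => G /SPD_adjacent[f [s0 [t0 [l [inc cov el sz]]]]].
have [||||s [t [ex le [o [q [po co best [Ew Eq] pos]]]]]] :=
  @runs_whole _ (@entry G) f s0 t0 l inc cov el sz (input G).
- by [].
- by move=> x /negbTE /= ->.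
- by move=> a /negbTE /= ->.
- exact: input_entry.
have [sigma sE] := order_of_list po.
have top : topological sigma by apply/(topological_compatible po sE).
have score := order_mcw_fits po sE _ top.
have opt : order_mcw sigma = mcw G.
  apply/eqP; rewrite eqn_leq mcw_le // andbT.
  have [sigma1 top1 <-] := mcw_attained top.
  have [o1 po1 sE1] := list_of_order top1.
  have co1 := (topological_compatible po1 sE1).1 top1.
  rewrite -(leq_add2r #|arc G|) score; apply: (best o1 po1 co1).
  exact: etrans (esym (order_mcw_fits po1 sE1 _ top1)) (leqnn _).
exists s, t, sigma; split=> //; split; last first.
  move=> u; rewrite -sE; have := pos (index (rank u) o).
  rewrite nth_index; last by rewrite (perm_mem po) mem_iota rank_lt.
  by apply; rewrite sE.
rewrite Ew inw_arcs // -opt.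
(* Both numbers lie below the same bounds [K], hence they are equal. *)
suff -> : q = order_mcw sigma + #|arc G| by rewrite addnK.
by apply/eqP; rewrite eqn_leq Eq -score leqnn score -Eq leqnn.
Qed.
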